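(* Let $A\in\mathbb{R}^{n\times n}$ and $b\in\mathbb{R}^n$ be such that $(A,b)$ satisfies the Kalman rank condition. There exists $T_0>0$ such that, for every $T\in(0,T_0)$, the eigenvalues of the controllability Gramian $G_T(A,b)$ satisfy $\lambda_1(T)>\cdots>\lambda_n(T)>0$ and, for every $k\in\{1,\ldots,n\}$, the eigenspace associated with $\lambda_k(T)$ is not orthogonal to $q_k$. For $T\in(0,T_0)$, let $\psi_k(T)$ be the unit eigenvector associated with $\lambda_k(T)$ and oriented by $\langle\psi_k(T),q_k\rangle>0$, and let $\Pi_k(T)$ be the orthogonal projector onto $\operatorname{span}(\psi_1(T),\ldots,\psi_k(T))$, with $\Pi_0(T)=0$ and $\Pi_n(T)=\mathrm{Id}$. (i) For every $k\in\{1,\ldots,n\}$, the function $T^{-(2k-1)}\lambda_k(T)$ extends to a real-analytic function on a neighborhood of $T=0$, and, as $T\to0^+$, $$\lambda_k(T)=\kappa_k\,d_k(A,b)^2\,T^{2k-1}\,(1+a_kT+\mathrm{O}(T^2)).$$ (ii) For every $k\in\{1,\ldots,n-1\}$, $\Pi_k(T)$ extends real analytically to a neighborhood of $T=0$ and, as $T\to0^+$, $$\Pi_k(T)=\Pi_{\mathcal{K}_k(A,b)}+\frac{T}{2}\beta_k\big(q_{k+1}q_k^\top+q_kq_{k+1}^\top\big)+\mathrm{O}(T^2).$$ (iii) For every $k\in\{1,\ldots,n\}$, the eigenvectors $\psi_k(T)$ extend real analytically to a neighborhood of $T=0$ and satisfy, as $T\to0^+$, $$\psi_k(T)=q_k+\frac{T}{2}\big(\beta_kq_{k+1}-\beta_{k-1}q_{k-1}\big)+\mathrm{O}(T^2),$$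 where the nonexistent terms for $k=1$ and $k=n$ are omitted. (iv) More precisely, near every controllable pair $(A_0,b_0)\in\mathcal{C}$, the normalized eigenvalues $T^{-(2k-1)}\lambda_k(T)$, the spectral projectors $\Pi_k(T)$ and the oriented eigenvectors $\psi_k(T)$ extend jointly real analytically in $(T,A,b)$ to a neighborhood of $(0,A_0,b_0)$. For a given compact $K\subset\mathcal{C}$, there exist $T_K>0$ and an open neighborhood $U_K\subset\mathcal{C}$ of $K$ such that these extensions are jointly real analytic on $(-T_K,T_K)\times U_K$ and, for every $(A,b)\in K$, their Taylor series in $T$ at zero converge for $|T|<T_K$. After decreasing $T_K$ if necessary, the eigenvalues are simple and strictly ordered for every $(A,b)\in K$ and every $T\in(0,T_K)$, and all the remainders $\mathrm{O}(T^2)$ in (i), (ii), (iii) are uniform on $K$.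
   Context: $\langle\cdot,\cdot\rangle$ is the Euclidean scalar product on $\mathbb{R}^n$ and $\|\cdot\|$ its norm; $\Pi_E$ is the orthogonal projector onto a subspace $E$. The pair $(A,b)\in\mathbb{R}^{n\times n}\times\mathbb{R}^n$ satisfies the Kalman rank condition (is controllable) if $\operatorname{rank}(b,Ab,\ldots,A^{n-1}b)=n$; $\mathcal{C}$ denotes the open set of controllable pairs. For $T>0$, the controllability Gramian is $G_T(A,b)=\int_0^Te^{tA}bb^\top e^{tA^\top}\,dt$, with eigenvalues ordered decreasingly, $\lambda_1(T)\ge\cdots\ge\lambda_n(T)>0$ (for controllable $(A,b)$). Krylov data, for $(A,b)\in\mathcal{C}$: $\mathcal{K}_k(A,b)=\operatorname{span}(b,Ab,\ldots,A^{k-1}b)$ for $k\in\{1,\ldots,n\}$, $\mathcal{K}_0(A,b)=\{0\}$. The orthonormal basis $(q_1,\ldots,q_n)$ is the one obtained by Gram–Schmidt from $b,Ab,\ldots,A^{n-1}b$, characterized by $q_k\in\mathcal{K}_k(A,b)$, $q_k\perp\mathcal{K}_{k-1}(A,b)$, $d_k(A,b):=\langle q_k,A^{k-1}b\rangle>0$. Equivalently $d_1(A,b)=\|b\|$ and $d_k(A,b)=\operatorname{dist}(A^{k-1}b,\mathcal{K}_{k-1}(A,b))$ for $k\ge2$. Set $a_k=\langle q_k,Aq_k\rangle$ for $k\in\{1,\ldots,n\}$; $\beta_k=\langle q_{k+1},Aq_k\rangle=d_{k+1}(A,b)/d_k(A,b)>0$ for $k\in\{1,\ldots,n-1\}$;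 $\beta_0=\beta_n=0$. Finally $$\kappa_k=\frac{((k-1)!)^2}{(2k-1)!\,(2k-2)!},\qquad k\in\{1,\ldots,n\}.$$ *)

(* Defs.v *)
From HB Require Import structures.
From mathcomp Require Import all_boot all_order all_algebra.
From mathcomp Require Import all_classical all_reals all_analysis.

Set Implicit Arguments.
Unset Strict Implicit.
Unset Printing Implicit Defensive.
Import Order.TTheory GRing.Theory Num.Theory.
Import numFieldNormedType.Exports.

Local Open Scope classical_set_scope.
Local Open Scope ring_scope.

Section Euclidean.
Variables (R : realType) (n : nat).
Implicit Types (u v : 'cV[R]_n) (E : {vspace 'cV[R]_n}) (M : 'M[R]_n).

Definition dotv u v : R := \sum_i u i 0 * v i 0.

Definition enorm v : R := Num.sqrt (dotv v v).

Definition is_orthoproj E M : Prop :=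
  forall x, M *m x \in E /\ (forall y, y \in E -> dotv y (x - M *m x) = 0).

Definition orthoproj E : 'M[R]_n := xget 0 [set M | is_orthoproj E M].

(* The eigenvalues with multiplicity in decreasing order, as the roots of the
   characteristic polynomial.  Only used for M symmetric, where this list
   exists and is unique. *)
Definition eigenvalues M : seq R :=
  xget [::] [set s | char_poly M = \prod_(z <- s) ('X - z%:P) /\
                     sorted (fun x y => y <= x) s].

Definition expmx M : 'M[R]_n :=
  limn (series (fun k : nat => (k`!%:R)^-1 *: M ^+ k)).

End Euclidean.

(* Throughout, subscripts k are natural numbers starting at 1, as in the
   usual notation: krylov A b 0 = 0, and eigval, krylov_basis, ... are only
   meaningful for 1 <= k <= n. *)
Section Krylov.
Variables (R : realType) (n : nat) (A : 'M[R]_n) (b : 'cV[R]_n).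
Implicit Type k : nat.

Definition controllable : Prop :=
  \rank (\matrix_(i < n, j < n) (A ^+ j *m b) i 0) = n.

Definition krylov k : {vspace 'cV[R]_n} :=
  <<[seq A ^+ i *m b | i <- iota 0 k]>>%VS.

(* The Gram-Schmidt orthonormalization q_1, ..., q_n of b, ..., A^(n-1) b. *)
Definition krylov_basis k : 'cV[R]_n :=
  let w := A ^+ k.-1 *m b in
  let r := w - orthoproj (krylov k.-1) *m w in
  (enorm r)^-1 *: r.

Definition krylov_d k : R := dotv (krylov_basis k) (A ^+ k.-1 *m b).

Definition krylov_a k : R := dotv (krylov_basis k) (A *m krylov_basis k).

Definition krylov_beta k : R :=
  if (0 < k < n)%N then dotv (krylov_basis k.+1) (A *m krylov_basis k) else 0.

End Krylov.

Definition kappa (R : realType) (k : nat) : R :=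
  (k.-1)`!%:R ^+ 2 / (((2 * k).-1)`!%:R * ((2 * k).-2)`!%:R).

Section Gramian.
Variables (R : realType) (n : nat).
Implicit Types (A : 'M[R]_n) (b : 'cV[R]_n) (T : R) (k : nat).

Definition gramian T A b : 'M[R]_n :=
  \matrix_(i, j) (\int[lebesgue_measure]_(t in `[0, T])
    (expmx (t *: A) *m b *m b^T *m expmx (t *: A^T)) i j)%R.

Definition eigval T A b k : R := nth 0 (eigenvalues (gramian T A b)) k.-1.

Definition is_oriented_eigvec T A b k (v : 'cV[R]_n) : Prop :=
  [/\ gramian T A b *m v = eigval T A b k *: v, enorm v = 1
    & 0 < dotv v (krylov_basis A b k)].

Definition eigvec T A b k : 'cV[R]_n :=
  xget 0 [set v | is_oriented_eigvec T A b k v].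

Definition spectral_proj T A b k : 'M[R]_n :=
  orthoproj <<[seq eigvec T A b j | j <- iota 1 k]>>%VS.

Definition strictly_ordered T A b : Prop :=
  (forall k, (1 <= k < n)%N -> eigval T A b k.+1 < eigval T A b k) /\
  (forall k, (1 <= k <= n)%N -> 0 < eigval T A b k).

Definition eigenspaces_not_orthogonal T A b : Prop :=
  forall k, (1 <= k <= n)%N ->
  exists v : 'cV[R]_n, gramian T A b *m v = eigval T A b k *: v /\
                       dotv v (krylov_basis A b k) != 0.

Definition normalized_eigval T A b k : R := eigval T A b k / T ^+ (2 * k).-1.

Definition eigval_remainder T A b k : R :=
  eigval T A b k / (kappa R k * krylov_d A b k ^+ 2 * T ^+ (2 * k).-1)
  - (1 + krylov_a A b k * T).

Definition spectral_proj_remainder T A b k : 'M[R]_n :=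
  let q := krylov_basis A b in
  spectral_proj T A b k
  - (orthoproj (krylov A b k)
     + (T / 2 * krylov_beta A b k) *: (q k.+1 *m (q k)^T + q k *m (q k.+1)^T)).

(* For k = 1 and k = n the terms without a meaning vanish because
   krylov_beta A b 0 = krylov_beta A b n = 0. *)
Definition eigvec_remainder T A b k : 'cV[R]_n :=
  let q := krylov_basis A b in let beta := krylov_beta A b in
  eigvec T A b k
  - (q k + (T / 2) *: (beta k *: q k.+1 - beta k.-1 *: q k.-1)).

End Gramian.

Section Analytic.
Variables (R : realType) (X : Type) (I : finType) (coord : I -> X -> R).

(* The sum of c_alpha h^alpha over the multi-indices alpha with |alpha| = k. *)
Definition homogeneous_part (c : {ffun I -> nat} -> R) (h : I -> R) (k : nat) :
    R :=
  \sum_(alpha : {ffun I -> 'I_k.+1} | ((\sum_i alpha i) == k)%N)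
    c [ffun i => alpha i : nat] * \prod_i h i ^+ alpha i.

(* X is a finite-dimensional space with linear coordinates (coord i)_i.  On an
   open set U, f is real analytic iff near each x in U it is the sum of a
   multivariate power series converging absolutely on a polydisc around x. *)
Definition analytic_on (U : set X) (f : X -> R) : Prop :=
  forall x, U x ->
  exists (c : {ffun I -> nat} -> R) (r : R),
  [/\ 0 < r,
      cvgn (series (homogeneous_part (fun alpha => `|c alpha|) (fun=> r)))
    & forall y, (forall i, `|coord i y - coord i x| < r) ->
      series (homogeneous_part c (fun i => coord i y - coord i x)) @ \oo
        --> f y].

(* F is analytic on U and extends the restriction of f to U `&` D. *)
Definition analytic_extension (U D : set X) (f F : X -> R) : Prop :=
  analytic_on U F /\ (forall x, U x -> D x -> F x = f x).

Definition mx_analytic_extension (p m : nat) (U D : set X)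
    (f F : X -> 'M[R]_(p, m)) : Prop :=
  forall i j, analytic_extension U D (fun x => f x i j) (fun x => F x i j).

End Analytic.

Definition coord1 (R : realType) (_ : unit) (t : R) : R := t.

Definition coord3 (R : realType) (n : nat)
    (l : unit + ('I_n * 'I_n + 'I_n)) (x : R * ('M[R]_n * 'cV[R]_n)) : R :=
  match l with
  | inl _ => x.1
  | inr (inl ij) => x.2.1 ij.1 ij.2
  | inr (inr i) => x.2.2 i 0
  end.

Section JointExtension.
Variables (R : realType) (n : nat).
Let X := (R * ('M[R]_n * 'cV[R]_n))%type.

Definition joint_extension (U : set X) (L : nat -> X -> R)
    (P : nat -> X -> 'M[R]_n) (Psi : nat -> X -> 'cV[R]_n) : Prop :=
  let D : set X := [set x | 0 < x.1] in
  [/\ forall x, U x -> D x -> strictly_ordered x.1 x.2.1 x.2.2 /\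
                              eigenspaces_not_orthogonal x.1 x.2.1 x.2.2,
      forall k, (1 <= k <= n)%N -> analytic_extension (@coord3 R n) U D
        (fun x => normalized_eigval x.1 x.2.1 x.2.2 k) (L k),
      forall k, (k <= n)%N -> mx_analytic_extension (@coord3 R n) U D
        (fun x => spectral_proj x.1 x.2.1 x.2.2 k) (P k)
    & forall k, (1 <= k <= n)%N -> mx_analytic_extension (@coord3 R n) U D
        (fun x => eigvec x.1 x.2.1 x.2.2 k) (Psi k)].

End JointExtension.

(* The Taylor series of f at 0 converges to f on ]-r, r[. *)
Definition taylor_at0_converges (R : realType) (r : R) (f : R -> R) : Prop :=
  forall T, `|T| < r ->
  series (fun m : nat => f^`(m)%classic 0 / m`!%:R * T ^+ m) @ \oo --> f T.

(* Main.v *)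
Require Import Defs.
From mathcomp Require Import all_boot all_order all_algebra.
From mathcomp Require Import all_classical all_reals all_analysis.
From mathcomp Require Import measurable_realfun.
From mathcomp Require Import ring lra zify.

(** The eigenvalues of the Gramian have the sizes [T, T ^ 3, T ^ 5, ...], so that
    perturbation theory at [T = 0] does not apply directly. The idea is to grade
    the Gramian by the Krylov basis until its spectral problem becomes a regular
    analytic one. Indices start at zero in this explanation.

    Since [q_i] is orthogonal to [A ^ p b] for [p < i], the function
    [<q_i, exp (t A) b>] begins with [e_i * t ^ i], where [e_i = d_i / i!].
    Hence [<q_i, G_T q_j> = T ^ (i + j + 1) * M_ij(T)] with [M] jointly analytic in
    [(T, A, b)] ([graded_gramian_facts]) and [M_ij(0) = e_i * e_j / (i + j + 1)]: up
    to a diagonal scaling the limit is the Hilbert matrix, the Gram matrix of the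
    monomials in L2 of [0, 1], which is triangularized by the monic orthogonal
    polynomials (shifted Legendre polynomials). Their squared norms are the source
    of the constants [kappa].

    For the eigenvalue of rank [k], written [T ^ (2 * k + 1) * mu], and an
    eigenvector with Krylov coordinates [T ^ |j - k| * w_j], the equations can be
    divided by powers of [T] until they become the kernel equation of a matrix
    [pencil] which is analytic at [T = 0], where the Legendre basis makes it
    triangular. The only diagonal entry vanishing at
    [mu = e_k ^ 2 * norm_k = kappa * d ^ 2] is the one of index [k], and it does so
    to first order ([limit_pencil_simple_root]). Therefore [mu] is an analytic simple
    root of the determinant and [w] is given by Cramer's rule
    ([local_eigenpair]). Analyticity means being the sum of a multivariate power
    series with finite weighted absolute sum; as these sums are a complete and
    submultiplicative norm, simple roots are obtained from a contraction
    ([analytic_simple_root]), and inverses and square roots are simple roots.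

    For small [T > 0] this gives [n] unit eigenvectors with strictly decreasing
    positive eigenvalues, and this determines the spectrum and, by orientation,
    the eigenvectors and the projectors ([gramian_spectrum]). The second order
    remainders come from the first two terms of [M]. Pairing the kernel equation
    with the limit vector, which spans the left kernel of the limit pencil, gives
    the term [a_k] of the eigenvalue ([eigval_expansion]); in the eigenvector only
    the two coordinates next to [k] are of first order, and the subleading
    coefficient and the first nonzero moments of the Legendre polynomials turn
    them into half of the numbers [beta] ([eig_dir_expansion]). The first order
    terms of the rank one projectors telescope ([proj_remainder_vanishes]).

    The matrix [G_T / T] is a power series in [T] and its spectral data make sense
    for [T < 0] as well, so that the extensions are given by formulas valid for all
    pairs ([ext_eigval], [ext_eigvec], [ext_proj]). The local statement
    [local_theorem] hence glues, and a covering argument gives radii and constants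
    uniform on a compact set ([good_radius_compact]); the statements about a single
    pair are the case of a singleton. *)

Import Order.TTheory GRing.Theory Num.Theory.
Import numFieldNormedType.Exports.
Set Implicit Arguments.
Unset Strict Implicit.
Unset Printing Implicit Defensive.
Local Open Scope classical_set_scope.
Local Open Scope ring_scope.

(** * Homogeneous parts of power series *)

Section HomogeneousPart.
Variables (R : realType) (I : finType).
Implicit Types (c : {ffun I -> nat} -> R) (h : I -> R).

Lemma homogeneous_partD c c' h k :
  homogeneous_part (fun a => c a + c' a) h k =
  homogeneous_part c h k + homogeneous_part c' h k.
Proof. by rewrite -big_split /=; apply: eq_bigr => a _; rewrite mulrDl. Qed.

Lemma homogeneous_partZ t c h k :
  homogeneous_part (fun a => t * c a) h k = t * homogeneous_part c h k.
Proof. by rewrite big_distrr /=; apply: eq_bigr => a _; rewrite mulrA. Qed.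

Lemma homogeneous_part_ge0 c h k :
  (forall a, 0 <= c a) -> (forall i, 0 <= h i) -> 0 <= homogeneous_part c h k.
Proof.
move=> c0 h0; apply: sumr_ge0 => a _; apply: mulr_ge0 => //.
by apply: prodr_ge0 => i _; apply: exprn_ge0.
Qed.

Lemma homogeneous_part_le c c' h h' k :
  (forall a, `|c a| <= c' a) -> (forall i, `|h i| <= h' i) ->
  `|homogeneous_part c h k| <= homogeneous_part c' h' k.
Proof.
move=> lec leh; apply: le_trans (ler_norm_sum _ _ _) _; apply: ler_sum => a _.
rewrite normrM; apply: ler_pM => //; rewrite normr_prod; apply: ler_prod => i _.
by rewrite normr_ge0 normrX lerXn2r ?nnegrE // (le_trans _ (leh i)).
Qed.

Lemma homogeneous_part_scale c h t k :
  homogeneous_part c (fun i => t * h i) k = t ^+ k * homogeneous_part c h k.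
Proof.
rewrite big_distrr /=; apply: eq_bigr => a /eqP ak.
rewrite -[in t ^+ k]ak mulrCA -prodrXr -big_split /=; congr (_ * _).
by apply: eq_bigr => i _; rewrite exprMn.
Qed.

Lemma homogeneous_part0 c h : homogeneous_part c h 0 = c [ffun=> 0%N].
Proof.
rewrite /homogeneous_part (bigD1 [ffun=> ord0]) /=; last first.
  by apply/eqP; rewrite big1 // => i _; rewrite ffunE.
rewrite [X in _ + X]big1 => [|a /andP[_ /eqP]]; last first.
  by case; apply/ffunP=> i; rewrite ffunE ord1.
rewrite addr0 big1 => [|i _]; last by rewrite ffunE.
by rewrite mulr1; congr c; apply/ffunP => i; rewrite !ffunE.
Qed.

Lemma homogeneous_part_eval0 c k : homogeneous_part c (fun=> 0) k.+1 = 0.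
Proof.
have -> : (fun _ : I => 0) = (fun i => 0 * (fun _ : I => 0) i) :> (I -> R).
  by apply/funext => i; rewrite mul0r.
by rewrite homogeneous_part_scale exprS !mul0r.
Qed.

(** The coefficients of the product of a power series by the variable [i]. *)
Definition coef_shift i c : {ffun I -> nat} -> R := fun a =>
  if a i == 0%N then 0 else c [ffun j => (a j - (j == i))%N].

Lemma coef_shift_norm i c : (fun a => `|coef_shift i c a|) = coef_shift i (fun a => `|c a|).
Proof. by apply/funext => a; rewrite /coef_shift; case: ifP => //; rewrite normr0. Qed.

Lemma homogeneous_part_shift i c h k :
  homogeneous_part (coef_shift i c) h k.+1 = h i * homogeneous_part c h k.
Proof.
have sumi : (\sum_j (j == i))%N = 1%N.
  by rewrite (bigD1 i) //= eqxx big1 ?addn0 // => j /negPf ->.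
rewrite /homogeneous_part big_distrr /= (bigID (fun a : {ffun I -> 'I_k.+2} => a i == ord0)) /=.
rewrite big1 ?add0r; last first.
  by move=> a /andP[_ /eqP ai]; rewrite /coef_shift ffunE ai mul0r.
pose fwd (b : {ffun I -> 'I_k.+1}) : {ffun I -> 'I_k.+2} :=
  [ffun j => inord (b j + (j == i))].
pose bwd (a : {ffun I -> 'I_k.+2}) : {ffun I -> 'I_k.+1} :=
  [ffun j => inord (a j - (j == i))].
have fwdE b j : fwd b j = (b j + (j == i))%N :> nat.
  rewrite ffunE inordK // ltnS; have := ltn_ord (b j); rewrite ltnS.
  by case: (j == i); lia.
(* The multi-indices of degree [k.+1] containing [i] correspond to all those of
   degree [k], by removing one occurrence of [i]. *)
rewrite (reindex_onto fwd bwd) /=; last first.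
  move=> a /andP[/eqP sa ai0]; apply/ffunP => j; apply: val_inj => /=.
  rewrite fwdE ffunE inordK.
    rewrite subnK //; case: (eqVneq j i) => [->|//].
    by rewrite lt0n.
  have := sa; rewrite (bigD1 i) //=; have : (0 < a i)%N by rewrite lt0n.
  case: (eqVneq j i) => [->|ji]; first by lia.
  rewrite (bigD1 j) //=; lia.
have bwdK b : bwd (fwd b) = b.
  apply/ffunP => j; apply: val_inj => /=; rewrite ffunE /= fwdE addnK.
  by rewrite inordK.
apply: eq_big => [b|b _].
  have -> : fwd b i != ord0.
    by apply/eqP => /(congr1 val) /=; rewrite fwdE eqxx addn1.
  rewrite bwdK eqxx !andbT (eq_bigr (fun j => b j + (j == i))%N) //.
  by rewrite big_split /= sumi addn1 eqSS.
rewrite /coef_shift ffunE fwdE eqxx addn1 /= mulrCA; congr (_ * _).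
  congr c; apply/ffunP => j; rewrite !ffunE inordK ?addnK //.
  by rewrite ltnS; have := ltn_ord (b j); rewrite ltnS; case: (j == i); lia.
rewrite (bigD1 i) //= fwdE eqxx addn1 exprS -mulrA; congr (_ * _).
rewrite [RHS](bigD1 i) //=; congr (_ * _); apply: eq_bigr => j /negPf ji.
by rewrite fwdE ji addn0.
Qed.

Lemma homogeneous_part_shift0 i c h : homogeneous_part (coef_shift i c) h 0 = 0.
Proof. by rewrite homogeneous_part0 /coef_shift ffunE eqxx. Qed.

End HomogeneousPart.

(** * Series with bounded partial sums *)

Section BoundedSeries.
Variable R : realType.
Implicit Types (u v : nat -> R) (s C : R).

Lemma nonneg_series_cvg u C : (forall n, 0 <= u n) ->
  (forall N, \sum_(0 <= k < N) u k <= C) -> cvgn (series u).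
Proof.
move=> u0 uC; apply: nondecreasing_is_cvgn.
  by apply/nondecreasing_seqP => n; rewrite seriesSr lerDl.
by exists C => _ [N _ <-]; apply: uC.
Qed.

Lemma normal_series_cvg u v C : (forall n, `|u n| <= v n) ->
  (forall N, \sum_(0 <= k < N) v k <= C) -> cvgn (series u).
Proof.
move=> uv vC; apply: normed_cvg; apply: (@nonneg_series_cvg _ C) => [n|N] /=.
  exact: normr_ge0.
by apply: (le_trans _ (vC N)); apply: ler_sum => k _.
Qed.

Lemma cvg_le_bound u l C : u @ \oo --> l -> (forall n, u n <= C) -> l <= C.
Proof.
move=> ul uC; rewrite -(cvg_lim _ ul) //; apply: limr_le.
  by apply/cvg_ex; exists l.
by apply: nearW.
Qed.

Lemma cvg_norm_le_bound u l C :
  u @ \oo --> l -> (forall n, `|u n| <= C) -> `|l| <= C.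
Proof. by move=> ul uC; apply: (@cvg_le_bound (fun n => `|u n|)) => //; apply: cvg_norm. Qed.

Lemma cvg_sum_seq (J : Type) (s : seq J) (P : pred J) (u_ : J -> nat -> R) l :
  (forall j, P j -> u_ j @ \oo --> l j) ->
  (fun n => \sum_(j <- s | P j) u_ j n) @ \oo --> \sum_(j <- s | P j) l j.
Proof.
move=> ul; elim: s => [|j s IH].
  by rewrite big_nil; under eq_fun do rewrite big_nil; exact: cvg_cst.
rewrite big_cons; under eq_fun do rewrite big_cons.
by case: ifP => // Pj; apply: cvgD => //; exact: ul.
Qed.

Lemma series_tail_small u C e : (forall n, 0 <= u n) -> 0 < e ->
  (forall N, \sum_(0 <= k < N) u k <= C) ->
  \forall M \near \oo, forall N, \sum_(M <= k < N) u k <= e.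
Proof.
move=> u0 e0 uC; have /cvg_ex[l ul] := nonneg_series_cvg u0 uC.
have leul N : series u N <= l.
  have uu : cvgn (series u) by apply/cvg_ex; exists l.
  rewrite -(cvg_lim _ ul) //; apply: nondecreasing_cvgn_le => //.
  by apply/nondecreasing_seqP => n; rewrite seriesSr lerDl.
move/cvgrPdist_le : ul => /(_ _ e0); apply: filterS => M leM N.
case: (leqP M N) => MN; last by rewrite big_geq ?ltW // ltnW.
have := leul N; rewrite /series /= (big_cat_nat _ MN) //= => h.
have := le_trans (ler_norm _) leM; rewrite /series /=; lra.
Qed.

Lemma geometric_sum_le s N : 0 <= s < 1 -> \sum_(0 <= i < N) s ^+ i <= (1 - s)^-1.
Proof.
move=> /andP[s0 s1]; have s1' : 0 < 1 - s by rewrite subr_gt0.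
rewrite -[_^-1]mul1r ler_pdivlMr //.
have -> : (\sum_(0 <= i < N) s ^+ i) * (1 - s) = 1 - s ^+ N.
  elim: N => [|N IH]; first by rewrite big_nil mul0r expr0 subrr.
  by rewrite big_nat_recr //= mulrDl IH exprS; ring.
by rewrite gerBl exprn_ge0.
Qed.

Lemma sum_half_le C N : 0 <= C -> \sum_(0 <= m < N) C * 2^-1 ^+ m <= 2 * C.
Proof.
move=> C0; rewrite -mulr_sumr mulrC; apply: ler_wpM2r => //.
apply: le_trans (geometric_sum_le _ _) _; first by lra.
by rewrite le_eqVlt; apply/orP; left; apply/eqP; field.
Qed.

End BoundedSeries.

(** * Absolutely convergent power series on polydiscs *)

Section PowerSeries.
Variables (R : realType) (X : Type) (I : finType) (coord : I -> X -> R).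
Implicit Types (c : {ffun I -> nat} -> R) (x y : X) (r C : R) (f g : X -> R).

Definition polydisc x r : set X :=
  [set y | forall i, `|coord i y - coord i x| < r].

(** The bound [C] on the sum of the absolute values of the coefficients, weighted
    by the powers of [r], is the essential parameter: this norm is complete and
    submultiplicative, so that products, substitutions and fixed points are
    controlled by numbers only. *)
Definition power_series x r C f : Prop := exists c,
  (forall N, \sum_(0 <= k < N)
     homogeneous_part (fun a => `|c a|) (fun=> r) k <= C) /\
  (forall y, polydisc x r y ->
     series (homogeneous_part c (fun i => coord i y - coord i x)) @ \oo
       --> f y).

Lemma ps_ext x r C f g : (forall y, polydisc x r y -> f y = g y) ->
  power_series x r C f -> power_series x r C g.
Proof.
move=> fg [c [cC cf]]; exists c; split=> // y yx.
by rewrite -fg //; apply: cf.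
Qed.

Lemma ps_weaken x r C C' f :
  C <= C' -> power_series x r C f -> power_series x r C' f.
Proof.
by move=> CC' [c [cC cf]]; exists c; split=> // N; apply: le_trans CC'.
Qed.

Lemma ps_bound_ge0 x r C f : power_series x r C f -> 0 <= C.
Proof. by case=> c [/(_ 0%N)]; rewrite big_nil. Qed.

Lemma ps_bound x r C f y :
  power_series x r C f -> polydisc x r y -> `|f y| <= C.
Proof.
move=> [c [cC cf]] yr; apply: (cvg_norm_le_bound (cf _ yr)) => N.
apply: le_trans (cC N); apply: le_trans (ler_norm_sum _ _ _) _.
by apply: ler_sum => k _; apply: homogeneous_part_le => // i; apply/ltW/yr.
Qed.

Lemma ps_const x r t : power_series x r `|t| (fun=> t).
Proof.
pose c (a : {ffun I -> nat}) := if a == [ffun=> 0%N] then t else 0.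
have cS h k : homogeneous_part c h k.+1 = 0.
  apply: big1 => a /eqP sa; rewrite /c; case: eqP => [/ffunP a0|]; last first.
    by rewrite mul0r.
  suff : (\sum_i a i = 0)%N by rewrite sa.
  by apply: big1 => i _; have := a0 i; rewrite !ffunE.
have sumE (u : nat -> R) N : (forall k, u k.+1 = 0) ->
    \sum_(0 <= k < N.+1) u k = u 0%N.
  by move=> u0; rewrite big_nat_recl // big1 ?addr0.
have cE : (fun a => `|c a|) = (fun a => `|t| / t * c a).
  apply/funext => a; rewrite /c; case: eqP; rewrite ?normr0 ?mulr0 // => _.
  by have [->|t0] := eqVneq t 0; rewrite ?normr0 ?mulr0 // divfK.
have c0 : c [ffun=> 0%N] = t by rewrite /c eqxx.
exists c; split=> [[|N]|y yr].
- by rewrite big_nil.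
- rewrite cE sumE => [|k]; rewrite homogeneous_partZ ?cS ?mulr0 //.
  rewrite homogeneous_part0 c0.
  by have [->|t0] := eqVneq t 0; rewrite ?normr0 ?mulr0 // divfK.
- apply/cvg_ballP => e e0; near=> N; have -> : N = N.-1.+1.
    by rewrite prednK //; near: N; exists 1%N.
  by rewrite /series /= sumE ?homogeneous_part0 ?c0; [exact: ballxx|].
Unshelve. all: by end_near.
Qed.

Lemma ps_add x r C C' f g : power_series x r C f -> power_series x r C' g ->
  0 <= r -> power_series x r (C + C') (fun y => f y + g y).
Proof.
move=> [c [cC cf]] [c' [cC' cf']] r0; exists (fun a => c a + c' a); split.
  move=> N; apply: le_trans (lerD (cC N) (cC' N)); rewrite -big_split /=.
  apply: ler_sum => k _; rewrite -homogeneous_partD.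
  apply: (le_trans (ler_norm _)); apply: homogeneous_part_le => [a|i].
    by rewrite normr_id ler_normD.
  by rewrite ger0_norm.
move=> y yr; have -> : series (homogeneous_part (fun a => c a + c' a)
    (fun i => coord i y - coord i x)) =
  series (homogeneous_part c (fun i => coord i y - coord i x)) \+
  series (homogeneous_part c' (fun i => coord i y - coord i x)).
  apply/funext => N; rewrite /series /= -big_split /=.
  by apply: eq_bigr => k _; rewrite homogeneous_partD.
by apply: cvgD; [exact: cf|exact: cf'].
Qed.

Lemma ps_scale x r C t f : power_series x r C f ->
  power_series x r (`|t| * C) (fun y => t * f y).
Proof.
move=> [c [cC cf]]; exists (fun a => t * c a); split.
  move=> N; apply: le_trans (ler_wpM2l (normr_ge0 t) (cC N)).
  rewrite big_distrr /=; apply: ler_sum => k _; rewrite -homogeneous_partZ.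
  by apply: ler_sum => a _; rewrite normrM.
move=> y yr; have -> : series (homogeneous_part (fun a => t * c a)
    (fun i => coord i y - coord i x)) =
  (fun N => t * series (homogeneous_part c (fun i => coord i y - coord i x)) N).
  apply/funext => N; rewrite /series /= big_distrr /=.
  by apply: eq_bigr => k _; rewrite homogeneous_partZ.
by apply: cvgMr; exact: cf.
Qed.

Lemma ps_sum (J : Type) (s : seq J) (P : pred J) x r (C : J -> R)
    (f_ : J -> X -> R) : 0 <= r ->
  (forall j, P j -> power_series x r (C j) (f_ j)) ->
  power_series x r (\sum_(j <- s | P j) C j) (fun y => \sum_(j <- s | P j) f_ j y).
Proof.
move=> r0 psf; elim: s => [|j s IH].
  rewrite big_nil -[X in power_series _ _ X](@normr0 R R).
  by apply: ps_ext (ps_const _ _ _) => y _; rewrite big_nil.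
rewrite big_cons; case: ifP => Pj; last first.
  by apply: ps_ext IH => y _; rewrite big_cons Pj.
apply: ps_ext (ps_add (psf _ Pj) IH r0) => y _.
by rewrite big_cons Pj.
Qed.

Lemma ps_coord_mul x r C f i : 0 <= r -> power_series x r C f ->
  power_series x r (r * C) (fun y => (coord i y - coord i x) * f y).
Proof.
move=> r0 [c [cC cf]]; exists (coef_shift i c).
have C0 := ps_bound_ge0 (ex_intro _ c (conj cC cf)).
have sumE c' h N : \sum_(0 <= k < N.+1) homogeneous_part (coef_shift i c') h k =
    h i * \sum_(0 <= k < N) homogeneous_part c' h k.
  rewrite big_nat_recl // homogeneous_part_shift0 add0r big_distrr /=.
  by apply: eq_bigr => k _; rewrite homogeneous_part_shift.
split=> [[|N]|y yr].
- by rewrite big_nil mulr_ge0.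
- by rewrite coef_shift_norm sumE ler_wpM2l.
- rewrite -cvg_shiftS /= /series /=; under eq_fun do rewrite sumE.
  by apply: cvgMr; apply: cf.
Qed.

(** Completeness: every coefficient of the sum is an absolutely convergent sum of
    coefficients, because a coefficient of degree [k] is at most [r ^- k] times
    the norm. *)
Lemma ps_normal_sum x r (C : nat -> R) D (f_ : nat -> X -> R) F : 0 < r ->
  (forall m, power_series x r (C m) (f_ m)) ->
  (forall M, \sum_(0 <= m < M) C m <= D) ->
  (forall y, polydisc x r y -> series (f_ ^~ y) @ \oo --> F y) ->
  power_series x r D F.
Proof.
move=> r0 psf CD fF; have [c_ c_P] := choice psf.
have C0 m : 0 <= C m := ps_bound_ge0 (psf m).
have r_ge0 (i : I) : 0 <= r by exact: ltW.
have part_le m N : \sum_(0 <= k < N)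
    homogeneous_part (fun a => `|c_ m a|) (fun=> r) k <= C m by apply (c_P m).1.
have coef_le (a : {ffun I -> nat}) m : `|c_ m a| <= C m / r ^+ (\sum_i a i)%N.
  rewrite ler_pdivlMr ?exprn_gt0 //; set K := (\sum_i a i)%N.
  apply: le_trans (part_le m K.+1); rewrite big_nat_recr //=.
  apply: ler_wpDl.
    by apply: sumr_ge0 => k _; apply: homogeneous_part_ge0.
  have aK i : (a i < K.+1)%N by rewrite ltnS /K (bigD1 i) //= leq_addr.
  pose b : {ffun I -> 'I_K.+1} := [ffun i => inord (a i)].
  have bE i : b i = a i :> nat by rewrite ffunE inordK.
  rewrite /homogeneous_part (bigD1 b) /=; last first.
    by apply/eqP; apply: eq_bigr => i _; rewrite bE.
  have -> : [ffun i => b i : nat] = a by apply/ffunP => i; rewrite !ffunE inordK.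
  under eq_bigr do rewrite bE.
  rewrite prodrXr ler_wpDr //.
  by apply: sumr_ge0 => a' _; rewrite mulr_ge0 // prodr_ge0 // => j _; exact/exprn_ge0/ltW.
have coef_sum (a : {ffun I -> nat}) M :
    \sum_(0 <= m < M) C m / r ^+ (\sum_i a i)%N <= D / r ^+ (\sum_i a i)%N.
  by rewrite -mulr_suml ler_pM2r ?invr_gt0 ?exprn_gt0.
have cvgc a : cvgn (series (fun m => c_ m a)).
  exact: (normal_series_cvg (coef_le a) (coef_sum a)).
have cvgabs a : cvgn (series (fun m => `|c_ m a|)).
  apply: (@normal_series_cvg _ _ _ _ _ (coef_sum a)) => m.
  by rewrite normr_id.
pose c a := limn (series (fun m => c_ m a)).
pose ca a := limn (series (fun m => `|c_ m a|)).
have c_ca a : `|c a| <= ca a by apply: lim_series_norm; exact: cvgabs.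
have part_lim (d : nat -> {ffun I -> nat} -> R) h k :
    (forall a, cvgn (series (fun m => d m a))) ->
    (fun M => \sum_(0 <= m < M) homogeneous_part (d m) h k) @ \oo -->
    homogeneous_part (fun a => limn (series (fun m => d m a))) h k.
  move=> dcvg; rewrite [X in X @ _](_ : _ = fun M =>
      \sum_(a : {ffun I -> 'I_k.+1} | (\sum_i a i)%N == k)
        series (fun m => d m [ffun i => a i : nat]) M * \prod_i h i ^+ a i).
    apply: cvg_sum_seq => a _; apply: cvgMl; exact: dcvg.
  apply/funext => M; rewrite exchange_big /=; apply: eq_bigr => a _.
  by rewrite /series /= mulr_suml.
have psum_lim (d : nat -> {ffun I -> nat} -> R) h N :
    (forall a, cvgn (series (fun m => d m a))) ->
    (fun M => \sum_(0 <= m < M) \sum_(0 <= k < N) homogeneous_part (d m) h k) @ \oo -->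
    \sum_(0 <= k < N) homogeneous_part (fun a => limn (series (fun m => d m a))) h k.
  move=> dcvg; rewrite [X in X @ _](_ : _ = fun M =>
      \sum_(0 <= k < N) \sum_(0 <= m < M) homogeneous_part (d m) h k).
    by apply: cvg_sum_seq => k _; apply: part_lim.
  by apply/funext => M; rewrite exchange_big.
exists c; split.
  move=> N; apply: (@le_trans _ _ (\sum_(0 <= k < N) homogeneous_part ca (fun=> r) k)).
    apply: ler_sum => k _; apply: (le_trans (ler_norm _)).
    by apply: homogeneous_part_le => [a|i]; rewrite ?normr_id // gtr0_norm.
  apply: (cvg_le_bound (psum_lim (fun m a => `|c_ m a|) (fun=> r) N cvgabs)) => M.
  by apply: le_trans (CD M); apply: ler_sum => m _.
move=> y yr; set h := fun i => _.
have hr i : `|h i| <= r by apply/ltW/yr.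
apply/cvgrPdist_le => e e0; have e3 : 0 < e / 3%:R by rewrite divr_gt0.
(* The value of the sum is compared with a finite part of the family, the latter
   with its Taylor polynomials, and these with those of the whole sum. *)
have tail := series_tail_small C0 e3 CD.
have Fnear := (cvgrPdist_le _ _).1 (fF _ yr) _ e3.
have [M [Mtail MF]] : exists M, (forall N, \sum_(M <= k < N) C k <= e / 3%:R) /\
    `|F y - series (f_^~ y) M| <= e / 3%:R.
  near \oo => M; exists M; split; near: M; [exact: tail|exact: Fnear].
have cvgM : (fun N => \sum_(0 <= m < M) series (homogeneous_part (c_ m) h) N) @ \oo
    --> \sum_(0 <= m < M) f_ m y.
  apply: cvg_sum_seq => m _; exact: (c_P m).2.
move/cvgrPdist_le : cvgM => /(_ _ e3) cvgM; near=> N.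
have h1 : `|\sum_(0 <= m < M) f_ m y -
   \sum_(0 <= m < M) series (homogeneous_part (c_ m) h) N| <= e / 3%:R by near: N.
have h2 : `|\sum_(0 <= m < M) series (homogeneous_part (c_ m) h) N -
    series (homogeneous_part c h) N| <= e / 3%:R.
  rewrite distrC; have := psum_lim c_ h N cvgc; rewrite -(cvg_shiftn M) => psumM.
  set d := \sum_(0 <= m < M) series _ _.
  have L : (fun M' => \sum_(0 <= m < M' + M) \sum_(0 <= k < N)
      homogeneous_part (c_ m) h k - d) @ \oo --> series (homogeneous_part c h) N - d.
    by apply: cvgB; [exact: psumM|exact: cvg_cst].
  apply: (cvg_norm_le_bound L) => M'.
  rewrite (big_cat_nat (leq0n M) (leq_addl M' M)) /= addrAC subrr add0r.
  apply: le_trans (Mtail (M' + M)%N); apply: le_trans (ler_norm_sum _ _ _) _.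
  apply: ler_sum => m _; apply: le_trans (part_le m N).
  apply: le_trans (ler_norm_sum _ _ _) _; apply: ler_sum => k _.
  exact: homogeneous_part_le.
have -> : F y - series (homogeneous_part c h) N =
  (F y - series (f_^~ y) M) + (\sum_(0 <= m < M) f_ m y -
   \sum_(0 <= m < M) series (homogeneous_part (c_ m) h) N) +
  (\sum_(0 <= m < M) series (homogeneous_part (c_ m) h) N -
    series (homogeneous_part c h) N).
  by rewrite /series /=; ring.
apply: (le_trans (ler_normD _ _)); rewrite (_ : e = e / 3%:R + e / 3%:R + e / 3%:R); last by field.
apply: lerD => //; apply: (le_trans (ler_normD _ _)); exact: lerD.
Unshelve. all: by end_near.
Qed.

End PowerSeries.

(** * Products and substitution *)

Section PowerSeriesAlgebra.
Variables (R : realType) (X : Type) (I : finType) (coord : I -> X -> R).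
Implicit Types (c : {ffun I -> nat} -> R) (x y : X) (r C : R) (f g : X -> R).
Notation power_series := (power_series coord).
Notation polydisc := (polydisc coord).

Lemma ps_monomial_mul x r C f (a : I -> nat) : 0 <= r -> power_series x r C f ->
  power_series x r ((\prod_i r ^+ a i) * C)
    (fun y => (\prod_i (coord i y - coord i x) ^+ a i) * f y).
Proof.
move=> r0 psf.
have psX i n D g : power_series x r D g ->
    power_series x r (r ^+ n * D) (fun y => (coord i y - coord i x) ^+ n * g y).
  elim: n => [|n IH] psg.
    by rewrite expr0 mul1r; apply: ps_ext psg => y _; rewrite expr0 mul1r.
  rewrite exprS -mulrA; apply: ps_ext (ps_coord_mul i r0 (IH psg)) => y _.
  by rewrite exprS mulrA.
elim: (index_enum I) => [|i s IH].
  by rewrite big_nil mul1r; apply: ps_ext psf => y _; rewrite big_nil mul1r.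
rewrite big_cons -mulrA; apply: ps_ext (psX i (a i) _ _ IH) => y _.
by rewrite big_cons mulrA.
Qed.

(** A product is the normally convergent sum of the products of one factor by
    the monomials of the other one. *)
Lemma ps_mul x r C C' f g : 0 < r -> power_series x r C f ->
  power_series x r C' g -> power_series x r (C * C') (fun y => f y * g y).
Proof.
move=> r0 [c [cC cf]] psg; have C'0 := ps_bound_ge0 psg.
pose h y i := coord i y - coord i x.
apply: (@ps_normal_sum _ _ _ _ x r
  (fun k => homogeneous_part (fun a => `|c a|) (fun=> r) k * C') _
  (fun k y => homogeneous_part c (h y) k * g y)) => //.
- move=> k; rewrite mulr_suml.
  apply: (@ps_ext _ _ _ _ x r _ (fun y => \sum_(a : {ffun I -> 'I_k.+1} |
     (\sum_i a i)%N == k) c [ffun i => a i : nat] *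
       ((\prod_i (coord i y - coord i x) ^+ a i) * g y))).
    by move=> y _; rewrite mulr_suml; apply: eq_bigr => a _; rewrite mulrA.
  apply: ps_sum => [|a _]; first exact: ltW.
  by rewrite -mulrA; apply/ps_scale/ps_monomial_mul => //; exact: ltW.
- by move=> M; rewrite -mulr_suml; apply: ler_wpM2r.
- move=> y yr; rewrite /series /=.
  by under eq_fun do rewrite -mulr_suml; apply: cvgMl; exact: cf.
Qed.

Lemma ps_exp x r C f n : 0 < r -> power_series x r C f ->
  power_series x r (C ^+ n) (fun y => f y ^+ n).
Proof.
move=> r0 psf; elim: n => [|n IH].
  by rewrite expr0 -[X in power_series _ _ X](@normr1 R); exact: ps_const.
rewrite exprS; apply: ps_ext (ps_mul r0 psf IH) => y _.
by rewrite exprS.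
Qed.

Lemma ps_prod (J : Type) (s : seq J) (P : pred J) x r (C : J -> R)
    (f_ : J -> X -> R) : 0 < r ->
  (forall j, P j -> power_series x r (C j) (f_ j)) ->
  power_series x r (\prod_(j <- s | P j) C j)
    (fun y => \prod_(j <- s | P j) f_ j y).
Proof.
move=> r0 psf; elim: s => [|j s IH].
  rewrite big_nil -[X in power_series _ _ X](@normr1 R).
  by apply: ps_ext (ps_const _ _ _ _) => y _; rewrite big_nil.
rewrite big_cons; case: ifP => Pj; last first.
  by apply: ps_ext IH => y _; rewrite big_cons Pj.
apply: ps_ext (ps_mul r0 (psf _ Pj) IH) => y _.
by rewrite big_cons Pj.
Qed.

Lemma ps_coord x r i : 0 <= r ->
  power_series x r r (fun y => coord i y - coord i x).
Proof.
move=> r0; have := ps_coord_mul i r0 (ps_const coord x r 1).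
by rewrite normr1 mulr1; apply: ps_ext => y _; rewrite mulr1.
Qed.

Lemma ps_coord_val x r i : 0 <= r ->
  power_series x r (r + `|coord i x|) (coord i).
Proof.
move=> r0; apply: ps_ext (ps_add (ps_coord x i r0) (ps_const _ _ _ (coord i x)) r0).
by move=> y _; rewrite subrK.
Qed.

Lemma homogeneous_part_mono c r r' k : 0 <= r' <= r ->
  homogeneous_part (fun a => `|c a|) (fun=> r') k <=
  homogeneous_part (fun a => `|c a|) (fun=> r) k.
Proof.
case/andP=> r'0 rr'; apply: (le_trans (ler_norm _)).
apply: homogeneous_part_le => [a|i]; first by rewrite normr_id.
by rewrite ger0_norm.
Qed.

Lemma ps_restrict x r r' C f : 0 <= r' <= r -> power_series x r C f ->
  power_series x r' C f.
Proof.
move=> rr' [c [cC cf]]; exists c; split=> [N|y yr'].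
  apply: le_trans (cC N); apply: ler_sum => k _; exact: homogeneous_part_mono.
by apply: cf => i; case/andP: rr' => _; apply: lt_le_trans.
Qed.

(** Without its constant term a power series has only monomials of positive
    degree, whose norm decreases at least linearly with the radius. *)
Lemma ps_shrink x r r' C f : 0 < r' <= r -> power_series x r C f ->
  power_series x r' (r' / r * C) (fun y => f y - f x).
Proof.
case/andP => r'0 rr' [c [cC cf]]; have r0 : 0 < r := lt_le_trans r'0 rr'.
pose c' a := if a == [ffun=> 0%N] then 0 else c a.
have c'S (d d' : {ffun I -> nat} -> R) h k : (forall a, a != [ffun=> 0%N] -> d a = d' a) ->
    homogeneous_part d h k.+1 = homogeneous_part d' h k.+1.
  move=> dd'; apply: eq_bigr => a /eqP sa; rewrite dd' //.
  apply/eqP => /ffunP a0; have : (\sum_i a i = 0)%N.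
    by apply: big1 => i _; have := a0 i; rewrite !ffunE.
  by rewrite sa.
have c'E a : a != [ffun=> 0%N] -> c' a = c a by rewrite /c' => /negPf ->.
have c'0 : c' [ffun=> 0%N] = 0 by rewrite /c' eqxx.
have rr'_le1 : r' / r <= 1 by rewrite ler_pdivrMr // mul1r.
have q0 : 0 <= r' / r by rewrite divr_ge0 // ltW.
have fx : f x = c [ffun=> 0%N].
  have xr : polydisc x r x by move=> i; rewrite subrr normr0.
  rewrite -(cvg_lim _ (cf _ xr)) //; apply: cvg_lim => //.
  have -> : (fun i => coord i x - coord i x) = (fun=> 0).
    by apply/funext => i; rewrite subrr.
  rewrite -cvg_shiftS /series /=.
  rewrite [X in X @ _](_ : _ = fun=> c [ffun=> 0%N]); first exact: cvg_cst.
  apply/funext => N; rewrite big_nat_recl // homogeneous_part0 big1 ?addr0 //.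
  by move=> k _; rewrite homogeneous_part_eval0.
exists c'; split=> [[|N]|y yr'].
- rewrite big_nil mulr_ge0 //; apply: le_trans (cC 0%N).
  by rewrite big_nil.
- rewrite big_nat_recl // homogeneous_part0 c'0 normr0 add0r.
  apply: le_trans (ler_wpM2l q0 (cC N.+1)).
  rewrite big_nat_recl // mulrDr ler_wpDl //.
    by rewrite mulr_ge0 // homogeneous_part0.
  rewrite big_distrr; apply: ler_sum => k _.
  rewrite (c'S _ (fun a => `|c a|)); last by move=> a /c'E ->.
  have -> : (fun _ : I => r') = (fun i => r' / r * (fun=> r) i) :> (I -> R).
    by apply/funext => i; rewrite divfK // gt_eqF.
  rewrite homogeneous_part_scale exprS; apply: ler_wpM2r.
    by apply: homogeneous_part_ge0 => // i; exact: ltW.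
  by rewrite -[leRHS]mulr1 ler_wpM2l // exprn_ile1.
- rewrite fx; set h := fun i => _; rewrite -cvg_shiftS /series /=.
  under eq_fun do rewrite big_nat_recl // homogeneous_part0 c'0 add0r
    (eq_bigr _ (fun k _ => c'S _ _ h k c'E)).
  have yr : polydisc x r y by move=> i; apply: lt_le_trans rr'.
  have := cf _ yr; rewrite -cvg_shiftS /series /= => L.
  rewrite [X in X @ _](_ : _ = fun N => \sum_(0 <= k < N.+1) homogeneous_part c h k
    - c [ffun=> 0%N]).
    by apply: cvgB L (cvg_cst _).
  by apply/funext => N; rewrite big_nat_recl // homogeneous_part0 addrAC subrr add0r.
Qed.

Lemma ps_lipschitz_at x r r' C f y : 0 < r' <= r -> power_series x r C f ->
  polydisc x r' y -> `|f y - f x| <= r' / r * C.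
Proof.
by move=> rr' psf yr'; apply: (ps_bound (ps_shrink rr' psf)).
Qed.

End PowerSeriesAlgebra.

Section Composition.
Variables (R : realType) (X Y : Type) (I J : finType).
Variables (cX : I -> X -> R) (cY : J -> Y -> R).

(** Substitution is a normally convergent sum of products, as soon as the norms of
    the inner functions do not exceed the radius of the outer series. *)
Lemma ps_comp (x : X) (y : Y) r r' C f (phi : Y -> X) (rho : I -> R) :
  0 < r' -> power_series cX x r C f ->
  (forall i, power_series cY y r' (rho i) (fun z => cX i (phi z) - cX i x)) ->
  (forall i, rho i <= r) ->
  (forall z, polydisc cY y r' z -> polydisc cX x r (phi z)) ->
  power_series cY y r' C (f \o phi).
Proof.
move=> r'0 [c [cC cf]] psphi rho_le phiP.
have rho0 i : 0 <= rho i := ps_bound_ge0 (psphi i).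
pose h z i := cX i (phi z) - cX i x.
apply: (@ps_normal_sum _ _ _ _ y r'
  (fun k => homogeneous_part (fun a => `|c a|) rho k) _
  (fun k z => homogeneous_part c (h z) k)) => //.
- move=> k; apply: ps_sum => [|a _]; first exact: ltW.
  apply: ps_scale; apply: ps_prod => // i _; exact: ps_exp.
- move=> M; apply: le_trans (cC M); apply: ler_sum => k _.
  apply: (le_trans (ler_norm _)); apply: homogeneous_part_le => [a|i].
    by rewrite normr_id.
  by rewrite ger0_norm.
- by move=> z zr; apply: cf; exact: phiP.
Qed.

End Composition.

Section Recentering.
Variables (R : realType) (X : Type) (I : finType) (coord : I -> X -> R).

(** A translation is an inner function whose norm exceeds the radius by the
    distance of the centres. *)
Lemma ps_recenter (x z : X) r r' C (f : X -> R) : 0 < r' ->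
  (forall i, `|coord i z - coord i x| + r' <= r) ->
  power_series coord x r C f -> power_series coord z r' C f.
Proof.
move=> r'0 zr psf.
apply: (@ps_comp _ _ _ _ _ coord _ x z r r' C f id
  (fun i => r' + `|coord i z - coord i x|)) => //.
- move=> i; apply: ps_ext (ps_add (ps_coord coord z i (ltW r'0))
    (ps_const _ _ _ (coord i z - coord i x)) (ltW r'0)) => y _.
  by rewrite addrA subrK.
- by move=> i; rewrite addrC.
- move=> y yr i; apply: lt_le_trans (zr i).
  have := yr i; have := ler_normD (coord i y - coord i z) (coord i z - coord i x).
  rewrite addrA subrK; lra.
Qed.

Lemma ps_analytic_on (x : X) r C (f : X -> R) : 0 < r ->
  power_series coord x r C f -> analytic_on coord (polydisc coord x r) f.
Proof.
move=> r0 psf z zr.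
have [r' r'0 zr'] : exists2 r', 0 < r' &
    forall i, `|coord i z - coord i x| + r' <= r.
  pose m := \big[Order.min/r]_i (r - `|coord i z - coord i x|).
  exists m; last first.
    by move=> i; rewrite addrC -lerBrDr /m (bigD1 i) //= ge_min lexx.
  by rewrite /m; elim/big_ind: _ => // [a b a0 b0|i _]; rewrite ?lt_min ?a0 // subr_gt0.
have [c [cC cf]] := ps_recenter r'0 zr' psf.
exists c, r'; split=> //.
apply: nonneg_series_cvg cC => k; apply: homogeneous_part_ge0 => // i.
exact: ltW.
Qed.

End Recentering.

(** * Germs of analytic functions *)

Section AnalyticGerms.
Variables (R : realType) (X : Type) (I : finType) (coord : I -> X -> R).
Implicit Types (x y : X) (r C : R) (f g : X -> R).
Notation power_series := (power_series coord).
Notation polydisc := (polydisc coord).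

(** The space is a bare type known through its coordinates only, hence this
    description of its neighbourhoods. *)
Definition polydisc_nbhs x : set_system X :=
  [set P | exists2 r, 0 < r & polydisc x r `<=` P].

Lemma polydisc_sub x r r' : r <= r' -> polydisc x r `<=` polydisc x r'.
Proof. by move=> rr' y yr i; apply: lt_le_trans rr'. Qed.

Lemma polydisc_center x r : 0 < r -> polydisc x r x.
Proof. by move=> r0 i; rewrite subrr normr0. Qed.

Global Instance polydisc_nbhs_filter x : ProperFilter (polydisc_nbhs x).
Proof.
apply: Build_ProperFilter_ex.
  by move=> P [r r0 rP]; exists x; apply/rP/polydisc_center.
split.
- by exists 1.
- move=> P Q [r r0 rP] [r' r'0 rQ]; exists (Num.min r r').
    by rewrite lt_min r0.
  move=> y yr; split; [apply: rP|apply: rQ]; apply: polydisc_sub yr.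
    by rewrite ge_min lexx.
  by rewrite ge_min lexx orbT.
- by move=> P Q PQ [r r0 rP]; exists r => //; apply: subset_trans PQ.
Qed.

Lemma near_polydisc x r : 0 < r -> \forall y \near polydisc_nbhs x, polydisc x r y.
Proof. by move=> r0; exists r. Qed.

Lemma near_center x (P : set X) : (\forall y \near polydisc_nbhs x, P y) -> P x.
Proof. by move=> [r r0 rP]; apply/rP/polydisc_center. Qed.

Lemma min_radius r r' : 0 < r -> 0 < r' -> 0 <= Num.min r r' <= r.
Proof. by move=> /ltW r0 /ltW r'0; rewrite ge_min lexx le_min r0 r'0. Qed.

Definition analytic_at x f := exists r C, 0 < r /\ power_series x r C f.

Lemma analytic_at_near_eq x f g :
  (\forall y \near polydisc_nbhs x, f y = g y) -> analytic_at x f -> analytic_at x g.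
Proof.
move=> [r' r'0 fg] [r [C [r0 psf]]]; exists (Num.min r r'), C.
split; first by rewrite lt_min r0.
apply: (@ps_ext _ _ _ _ _ _ _ f) => [y yr|].
  by apply: fg; apply: polydisc_sub yr; rewrite ge_min lexx orbT.
by apply: ps_restrict psf; exact: min_radius.
Qed.

Lemma analytic_at_eq x f g : f =1 g -> analytic_at x f -> analytic_at x g.
Proof. by move=> /funext ->. Qed.

Lemma analytic_at_common (J : finType) x (f_ : J -> X -> R) :
  (forall j, analytic_at x (f_ j)) ->
  exists r C, [/\ 0 < r, 0 <= C & forall j, power_series x r C (f_ j)].
Proof.
move=> anf; suff [r [C [r0 C0 rC]]] : exists r C, [/\ 0 < r, 0 <= C &
    forall j, j \in enum J -> power_series x r C (f_ j)].
  by exists r, C; split=> // j; apply: rC; rewrite mem_enum.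
elim: (enum J) => [|j s [r [C [r0 C0 IH]]]]; first by exists 1, 0.
have [r' [C' [r'0 psj]]] := anf j.
exists (Num.min r r'), (Num.max C C'); split.
- by rewrite lt_min r0.
- by rewrite le_max C0.
move=> k; rewrite inE => /orP[/eqP ->|/IH psk].
  apply: (@ps_weaken _ _ _ _ _ _ C'); first by rewrite le_max lexx orbT.
  by apply: ps_restrict psj; rewrite minC min_radius.
apply: (@ps_weaken _ _ _ _ _ _ C); first by rewrite le_max lexx.
by apply: ps_restrict psk; exact: min_radius.
Qed.

Lemma analytic_at_const x t : analytic_at x (fun=> t).
Proof. by exists 1, `|t|; split=> //; exact: ps_const. Qed.

Lemma analytic_at_coord x i : analytic_at x (coord i).
Proof. by exists 1, (1 + `|coord i x|); split=> //; exact: ps_coord_val. Qed.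

Lemma analytic_at_common2 x f g : analytic_at x f -> analytic_at x g ->
  exists r C, [/\ 0 < r, power_series x r C f & power_series x r C g].
Proof.
move=> anf ang.
have anb (b : bool) : analytic_at x (if b then f else g) by case: b.
have [r [C [r0 _ psb]]] := analytic_at_common anb.
by exists r, C; split; [|exact: psb true|exact: psb false].
Qed.

Lemma analytic_at_add x f g : analytic_at x f -> analytic_at x g ->
  analytic_at x (fun y => f y + g y).
Proof.
move=> anf ang; have [r [C [r0 psf psg]]] := analytic_at_common2 anf ang.
by exists r, (C + C); split=> //; exact: ps_add psf psg (ltW r0).
Qed.

Lemma analytic_at_sum (J : Type) (s : seq J) (P : pred J) x (f_ : J -> X -> R) :
  (forall j, P j -> analytic_at x (f_ j)) ->
  analytic_at x (fun y => \sum_(j <- s | P j) f_ j y).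
Proof.
move=> anf; elim: s => [|j s IH].
  by apply: analytic_at_eq (analytic_at_const x 0) => y; rewrite big_nil.
case: (boolP (P j)) => Pj; last first.
  by apply: analytic_at_eq IH => y; rewrite big_cons (negPf Pj).
by apply: analytic_at_eq (analytic_at_add (anf _ Pj) IH) => y; rewrite big_cons Pj.
Qed.

Lemma analytic_at_mul x f g : analytic_at x f -> analytic_at x g ->
  analytic_at x (fun y => f y * g y).
Proof.
move=> anf ang; have [r [C [r0 psf psg]]] := analytic_at_common2 anf ang.
by exists r, (C * C); split=> //; exact: ps_mul.
Qed.

Lemma analytic_at_opp x f : analytic_at x f -> analytic_at x (fun y => - f y).
Proof.
move=> anf; apply: analytic_at_eq (analytic_at_mul (analytic_at_const x (-1)) anf).
by move=> y; rewrite mulN1r.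
Qed.

Lemma analytic_at_sub x f g : analytic_at x f -> analytic_at x g ->
  analytic_at x (fun y => f y - g y).
Proof. by move=> anf ang; apply/analytic_at_add/analytic_at_opp. Qed.

Lemma analytic_at_exp x f n : analytic_at x f -> analytic_at x (fun y => f y ^+ n).
Proof. by move=> [r [C [r0 psf]]]; exists r, (C ^+ n); split=> //; exact: ps_exp. Qed.

Lemma analytic_at_prod (J : Type) (s : seq J) (P : pred J) x (f_ : J -> X -> R) :
  (forall j, P j -> analytic_at x (f_ j)) ->
  analytic_at x (fun y => \prod_(j <- s | P j) f_ j y).
Proof.
move=> anf; elim: s => [|j s IH].
  by apply: analytic_at_eq (analytic_at_const x 1) => y; rewrite big_nil.
case: (boolP (P j)) => Pj; last first.
  by apply: analytic_at_eq IH => y; rewrite big_cons (negPf Pj).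
by apply: analytic_at_eq (analytic_at_mul (anf _ Pj) IH) => y; rewrite big_cons Pj.
Qed.

Lemma analytic_at_bounded x f : analytic_at x f ->
  exists C, \forall y \near polydisc_nbhs x, `|f y| <= C.
Proof. by move=> [r [C [r0 psf]]]; exists C, r => // y; exact: ps_bound. Qed.

Lemma analytic_at_continuous x f e : analytic_at x f -> 0 < e ->
  \forall y \near polydisc_nbhs x, `|f y - f x| < e.
Proof.
move=> [r [C [r0 psf]]] e0; have C0 := ps_bound_ge0 psf.
have C1 : 0 < e + 2 * C by rewrite ltr_wpDr // mulr_ge0.
exists (r * (e / (e + 2 * C))); first by rewrite mulr_gt0 // divr_gt0.
move=> y yr; apply: (@le_lt_trans _ _ (r * (e / (e + 2 * C)) / r * C)).
  apply: (@ps_lipschitz_at _ _ _ _ _ _ _ _ _ _ _ psf yr).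
  rewrite mulr_gt0 ?divr_gt0 //=; apply: ler_piMr; first exact: ltW.
  by rewrite ler_pdivrMr // mul1r lerDl mulr_ge0.
rewrite (mulrAC r) mulfV ?gt_eqF // mul1r mulrAC ltr_pdivrMr // ltr_pM2l //.
lra.
Qed.

Lemma analytic_at_gt0 x f : analytic_at x f -> 0 < f x ->
  \forall y \near polydisc_nbhs x, 0 < f y.
Proof.
move=> anf fx; apply: filterS (analytic_at_continuous anf fx) => y.
by rewrite ltr_norml => /andP[]; lra.
Qed.

Lemma analytic_at_neq0 x f : analytic_at x f -> f x != 0 ->
  \forall y \near polydisc_nbhs x, f y != 0.
Proof.
rewrite -normr_gt0 => anf fx; apply: filterS (analytic_at_continuous anf fx) => y.
by apply: contraTN => /eqP ->; rewrite sub0r normrN ltxx.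
Qed.

End AnalyticGerms.

(** * Analytic dependence of simple roots *)

Section AnalyticRoots.
Variables (R : realType) (X : Type) (I : finType) (coord : I -> X -> R).
Implicit Types (x y : X) (r C : R) (f g : X -> R).
Notation power_series := (power_series coord).
Notation polydisc := (polydisc coord).
Notation polydisc_nbhs := (polydisc_nbhs coord).
Notation analytic_at := (analytic_at coord).

Lemma polynomial_contraction (d : nat) (a b : R) (g : 'I_d -> R) (z w : R) :
  let phi z := a + b * z + \sum_(i < d) g i * z ^+ i.+2 in
  phi z - phi w = (z - w) *
    (b + \sum_(i < d) g i * \sum_(j < i.+2) z ^+ (i.+1 - j) * w ^+ j).
Proof.
rewrite /= mulrDr big_distrr /= opprD addrACA -sumrB; congr (_ + _).
  by ring.
by apply: eq_bigr => i _; rewrite -mulrBr subrXX mulrCA.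
Qed.

(** The iteration converges normally on a small polydisc, because there the
    map is a contraction for the norm of absolutely convergent power series. *)
Lemma analytic_fixpoint x (d : nat) f g (h : 'I_d -> X -> R) :
  analytic_at x f -> analytic_at x g -> (forall i, analytic_at x (h i)) ->
  f x = 0 -> g x = 0 ->
  exists z, [/\ analytic_at x z, z x = 0 & \forall y \near polydisc_nbhs x,
    z y = f y + g y * z y + \sum_(i < d) h i y * z y ^+ i.+2].
Proof.
move=> anf ang anh fx gx.
have [r0 [G [r0_gt0 G0 psall]]] : exists r C, [/\ 0 < r, 0 <= C & forall j,
    power_series x r C (match j : option (option 'I_d) with
      | None => f | Some None => g | Some (Some i) => h i end)].
  by apply: analytic_at_common => -[[i|]|].
(* [del] bounds the norms of the iterates and [eta] those of the coefficients of
   degree zero and one, which vanish at the centre and hence are small on a small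
   polydisc. The choices make one half a Lipschitz constant of the iteration. *)
pose K := (d * d.+2)%:R * G; have K0 : 0 <= K by rewrite mulr_ge0.
pose del := (2%:R + 4%:R * K)^-1.
have del0 : 0 < del by rewrite invr_gt0 ltr_wpDr // mulr_ge0.
have delE : del * (2%:R + 4%:R * K) = 1.
  by rewrite mulVf // gt_eqF // ltr_wpDr // mulr_ge0.
have delK0 : 0 <= del * K by rewrite mulr_ge0 // ltW.
have del_le : del <= 2^-1 by lra.
have delK : del * K <= 4^-1 by lra.
pose eta := del / 2; have eta0 : 0 < eta by rewrite divr_gt0.
pose r := r0 * (eta / (G + eta)).
have Geta : 0 < G + eta by rewrite ltr_wpDl.
have r_gt0 : 0 < r by rewrite mulr_gt0 // divr_gt0.
have rr0 : 0 < r <= r0.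
  rewrite r_gt0 /=; apply: ler_piMr; first exact: ltW.
  rewrite ler_pdivrMr // mul1r; lra.
have rG : r / r0 * G <= eta.
  rewrite /r (mulrAC r0) mulfV ?gt_eqF // mul1r mulrAC ler_pdivrMr //.
  by apply: ler_wpM2l; [exact: ltW|lra].
have psf : power_series x r eta f.
  apply: ps_weaken rG _; have := ps_shrink rr0 (psall None).
  by rewrite fx; apply: ps_ext => y _; rewrite subr0.
have psg : power_series x r eta g.
  apply: ps_weaken rG _; have := ps_shrink rr0 (psall (Some None)).
  by rewrite gx; apply: ps_ext => y _; rewrite subr0.
have psh i : power_series x r G (h i).
  apply: ps_restrict (psall (Some (Some i))).
  by case/andP: rr0 => /ltW -> ->.
pose phi y z := f y + g y * z + \sum_(i < d) h i y * z ^+ i.+2.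
pose z_ m y := iter m (phi y) 0.
have z_S m y : z_ m.+1 y = phi y (z_ m y) by [].
have half_ge0 m : 0 <= 2^-1 ^+ m :> R by rewrite exprn_ge0.
have half_le1 m : 2^-1 ^+ m <= 1 :> R by rewrite exprn_ile1 //; lra.
have psz m : power_series x r (del * (1 - 2^-1 ^+ m)) (z_ m) /\
    power_series x r (eta * 2^-1 ^+ m) (fun y => z_ m.+1 y - z_ m y).
  elim: m => [|m [IH1 IH2]].
    rewrite expr0 subrr mulr0 mulr1; split.
      by rewrite -[X in power_series _ _ X](@normr0 _ R); exact: ps_const.
    apply: ps_ext psf => y _; rewrite z_S /z_ /= subr0 /phi mulr0 addr0.
    by rewrite big1 ?addr0 // => i _; rewrite expr0n mulr0.
  have psz1 : power_series x r (del * (1 - 2^-1 ^+ m.+1)) (z_ m.+1).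
    have -> : del * (1 - 2^-1 ^+ m.+1) =
       del * (1 - 2^-1 ^+ m) + eta * 2^-1 ^+ m.
      by rewrite exprS /eta; field.
    by apply: ps_ext (ps_add IH1 IH2 (ltW r_gt0)) => y _; rewrite addrC subrK.
  split=> //.
  have le_del u m' : power_series x r (del * (1 - 2^-1 ^+ m')) u ->
      power_series x r del u.
    apply: ps_weaken; apply: ler_piMr; first exact: ltW.
    by rewrite gerBl.
  have {}IH1 := le_del _ _ IH1; have {}psz1 := le_del _ _ psz1.
  pose S y := g y + \sum_(i < d) h i y *
    \sum_(j < i.+2) z_ m.+1 y ^+ (i.+1 - j) * z_ m y ^+ j.
  have psS : power_series x r (eta + \sum_(i < d) G * \sum_(j < i.+2)
      del ^+ (i.+1 - j) * del ^+ j) S.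
    apply: ps_add psg _ (ltW r_gt0).
    apply: ps_sum => [|i _]; first exact: ltW.
    apply: ps_mul => //; apply: ps_sum => [|j _]; first exact: ltW.
    by apply: ps_mul => //; exact: ps_exp.
  have S_le : eta + \sum_(i < d) G * \sum_(j < i.+2)
      del ^+ (i.+1 - j) * del ^+ j <= 2^-1.
    apply: (@le_trans _ _ (eta + del * K)); last by rewrite /eta; lra.
    rewrite lerD2l; apply: (@le_trans _ _ (\sum_(i < d) G * (d.+2%:R * del))).
      apply: ler_sum => i _; apply: ler_wpM2l => //.
      apply: (@le_trans _ _ (\sum_(j < i.+2) del)).
        apply: ler_sum => j _; rewrite -exprD subnK -1?ltnS //.
        rewrite exprS ler_piMr //; first exact: ltW.
        by rewrite exprn_ile1 //; [exact: ltW|lra].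
      rewrite sumr_const card_ord -[del *+ _]mulr_natl.
      apply: ler_wpM2r; first exact: ltW.
      by rewrite ler_nat !ltnS; exact: ltnW.
    rewrite sumr_const card_ord -[X in X <= _]mulr_natl /K natrM.
    by rewrite le_eqVlt; apply/orP; left; apply/eqP; ring.
  apply: (@ps_weaken _ _ _ _ _ _ (eta * 2^-1 ^+ m * 2^-1)).
    by rewrite exprSr mulrA.
  apply: (@ps_weaken _ _ _ _ _ _ (eta * 2^-1 ^+ m *
     (eta + \sum_(i < d) G * \sum_(j < i.+2) del ^+ (i.+1 - j) * del ^+ j))).
    by apply: ler_wpM2l => //; rewrite mulr_ge0 // ltW.
  apply: ps_ext (ps_mul r_gt0 IH2 psS) => y _.
  by rewrite /S !z_S -!/(phi _ _) (polynomial_contraction (f y)).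
have sum_half M : \sum_(0 <= m < M) eta * 2^-1 ^+ m <= del.
  have -> : \sum_(0 <= m < M) eta * 2^-1 ^+ m = del * (1 - 2^-1 ^+ M).
    elim: M => [|M IH]; first by rewrite big_nil expr0 subrr mulr0.
    by rewrite big_nat_recr //= IH exprS /eta; field.
  by apply: ler_piMr; [exact: ltW|rewrite gerBl].
have telesc y : series (fun m => z_ m.+1 y - z_ m y) = z_ ^~ y.
  by apply/funext => M; rewrite /series /= telescope_sumr // subr0.
pose z y := limn (series (fun m => z_ m.+1 y - z_ m y)).
have zcvg y : polydisc x r y -> z_ ^~ y @ \oo --> z y.
  move=> yr; have : cvgn (series (fun m => z_ m.+1 y - z_ m y)).
    by apply: normal_series_cvg sum_half => m; exact: ps_bound (psz m).2 yr.
  by rewrite /z telesc.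
have psz_lim : power_series x r del z.
  apply: (ps_normal_sum r_gt0 (fun m => (psz m).2) sum_half) => y yr.
  by rewrite telesc; exact: zcvg.
exists z; split.
- by exists r, del.
- have zx := zcvg _ (polydisc_center coord x r_gt0).
  rewrite -(cvg_lim _ zx) //; apply: cvg_lim => //.
  rewrite [X in X @ _](_ : _ = fun=> 0); first exact: cvg_cst.
  apply/funext; elim=> // m IH; rewrite z_S IH /phi fx gx mul0r !add0r.
  by apply: big1 => i _; rewrite expr0n mulr0.
- exists r => // y yr; have zy := zcvg _ yr.
  have : z_ ^~ y @ \oo --> phi y (z y).
    rewrite -cvg_shiftS /=; apply: cvgD.
      by apply: cvgD; [exact: cvg_cst|apply: cvgMr].
    apply: cvg_sum_seq => i _; apply: cvgMr; move: (i.+2) => k.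
    elim: k => [|k IH].
      by rewrite expr0; under eq_fun do rewrite expr0; exact: cvg_cst.
    by rewrite exprS; under eq_fun do rewrite exprS; exact: cvgM.
  move=> zy'; transitivity (limn (z_ ^~ y)); last exact: cvg_lim.
  by apply/esym/cvg_lim.
Qed.

Definition analytic_poly_at x (p : X -> {poly R}) := exists2 d : nat,
  (forall y, size (p y) <= d)%N & forall i, analytic_at x (fun y => (p y)`_i).

(** Expanding the polynomial at the simple root and dividing by the value of its
    derivative turns the equation into a fixed point problem. *)
Lemma analytic_simple_root x (p : X -> {poly R}) t :
  analytic_poly_at x p -> root (p x) t -> (p x)^`().[t] != 0 ->
  exists z, [/\ analytic_at x z, z x = t &
    \forall y \near polydisc_nbhs x, root (p y) (z y)].
Proof.
move=> [d sp anp] /rootP p0 p1; set s := (p x)^`().[t] in p1.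
pose q i y := (p y)^`N(i).[t].
have anq i : analytic_at x (q i).
  apply: (@analytic_at_eq _ _ _ _ _ (fun y => \sum_(j < d)
     (p y)`_(i + j) *+ 'C(i + j, i) * t ^+ j)).
    move=> y; rewrite /q (@horner_coef_wide _ d).
      by apply: eq_bigr => j _; rewrite coef_nderivn.
    apply/leq_sizeP => j dj; rewrite coef_nderivn nth_default ?mul0rn //.
    by apply: leq_trans (sp y) _; apply: leq_trans dj (leq_addl _ _).
  apply: analytic_at_sum => j _; apply: analytic_at_mul; last exact: analytic_at_const.
  apply: (@analytic_at_eq _ _ _ _ _ (fun y => 'C(i + j, i)%:R * (p y)`_(i + j))).
    by move=> y; rewrite mulr_natl.
  by apply: analytic_at_mul; [exact: analytic_at_const|exact: anp].
have qx0 : q 0%N x = 0 by rewrite /q nderivn0.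
have qx1 : q 1%N x = s by rewrite /q nderivn1.
have taylor y h : (p y).[t + h] =
    q 0%N y + q 1%N y * h + \sum_(i < d) q i.+2 y * h ^+ i.+2.
  rewrite (@nderiv_taylor_wide _ d.+2); first last.
  - by apply: leq_trans (sp y) _; rewrite ltnW.
  - exact: mulrC.
  by rewrite !big_ord_recl /= expr0 mulr1 expr1 addrA.
have anqs i : analytic_at x (fun y => - (q i y / s)).
  by apply/analytic_at_opp/analytic_at_mul; [exact: anq|exact: analytic_at_const].
have [|||z [anz zx znear]] := @analytic_fixpoint x d (fun y => - (q 0%N y / s))
  (fun y => 1 - q 1%N y / s) (fun i y => - (q i.+2 y / s)) (anqs _) _ (fun=> anqs _).
- by apply: analytic_at_add; [exact: analytic_at_const|exact: anqs].
- by rewrite qx0 mul0r oppr0.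
- by rewrite qx1 mulfV // subrr.
exists (fun y => t + z y); split.
- by apply: analytic_at_add => //; exact: analytic_at_const.
- by rewrite zx addr0.
apply: filterS znear => y zy; apply/rootP; rewrite taylor.
apply/eqP; rewrite -(inj_eq (mulIf (invr_neq0 p1))) mul0r; apply/eqP.
rewrite !mulrDl mulr_suml; move: zy.
have -> : \sum_(i < d) - (q i.+2 y / s) * z y ^+ i.+2 =
   - \sum_(i < d) q i.+2 y * z y ^+ i.+2 / s.
  by rewrite -sumrN; apply: eq_bigr => i _; rewrite mulNr mulrAC.
rewrite mulrBl mul1r (mulrAC (q 1%N y)); lra.
Qed.

Lemma analytic_at_inv x f : analytic_at x f -> f x != 0 ->
  analytic_at x (fun y => (f y)^-1).
Proof.
move=> anf fx; pose p y := f y *: 'X - 1%:P.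
have [|||z [anz zx pz]] := @analytic_simple_root x p (f x)^-1.
- exists 2%N => [y|i].
    apply: leq_trans (size_polyD _ _) _; rewrite geq_max size_polyN size_polyC.
    by rewrite (leq_trans (size_scale_leq _ _)) ?size_polyX //; case: (_ != _).
  rewrite /p; under eq_fun do rewrite coefB coefZ coefX coefC.
  apply: analytic_at_sub; last exact: analytic_at_const.
  by apply: analytic_at_mul => //; exact: analytic_at_const.
- by rewrite /root /p !hornerE mulfV // subrr.
- by rewrite /p derivB derivZ derivX derivC subr0 hornerZ hornerC mulr1.
apply: analytic_at_near_eq anz; apply: filterS pz => y.
rewrite /root /p !hornerE subr_eq0 => /eqP fz.
by rewrite -[RHS]mulr1 -fz mulKf //; apply: contra_eq_neq fz => ->; rewrite mul0r eq_sym oner_eq0.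
Qed.

Lemma analytic_at_sqrt x f : analytic_at x f -> 0 < f x ->
  analytic_at x (fun y => Num.sqrt (f y)).
Proof.
move=> anf fx; pose p y := 'X^2 - (f y)%:P.
have [|||z [anz zx pz]] := @analytic_simple_root x p (Num.sqrt (f x)).
- exists 3%N => [y|i].
    apply: leq_trans (size_polyD _ _) _; rewrite geq_max size_polyN size_polyC.
    by rewrite size_polyXn; case: (_ != _).
  rewrite /p; under eq_fun do rewrite coefB coefXn coefC.
  apply: analytic_at_sub; first exact: analytic_at_const.
  by case: (i == 0%N) => //; exact: analytic_at_const.
- by rewrite /root /p !hornerE sqr_sqrtr ?subrr // ltW.
- by rewrite /p derivB derivXn derivC subr0 hornerMn hornerXn mulrn_eq0 /= gt_eqF // sqrtr_gt0.
have z0 : 0 < z x by rewrite zx sqrtr_gt0.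
apply: (analytic_at_near_eq _ anz).
apply: filterS2 pz (analytic_at_gt0 anz z0) => y.
rewrite /root /p !hornerE subr_eq0 => /eqP <- zy.
by rewrite sqrtr_sqr gtr0_norm.
Qed.

Lemma analytic_at_div x f g : analytic_at x f -> analytic_at x g -> g x != 0 ->
  analytic_at x (fun y => f y / g y).
Proof. by move=> anf ang gx; apply/analytic_at_mul/analytic_at_inv. Qed.

End AnalyticRoots.

(** * Analytic matrices *)

Section AnalyticMatrices.
Variables (R : realType) (X : Type) (I : finType) (coord : I -> X -> R).
Implicit Types (x y : X) (r C : R) (f g : X -> R).
Notation analytic_at := (analytic_at coord).

Definition mx_analytic_at m n x (F : X -> 'M[R]_(m, n)) :=
  forall i j, analytic_at x (fun y => F y i j).

Lemma mx_analytic_at_near_eq m n x (F G : X -> 'M[R]_(m, n)) :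
  (\forall y \near polydisc_nbhs coord x, F y = G y) ->
  mx_analytic_at x F -> mx_analytic_at x G.
Proof.
move=> FG anF i j; apply: (analytic_at_near_eq _ (anF i j)).
by apply: filterS FG => y ->.
Qed.

Lemma mx_analytic_at_const m n x (F : 'M[R]_(m, n)) : mx_analytic_at x (fun=> F).
Proof. by move=> i j; exact: analytic_at_const. Qed.

Lemma mx_analytic_at_sub m n x (F G : X -> 'M[R]_(m, n)) :
  mx_analytic_at x F -> mx_analytic_at x G -> mx_analytic_at x (fun y => F y - G y).
Proof.
move=> anF anG i j; under eq_fun do rewrite !mxE.
exact: analytic_at_sub.
Qed.

Lemma mx_analytic_at_scale m n x f (F : X -> 'M[R]_(m, n)) :
  analytic_at x f -> mx_analytic_at x F -> mx_analytic_at x (fun y => f y *: F y).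
Proof.
move=> anf anF i j; under eq_fun do rewrite mxE.
exact: analytic_at_mul.
Qed.

Lemma mx_analytic_at_sum m n (J : Type) (s : seq J) (P : pred J) x
    (F : J -> X -> 'M[R]_(m, n)) : (forall j, P j -> mx_analytic_at x (F j)) ->
  mx_analytic_at x (fun y => \sum_(j <- s | P j) F j y).
Proof.
move=> anF i j; under eq_fun do rewrite summxE.
by apply: analytic_at_sum => k Pk; exact: anF.
Qed.

Lemma mx_analytic_at_mul m n p x (F : X -> 'M[R]_(m, n)) (G : X -> 'M[R]_(n, p)) :
  mx_analytic_at x F -> mx_analytic_at x G -> mx_analytic_at x (fun y => F y *m G y).
Proof.
move=> anF anG i j; under eq_fun do rewrite mxE.
by apply: analytic_at_sum => k _; exact: analytic_at_mul.
Qed.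

Lemma mx_analytic_at_tr m n x (F : X -> 'M[R]_(m, n)) :
  mx_analytic_at x F -> mx_analytic_at x (fun y => (F y)^T).
Proof. by move=> anF i j; under eq_fun do rewrite mxE; exact: anF. Qed.

Lemma analytic_at_det n x (F : X -> 'M[R]_n) :
  mx_analytic_at x F -> analytic_at x (fun y => \det (F y)).
Proof.
move=> anF; apply: analytic_at_sum => s _.
apply: analytic_at_mul; first exact: analytic_at_const.
by apply: analytic_at_prod => i _; exact: anF.
Qed.

Lemma mx_analytic_at_adj n x (F : X -> 'M[R]_n) :
  mx_analytic_at x F -> mx_analytic_at x (fun y => \adj (F y)).
Proof.
move=> anF i j; under eq_fun do rewrite mxE.
apply: analytic_at_mul; first exact: analytic_at_const.
by apply: analytic_at_det => k l; under eq_fun do rewrite !mxE; exact: anF.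
Qed.

Lemma analytic_at_dotv n x (F G : X -> 'cV[R]_n) :
  mx_analytic_at x F -> mx_analytic_at x G -> analytic_at x (fun y => dotv (F y) (G y)).
Proof. by move=> anF anG; apply: analytic_at_sum => i _; apply: analytic_at_mul. Qed.

Notation analytic_poly_at := (analytic_poly_at coord).

Lemma analytic_poly_at_C x f : analytic_at x f -> analytic_poly_at x (fun y => (f y)%:P).
Proof.
move=> anf; exists 1%N => [y|i]; first by rewrite size_polyC; case: (_ != _).
under eq_fun do rewrite coefC.
by case: (i == 0%N) => //; exact: analytic_at_const.
Qed.

Lemma analytic_poly_at_const x (q : {poly R}) : analytic_poly_at x (fun=> q).
Proof. by exists (size q) => // i; exact: analytic_at_const. Qed.

Lemma analytic_poly_at_add x (p q : X -> {poly R}) : analytic_poly_at x p ->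
  analytic_poly_at x q -> analytic_poly_at x (fun y => p y + q y).
Proof.
move=> [d sp anp] [d' sq anq]; exists (maxn d d') => [y|i].
  apply: leq_trans (size_polyD _ _) _.
  by rewrite geq_max !leq_max sp sq orbT.
by under eq_fun do rewrite coefD; exact: analytic_at_add.
Qed.

Lemma analytic_poly_at_mul x (p q : X -> {poly R}) : analytic_poly_at x p ->
  analytic_poly_at x q -> analytic_poly_at x (fun y => p y * q y).
Proof.
move=> [d sp anp] [d' sq anq]; exists (d + d')%N => [y|i].
  apply: leq_trans (size_polyMleq _ _) _; apply: leq_trans (leq_pred _) _.
  exact: leq_add.
under eq_fun do rewrite coefM.
by apply: analytic_at_sum => j _; exact: analytic_at_mul.
Qed.

Lemma analytic_poly_at_det n x (F : X -> 'M[{poly R}]_n) :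
  (forall i j, analytic_poly_at x (fun y => F y i j)) ->
  analytic_poly_at x (fun y => \det (F y)).
Proof.
move=> anF; rewrite /determinant.
have big_poly (op : {poly R} -> {poly R} -> {poly R}) t (J : Type) (s : seq J)
    (G : J -> X -> {poly R}) :
    (forall p q : X -> {poly R}, analytic_poly_at x p -> analytic_poly_at x q ->
       analytic_poly_at x (fun y => op (p y) (q y))) ->
    (forall j, analytic_poly_at x (G j)) ->
    analytic_poly_at x (fun y => \big[op/t]_(j <- s) G j y).
  move=> anop anG; elim: s => [|j s IH].
    by under eq_fun do rewrite big_nil; exact: analytic_poly_at_const.
  by under eq_fun do rewrite big_cons; exact: anop.
apply: (big_poly) => [|s]; first exact: analytic_poly_at_add.
apply: analytic_poly_at_mul; first exact: analytic_poly_at_const.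
by apply: (big_poly) => [|i]; first exact: analytic_poly_at_mul.
Qed.

End AnalyticMatrices.

(** * Orders of vanishing in one coordinate *)

Section VanishingOrder.
Variables (R : realType) (X : Type) (I : finType) (coord : I -> X -> R).
Variables (i0 : I) (x0 : X).
Hypothesis x00 : coord i0 x0 = 0.
Implicit Types (f g : X -> R) (m : nat).

(** A big O of the power [m] of one coordinate, uniform in the other ones. *)
Definition vanishes m f := exists C, \forall y \near polydisc_nbhs coord x0,
  `|f y| <= C * `|coord i0 y| ^+ m.

Lemma vanishes_eq m f g :
  (\forall y \near polydisc_nbhs coord x0, f y = g y) -> vanishes m f -> vanishes m g.
Proof.
by move=> fg [C fC]; exists C; apply: filterS2 fg fC => y ->.
Qed.

Lemma vanishes_add m f g : vanishes m f -> vanishes m g -> vanishes m (fun y => f y + g y).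
Proof.
move=> [C fC] [D gD]; exists (C + D); apply: filterS2 fC gD => y fC gD.
by apply: (le_trans (ler_normD _ _)); rewrite mulrDl lerD.
Qed.

Lemma vanishes_mul m m' f g : vanishes m f -> vanishes m' g ->
  vanishes (m + m') (fun y => f y * g y).
Proof.
move=> [C fC] [D gD]; exists (C * D); apply: filterS2 fC gD => y fC gD.
by rewrite exprD mulrACA normrM; apply: ler_pM.
Qed.

Lemma analytic_at_vanishes0 f : analytic_at coord x0 f -> vanishes 0 f.
Proof.
move=> anf; have [C fC] := analytic_at_bounded anf; exists C.
by apply: filterS fC => y; rewrite mulr1.
Qed.

Lemma vanishes_le m m' f : (m <= m')%N -> vanishes m' f -> vanishes m f.
Proof.
move=> mm' [C fC]; exists `|C|.
apply: filterS2 fC (near_polydisc coord x0 ltr01) => y fC /(_ i0).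
rewrite x00 subr0 => y1; apply: (le_trans fC).
rewrite -(subnK mm') exprD mulrA; apply: ler_wpM2r; first exact: exprn_ge0.
apply: (le_trans (ler_norm _)); rewrite normrM normrX normr_id.
by rewrite ler_piMr // exprn_ile1 // ltW.
Qed.

Lemma vanishes_mull m f g : analytic_at coord x0 g -> vanishes m f ->
  vanishes m (fun y => g y * f y).
Proof. by move=> ang; apply: (@vanishes_mul 0); exact: analytic_at_vanishes0. Qed.

Lemma vanishes_opp m f : vanishes m f -> vanishes m (fun y => - f y).
Proof.
move=> fm; apply: (vanishes_eq _ (vanishes_mull (analytic_at_const _ _ (-1)) fm)).
by apply: nearW => y; rewrite mulN1r.
Qed.

Lemma vanishes_sub m f g : vanishes m f -> vanishes m g -> vanishes m (fun y => f y - g y).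
Proof. by move=> fm gm; apply/vanishes_add/vanishes_opp. Qed.

Lemma vanishes_sum (J : Type) (s : seq J) (P : pred J) m (f_ : J -> X -> R) :
  (forall j, P j -> vanishes m (f_ j)) -> vanishes m (fun y => \sum_(j <- s | P j) f_ j y).
Proof.
move=> fm; elim: s => [|j s IH].
  by exists 0; apply: nearW => y; rewrite big_nil normr0 mul0r.
case: (boolP (P j)) => Pj; last first.
  by apply: (vanishes_eq _ IH); apply: nearW => y; rewrite big_cons (negPf Pj).
apply: (vanishes_eq _ (vanishes_add (fm _ Pj) IH)).
by apply: nearW => y; rewrite big_cons Pj.
Qed.

Lemma vanishes_coord m : vanishes m (fun y => coord i0 y ^+ m).
Proof. by exists 1; apply: nearW => y; rewrite mul1r normrX. Qed.

(** Monomials which do not contain the coordinate cancel in the difference; the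
    other ones are divisible by it. *)
Lemma analytic_at_vanishes1 f (p : X -> X) : analytic_at coord x0 f ->
  (forall y, coord i0 (p y) = 0) ->
  (forall y i, i != i0 -> coord i (p y) = coord i y) ->
  vanishes 1 (fun y => f y - f (p y)).
Proof.
move=> [r [C [r0 [c [cC cf]]]]] p0 pE; exists (C / r); exists r => // y yr.
have pyr : polydisc coord x0 r (p y).
  move=> i; have [->|ii0] := eqVneq i i0; last by rewrite pE.
  by rewrite p0 x00 subr0 normr0.
pose S z := series (homogeneous_part c (fun i => coord i z - coord i x0)).
have ul : (fun N => S y N - S (p y) N) @ \oo --> f y - f (p y).
  by apply: cvgB; exact: cf.
apply: (cvg_norm_le_bound ul) => N; rewrite /S /series /= -sumrB.
set t := coord i0 y.
apply: (@le_trans _ _ (\sum_(0 <= k < N) (`|t| / r) *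
    homogeneous_part (fun a => `|c a|) (fun=> r) k)); last first.
  rewrite -mulr_sumr expr1 (_ : C / r * _ = `|t| / r * C); last by ring.
  by apply: ler_wpM2l => //; rewrite divr_ge0 // ltW.
apply: (le_trans (ler_norm_sum _ _ _)); apply: ler_sum => k _.
rewrite -sumrB big_distrr; apply: (le_trans (ler_norm_sum _ _ _)).
apply: ler_sum => a _; rewrite -mulrBr normrM /= mulrCA; apply: ler_wpM2l => //.
rewrite (bigD1 i0) //= [X in _ - X](bigD1 i0) //= [X in _ <= _ * X](bigD1 i0) //=.
have -> : \prod_(i | i != i0) (coord i (p y) - coord i x0) ^+ a i =
          \prod_(i | i != i0) (coord i y - coord i x0) ^+ a i.
  by apply: eq_bigr => i ii0; rewrite pE.
rewrite p0 x00 subrr subr0 -/t -mulrBl normrM mulrA; apply: ler_pM => //.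
  case: (nat_of_ord (a i0)) => [|j]; first by rewrite !expr0 subrr normr0 mulr1 divr_ge0 // ltW.
  rewrite expr0n subr0 normrX !exprS mulrA divfK ?gt_eqF //.
  rewrite ler_wpM2l // lerXn2r ?nnegrE // ?ltW //.
  by have := yr i0; rewrite x00 subr0.
rewrite normr_prod; apply: ler_prod => i ii0; rewrite normr_ge0 normrX /=.
by rewrite lerXn2r ?nnegrE // ltW // yr.
Qed.

End VanishingOrder.

(** * Monic orthogonal polynomials on the unit interval *)

Section Legendre.
Variable R : realType.
Implicit Types p q : {poly R}.

(** The integral over [0, 1]. *)
Definition integral01 p : R := \sum_(i < size p) p`_i / i.+1%:R.

Lemma integral01_wide n p : (size p <= n)%N ->
  integral01 p = \sum_(i < n) p`_i / i.+1%:R.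
Proof.
move=> sp; rewrite /integral01 (big_ord_widen n (fun i => p`_i / i.+1%:R)) //.
rewrite big_mkcond /=; apply: eq_bigr => i _; case: ltnP => // pi.
by rewrite nth_default // mul0r.
Qed.

Lemma integral01D p q : integral01 (p + q) = integral01 p + integral01 q.
Proof.
have spq := size_polyD p q.
rewrite (integral01_wide spq) (@integral01_wide (maxn (size p) (size q)) p) ?leq_maxl //.
rewrite (@integral01_wide (maxn (size p) (size q)) q) ?leq_maxr // -big_split.
by apply: eq_bigr => i _; rewrite coefD mulrDl.
Qed.

Lemma integral01Z c p : integral01 (c *: p) = c * integral01 p.
Proof.
rewrite (integral01_wide (size_scale_leq c p)) /integral01 mulr_sumr.
by apply: eq_bigr => i _; rewrite coefZ mulrA.
Qed.

Lemma integral01Mn p n : integral01 (p *+ n) = n%:R * integral01 p.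
Proof. by rewrite -scaler_nat integral01Z. Qed.

Lemma integral01_deriv p : integral01 p^`() = p.[1] - p.[0].
Proof.
rewrite (@integral01_wide (size p)); last exact: leq_trans (size_poly _ _) (leq_pred _).
rewrite horner_coef0 (@horner_coef_wide _ (size p).+1) // big_ord_recl.
rewrite expr0 mulr1 addrAC subrr add0r; apply: eq_bigr => i _.
by rewrite coef_deriv expr1n mulr1 -[_ *+ i.+1]mulr_natr mulfK // pnatr_eq0.
Qed.

Lemma integral01_parts p q :
  integral01 (p^`() * q) = (p * q).[1] - (p * q).[0] - integral01 (p * q^`()).
Proof. by rewrite -integral01_deriv derivM integral01D addrK. Qed.

Lemma derivn_mul_XsubC_exp_root p c i m :
  (i < m)%N -> (p * ('X - c%:P) ^+ m)^`(i).[c] = 0.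
Proof.
elim: i m p => [|i IH] [|m] p //.
  by rewrite derivn0 !hornerE subrr expr0n mulr0.
move=> im; rewrite derivSn.
have -> : (p * ('X - c%:P) ^+ m.+1)^`() =
    (p^`() * ('X - c%:P) + m.+1%:R *: p) * ('X - c%:P) ^+ m.
  rewrite derivM deriv_exp derivXsubC /= mulrDl exprS mulrA; congr (_ + _).
  by rewrite mul1r mulrnAr scaler_nat mulrnAl.
exact: IH.
Qed.

(** Repeated integration by parts: the boundary terms are zero because of the
    multiplicity of the roots 0 and 1. *)
Lemma rodrigues m q : let W := 'X^m * ('X - 1%:P) ^+ m in
  integral01 (W^`(m) * q) = (-1) ^+ m * integral01 (W * q^`(m)).
Proof.
move=> W; have W1 i : (i < m)%N -> W^`(i).[1] = 0 by exact: derivn_mul_XsubC_exp_root.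
have W0 i : (i < m)%N -> W^`(i).[0] = 0.
  have -> : W = ('X - 1%:P) ^+ m * ('X - 0%:P) ^+ m by rewrite polyC0 subr0 mulrC.
  exact: derivn_mul_XsubC_exp_root.
suff H j : (j <= m)%N ->
    integral01 (W^`(m) * q) = (-1) ^+ j * integral01 (W^`(m - j) * q^`(j)).
  by rewrite (H m) // subnn derivn0.
elim: j => [|j IH] jm; first by rewrite subn0 derivn0 expr0 mul1r.
rewrite IH ?(ltnW jm) // -(subnSK jm) derivnS integral01_parts -derivnS.
rewrite !hornerM W0 ?W1; try lia.
by rewrite !mul0r subr0 sub0r mulrN exprS mulN1r mulNr.
Qed.

Lemma fact_neq0 k : k`!%:R != 0 :> R.
Proof. by rewrite pnatr_eq0 -lt0n fact_gt0. Qed.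

Lemma integral01_beta a b : integral01 ('X^a * ('X - 1%:P) ^+ b) =
  (-1) ^+ b * (a`!%:R * b`!%:R) / (a + b).+1`!%:R.
Proof.
elim: b a => [|b IH] a.
  rewrite !expr0 mulr1 mul1r addn0 /integral01 size_polyXn big_ord_recr /=.
  rewrite big1 => [|i _]; last by rewrite coefXn ltn_eqF ?ltn_ord // mul0r.
  rewrite coefXn eqxx fact0 add0r factS natrM.
  have -> : true%:R = 1 :> R by [].
  by field; rewrite fact_neq0 ?natr1 ?nat1r pnatr_eq0.
have := integral01_parts 'X^(a.+1) (('X - 1%:P) ^+ b.+1).
rewrite !hornerE subrr expr0n mulr0 expr0n !mul0r subrr sub0r derivXn deriv_exp.
rewrite derivXsubC mul1r /= mulrnAl integral01Mn [X in - integral01 X]mulrnAr.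
rewrite integral01Mn IH => E.
have a0 : a.+1%:R != 0 :> R by rewrite pnatr_eq0.
apply: (mulfI a0); rewrite E addSn addnS [a.+1`!]factS [b.+1`!]factS !natrM exprS.
by ring.
Qed.

(** Rodrigues' formula on [0, 1], normalized to be monic. *)
Definition legendre m : {poly R} :=
  (m`!%:R / (2 * m)`!%:R) *: ('X^m * ('X - 1%:P) ^+ m)^`(m).

(** The square of the L2 norm of the polynomial above. *)
Definition legendre_norm m : R :=
  m`!%:R ^+ 4 / ((2 * m)`!%:R * (2 * m).+1`!%:R).

Lemma legendre_norm_gt0 m : 0 < legendre_norm m.
Proof. by rewrite divr_gt0 ?exprn_gt0 ?mulr_gt0 ?ltr0n ?fact_gt0. Qed.

Lemma kappa_legendre_norm m : kappa R m.+1 = legendre_norm m / m`!%:R ^+ 2.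
Proof.
rewrite /kappa /legendre_norm (_ : 2 * m.+1 = (2 * m).+2)%N /=; last by lia.
by field; rewrite !fact_neq0.
Qed.

Lemma legendre_weight_monic m :
  ('X^m * ('X - 1%:P) ^+ m : {poly R}) \is monic /\
  size ('X^m * ('X - 1%:P) ^+ m : {poly R}) = (2 * m).+1.
Proof.
have mX : ('X - 1%:P) ^+ m \is @monic R by rewrite monic_exp // monicXsubC.
split; first by rewrite monicMl ?monicXn.
by rewrite size_monicM ?monicXn ?monic_neq0 // size_polyXn size_exp_XsubC; lia.
Qed.

Lemma legendre_lead m : (legendre m)`_m = 1.
Proof.
have [mW sW] := legendre_weight_monic m.
rewrite coefZ coef_derivn addnn -mul2n; move: mW; rewrite monicE lead_coefE sW /= => /eqP ->.
have := ffact_fact (leq_addr m m); rewrite addKn addnn -mul2n => <-.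
rewrite natrM; field.
by rewrite fact_neq0 pnatr_eq0 -lt0n ffact_gt0; lia.
Qed.

Lemma legendre_coef_gt m j : (m < j)%N -> (legendre m)`_j = 0.
Proof.
move=> mj; have [_ sW] := legendre_weight_monic m.
by rewrite coefZ coef_derivn nth_default ?mul0rn ?mulr0 // sW; lia.
Qed.

(** The Hilbert matrix is the Gram matrix of the monomials, so its product with
    the coefficients of a polynomial gives the moments of this polynomial. *)
Lemma legendre_momentE m i : \sum_(j < m.+1) (legendre m)`_j / (i + j).+1%:R =
  integral01 (legendre m * 'X^i).
Proof.
have s_leg : (size (legendre m) <= m.+1)%N.
  by apply/leq_sizeP => j mj; rewrite legendre_coef_gt.
rewrite (@integral01_wide (i + m.+1)).
  rewrite big_split_ord /= [X in _ = X + _]big1 ?add0r => [|j _].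
    by apply: eq_bigr => j _; rewrite coefMXn ltnNge leq_addr /= addKn.
  by rewrite coefMXn ltn_ord mul0r.
apply: leq_trans (size_polyMleq _ _) _; rewrite size_polyXn addnS /= addnC.
by rewrite leq_add2l.
Qed.

Lemma legendre_moment m i : integral01 (legendre m * 'X^i) =
  (m`!%:R / (2 * m)`!%:R) * ((-1) ^+ m *
    integral01 ('X^m * ('X - 1%:P) ^+ m * ('X^i)^`(m))).
Proof. by rewrite -scalerAl integral01Z rodrigues. Qed.

Lemma legendre_orthogonal m i : (i < m)%N ->
  \sum_(j < m.+1) (legendre m)`_j / (i + j).+1%:R = 0.
Proof.
move=> im; rewrite legendre_momentE legendre_moment derivn_poly0 ?size_polyXn //.
by rewrite mulr0 /integral01 size_poly0 big_ord0 !mulr0.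
Qed.

(** After the integrations by parts the moment is a Beta integral. *)
Lemma legendre_moment_high m i : \sum_(j < m.+1) (legendre m)`_j / (m + i + j).+1%:R =
  m`!%:R / (2 * m)`!%:R * (((m + i) ^_ m)%:R *
    ((m + i)`!%:R * m`!%:R / (m + i + m).+1`!%:R)).
Proof.
rewrite legendre_momentE legendre_moment derivnXn addKn mulrnAr integral01Mn.
rewrite [_ * 'X^i]mulrAC -exprD integral01_beta.
have ss : (-1) ^+ m * (-1) ^+ m = 1 :> R by rewrite -expr2 sqrr_sign.
transitivity ((-1) ^+ m * (-1) ^+ m * (m`!%:R / (2 * m)`!%:R * (((m + i) ^_ m)%:R *
  ((m + i)`!%:R * m`!%:R / (m + i + m).+1`!%:R))) : R); last by rewrite ss mul1r.
by ring.
Qed.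

Lemma legendre_moment_diag m :
  \sum_(j < m.+1) (legendre m)`_j / (m + j).+1%:R = legendre_norm m.
Proof.
have := legendre_moment_high m 0; rewrite addn0 => ->.
rewrite ffactnn addnn -mul2n /legendre_norm; field.
by rewrite !fact_neq0.
Qed.

Lemma legendre_moment_next m :
  \sum_(j < m.+1) (legendre m)`_j / (m.+1 + j).+1%:R = m.+1%:R / 2 * legendre_norm m.
Proof.
have := legendre_moment_high m 1; rewrite addn1 => ->.
have := ffact_fact (leqnSn m); rewrite subSnn factS muln1 => ->.
rewrite addSn addnn -mul2n /legendre_norm (factS (2 * m).+1) factS !natrM.
have -> : (2 * m).+2%:R = 2 * m.+1%:R :> R by rewrite -natrM; congr _%:R; lia.
field.
by rewrite fact_neq0 -natrM !nat1r !pnatr_eq0.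
Qed.

(** Expressing that two consecutive polynomials are orthogonal determines the
    subleading coefficient. *)
Lemma legendre_subleading m : (legendre m.+1)`_m = - (m.+1%:R / 2).
Proof.
have H : \sum_(i < m.+1) (legendre m)`_i *
    \sum_(j < m.+2) (legendre m.+1)`_j / (i + j).+1%:R = 0.
  by apply: big1 => i _; rewrite legendre_orthogonal ?mulr0.
move: H; under eq_bigr do rewrite mulr_sumr.
rewrite exchange_big /=.
have E (j : 'I_m.+2) : \sum_(i < m.+1) (legendre m)`_i * ((legendre m.+1)`_j / (i + j).+1%:R) =
    (legendre m.+1)`_j * \sum_(i < m.+1) (legendre m)`_i / (j + i).+1%:R.
  by rewrite mulr_sumr; apply: eq_bigr => i _; rewrite mulrCA addnC.
under eq_bigr do rewrite E.
rewrite 2!big_ord_recr /= big1 ?add0r => [|i _]; last first.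
  by rewrite legendre_orthogonal ?mulr0.
rewrite legendre_moment_diag legendre_moment_next legendre_lead mul1r -mulrDl => /eqP.
by rewrite mulf_eq0 (gt_eqF (legendre_norm_gt0 m)) orbF addr_eq0 => /eqP ->.
Qed.

End Legendre.

(** * Orthonormal families and orthogonal projectors *)

Section EuclideanTheory.
Variables (R : realType) (n : nat).
Implicit Types (u v w : 'cV[R]_n) (E : {vspace 'cV[R]_n}) (M : 'M[R]_n).

Lemma dotvE u v : u^T *m v = (dotv u v)%:M.
Proof.
apply/matrixP => i j; rewrite !ord1 !mxE eqxx mulr1n.
by apply: eq_bigr => k _; rewrite mxE.
Qed.

Lemma dotvC u v : dotv u v = dotv v u.
Proof. by apply: eq_bigr => i _; rewrite mulrC. Qed.

Lemma dotvDl u v w : dotv (u + v) w = dotv u w + dotv v w.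
Proof. by rewrite -big_split; apply: eq_bigr => i _; rewrite mxE mulrDl. Qed.

Lemma dotvZl a u v : dotv (a *: u) v = a * dotv u v.
Proof. by rewrite mulr_sumr; apply: eq_bigr => i _; rewrite mxE mulrA. Qed.

Lemma dotvDr u v w : dotv w (u + v) = dotv w u + dotv w v.
Proof. by rewrite !(dotvC w) dotvDl. Qed.

Lemma dotvZr a u v : dotv u (a *: v) = a * dotv u v.
Proof. by rewrite !(dotvC u) dotvZl. Qed.

Lemma dotvBr u v w : dotv w (u - v) = dotv w u - dotv w v.
Proof. by rewrite -[- v]scaleN1r dotvDr dotvZr mulN1r. Qed.

Lemma dotv0r u : dotv u 0 = 0.
Proof. by rewrite -(scale0r 0) dotvZr mul0r. Qed.

Lemma dotv0l u : dotv 0 u = 0. Proof. by rewrite dotvC dotv0r. Qed.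

Lemma dotv_sumr (J : Type) (s : seq J) (P : pred J) u (F : J -> 'cV[R]_n) :
  dotv u (\sum_(j <- s | P j) F j) = \sum_(j <- s | P j) dotv u (F j).
Proof.
elim: s => [|j s IH]; first by rewrite !big_nil dotv0r.
by rewrite !big_cons; case: ifP => // _; rewrite dotvDr IH.
Qed.

Lemma dotv_suml (J : Type) (s : seq J) (P : pred J) u (F : J -> 'cV[R]_n) :
  dotv (\sum_(j <- s | P j) F j) u = \sum_(j <- s | P j) dotv (F j) u.
Proof. by rewrite dotvC dotv_sumr; apply: eq_bigr => j _; rewrite dotvC. Qed.

Lemma dotv_mulmx u M v : dotv u (M *m v) = dotv (M^T *m u) v.
Proof.
have : (dotv u (M *m v))%:M = (dotv (M^T *m u) v)%:M :> 'M[R]_1.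
  by rewrite -!dotvE trmx_mul trmxK mulmxA.
by move=> /matrixP/(_ 0 0); rewrite !mxE !eqxx !mulr1n.
Qed.

Lemma dotv_ge0 u : 0 <= dotv u u.
Proof. by apply: sumr_ge0 => i _; rewrite -expr2 sqr_ge0. Qed.

Lemma dotv_eq0 u : dotv u u = 0 -> u = 0.
Proof.
move=> /eqP; rewrite psumr_eq0 => [/allP u0|i _]; last by rewrite -expr2 sqr_ge0.
apply/matrixP => i j; rewrite ord1 mxE; apply/eqP.
by have /= := u0 i (mem_index_enum _); rewrite mulf_eq0 orbb.
Qed.

Lemma dotv_gt0 u : u != 0 -> 0 < dotv u u.
Proof.
by rewrite lt_neqAle dotv_ge0 andbT; apply: contra_neq => /esym/dotv_eq0.
Qed.

Lemma enorm_sqr u : enorm u ^+ 2 = dotv u u.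
Proof. by rewrite sqr_sqrtr ?dotv_ge0. Qed.

Lemma rank1_mul u v w : (u *m v^T) *m w = dotv v w *: u.
Proof. by rewrite -mulmxA dotvE mul_mx_scalar. Qed.

Lemma dotv_span_eq0 (X : seq 'cV[R]_n) u : (forall v, v \in X -> dotv v u = 0) ->
  forall v, v \in <<X>>%VS -> dotv v u = 0.
Proof.
move=> Xu v vX; have vX' : v \in <<in_tuple X>>%VS by [].
rewrite (coord_span vX') dotv_suml big1 // => i _.
by rewrite dotvZl Xu ?mulr0 // mem_nth.
Qed.

Lemma orthoproj_unique E M : is_orthoproj E M -> orthoproj E = M.
Proof.
move=> EM; apply: xget_unique => // M' EM'.
have MM' (x : 'cV[R]_n) : M' *m x = M *m x.
  apply/eqP; rewrite -subr_eq0; apply/eqP; apply: dotv_eq0.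
  have [Mx xM] := EM x; have [M'x xM'] := EM' x.
  have dE : M' *m x - M *m x \in E by rewrite memvB.
  have -> : dotv (M' *m x - M *m x) (M' *m x - M *m x) =
      dotv (M' *m x - M *m x) ((x - M *m x) - (x - M' *m x)).
    by congr dotv; rewrite opprB [RHS]addrC addrA subrK.
  by rewrite dotvBr xM // xM' // subrr.
apply/matrixP => i j.
have /matrixP/(_ i 0) := MM' (delta_mx j 0).
by rewrite -!colE !mxE.
Qed.

Definition orthonormal_on (q : nat -> 'cV[R]_n) (s : seq nat) :=
  forall i j, i \in s -> j \in s -> dotv (q i) (q j) = (i == j)%:R.

Lemma orthonormal_is_orthoproj q s : uniq s -> orthonormal_on q s ->
  is_orthoproj <<[seq q j | j <- s]>>%VS (\sum_(j <- s) q j *m (q j)^T).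
Proof.
move=> us qs x.
have -> : (\sum_(j <- s) q j *m (q j)^T) *m x = \sum_(j <- s) dotv (q j) x *: q j.
  by rewrite mulmx_suml; apply: eq_bigr => j _; rewrite rank1_mul.
split.
  rewrite big_seq; apply: memv_suml => j js; apply/memvZ/memv_span.
  exact: map_f.
apply: dotv_span_eq0 => _ /mapP[i is_ ->].
rewrite dotvBr dotv_sumr (bigD1_seq i) //= dotvZr qs // eqxx mulr1.
rewrite big_seq_cond big1 ?addr0 ?subrr // => j /andP[js ji].
by rewrite dotvZr qs // eq_sym (negPf ji) mulr0.
Qed.

Lemma orthoproj_orthonormal q s : uniq s -> orthonormal_on q s ->
  orthoproj <<[seq q j | j <- s]>>%VS = \sum_(j <- s) q j *m (q j)^T.
Proof. by move=> us qs; apply/orthoproj_unique/orthonormal_is_orthoproj. Qed.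

Lemma is_orthoproj_id E M v : is_orthoproj E M -> v \in E -> M *m v = v.
Proof.
move=> EM vE; have [Mv vM] := EM v.
apply/esym/eqP; rewrite -subr_eq0; apply/eqP; apply: dotv_eq0.
by apply: vM; rewrite memvB.
Qed.

Lemma orthonormal_basis_eq0 (q : nat -> 'cV[R]_n) w :
  (forall i j : 'I_n, dotv (q i) (q j) = (i == j)%:R) ->
  (forall i : 'I_n, dotv (q i) w = 0) -> w = 0.
Proof.
move=> qq w0; pose P := \matrix_(i < n, j < n) q i j 0.
have PP : P *m P^T = 1%:M.
  apply/matrixP => i j; rewrite !mxE -qq.
  by apply: eq_bigr => k _; rewrite !mxE.
have Pw : P *m w = 0.
  apply/matrixP => i j; rewrite !mxE ord1 -[RHS](w0 i).
  by apply: eq_bigr => k _; rewrite !mxE.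
by rewrite -[w]mul1mx -(mulmx1C PP) -mulmxA Pw mulmx0.
Qed.

End EuclideanTheory.

(** * The Krylov basis *)

Lemma iota_rcons m k : iota m k.+1 = rcons (iota m k) (m + k)%N.
Proof. by rewrite -addn1 iotaD cats1. Qed.

Section GramSchmidt.
Variables (R : realType) (n : nat) (A : 'M[R]_n) (b : 'cV[R]_n).
Hypothesis Ab : controllable A b.
Notation q := (krylov_basis A b).
Notation K p := (A ^+ p *m b).

Lemma krylov_S k : krylov A b k.+1 = (krylov A b k + <[K k]>)%VS.
Proof. by rewrite /krylov iota_rcons map_rcons -cats1 span_cat span_seq1 add0n. Qed.

Lemma krylov_mem p k : (p < k)%N -> K p \in krylov A b k.
Proof.
by move=> pk; apply/memv_span/mapP; exists p; rewrite ?mem_iota.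
Qed.

Lemma krylov_free : free [seq K i | i <- iota 0 n].
Proof.
set X := map _ _; have sX : size X == n by rewrite size_map size_iota.
have -> : X = Tuple sX by [].
apply/freeP => c c0; pose Km := \matrix_(i < n, j < n) (A ^+ j *m b) i 0.
have Ku : Km \in unitmx by rewrite -row_full_unit /row_full; apply/eqP; exact: Ab.
have : Km *m (\col_i c i) = 0.
  rewrite -c0; apply/matrixP => i j; rewrite mxE summxE; apply: eq_bigr => k _.
  by rewrite !mxE mulrC (nth_map 0%N) ?size_iota // nth_iota // add0n ord1 mxE.
move=> /(congr1 (mulmx (invmx Km))); rewrite mulKmx // mulmx0 => /matrixP c00 i.
by have := c00 i 0; rewrite !mxE.
Qed.

Lemma krylov_notin k : (k < n)%N -> K k \notin krylov A b k.
Proof.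
move=> kn; have := krylov_free.
have -> : iota 0 n = iota 0 k.+1 ++ iota k.+1 (n - k.+1).
  by rewrite -iotaD subnKC.
rewrite map_cat => /catl_free; rewrite iota_rcons map_rcons.
rewrite (@perm_free _ _ _ (K k :: [seq K i | i <- iota 0 k])).
  by rewrite free_cons => /andP[].
by rewrite add0n perm_rcons.
Qed.

Lemma krylov_basis_orthonormal_span k : (k <= n)%N ->
  orthonormal_on q (iota 1 k) /\ <<[seq q j | j <- iota 1 k]>>%VS = krylov A b k.
Proof.
elim: k => [|k IH] kn; first by [].
have [oq sq] := IH (ltnW kn).
pose r := K k - orthoproj (krylov A b k) *m K k.
have [pK rq] : orthoproj (krylov A b k) *m K k \in krylov A b k /\
    (forall v, v \in krylov A b k -> dotv v r = 0).
  rewrite /r -sq (orthoproj_orthonormal (iota_uniq _ _) oq).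
  exact: (orthonormal_is_orthoproj (iota_uniq _ _) oq (K k)).
have r0 : r != 0.
  by apply: contraNneq (krylov_notin kn) => /eqP; rewrite subr_eq0 => /eqP ->.
have rr : 0 < enorm r by rewrite sqrtr_gt0 dotv_gt0.
have qS : q k.+1 = (enorm r)^-1 *: r by [].
have {}rq j : j \in iota 1 k -> dotv (q j) r = 0.
  by move=> jk; rewrite rq // -sq; exact/memv_span/map_f.
have qq : dotv (q k.+1) (q k.+1) = 1.
  by rewrite qS dotvZl dotvZr -enorm_sqr; field; rewrite gt_eqF.
have kS j : j \in iota 1 k -> (j == k.+1) = false.
  by rewrite mem_iota => jk; apply/eqP => jk'; lia.
split.
  rewrite iota_rcons add1n => i j; rewrite !mem_rcons !inE.
  move=> /orP[/eqP ->|ik] /orP[/eqP ->|jk].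
  - by rewrite eqxx.
  - by rewrite dotvC qS dotvZr rq // mulr0 eq_sym kS.
  - by rewrite qS dotvZr rq // mulr0 kS.
  - exact: oq.
rewrite krylov_S iota_rcons add1n map_rcons -cats1 span_cat span_seq1 sq.
have rK : r = enorm r *: q k.+1 by rewrite qS scalerA mulfV ?scale1r // gt_eqF.
apply/eqP; rewrite eqEsubv !subv_add !addvSl /= -!memvE; apply/andP; split.
  rewrite qS memvZ // /r; apply: memvB; first by rewrite memvE addvSr.
  by apply: subvP pK; exact: addvSl.
rewrite -(subrK (orthoproj (krylov A b k) *m K k) (K k)) -/r; apply: memvD.
  by rewrite rK memvZ // memvE addvSr.
by apply: subvP pK; exact: addvSl.
Qed.

Lemma krylov_basis_orthonormal i j : (1 <= i <= n)%N -> (1 <= j <= n)%N ->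
  dotv (q i) (q j) = (i == j)%:R.
Proof.
move=> hi hj; have [oq _] := krylov_basis_orthonormal_span (leqnn n).
by apply: oq; rewrite mem_iota add1n ltnS.
Qed.

Lemma krylov_orthoproj k : (k <= n)%N ->
  orthoproj (krylov A b k) = \sum_(1 <= j < k.+1) q j *m (q j)^T.
Proof.
move=> kn; have [oq <-] := krylov_basis_orthonormal_span kn.
by rewrite orthoproj_orthonormal ?iota_uniq // /index_iota subn1.
Qed.

Lemma krylov_basis_perp i v : (1 <= i <= n)%N -> v \in krylov A b i.-1 ->
  dotv (q i) v = 0.
Proof.
move=> /andP[i1 i_n]; have [|_ <-] := @krylov_basis_orthonormal_span i.-1; first by lia.
rewrite dotvC; apply: dotv_span_eq0 => _ /mapP[j jk ->].
move: jk; rewrite mem_iota => jk; rewrite krylov_basis_orthonormal; try lia.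
by case: eqP => // ji; lia.
Qed.

Lemma krylov_basis_perp_pow i p : (1 <= i <= n)%N -> (p.+1 < i)%N ->
  dotv (q i) (K p) = 0.
Proof.
move=> hi pi; apply: krylov_basis_perp => //; apply: krylov_mem.
by rewrite -ltnS prednK //; lia.
Qed.

Lemma krylov_expand k v : (k <= n)%N -> v \in krylov A b k ->
  v = \sum_(1 <= j < k.+1) dotv (q j) v *: q j.
Proof.
move=> kn vk; have [oq sq] := krylov_basis_orthonormal_span kn; rewrite -sq in vk.
have proj := orthonormal_is_orthoproj (iota_uniq 1 k) oq.
rewrite -{1}(is_orthoproj_id proj vk) mulmx_suml /index_iota subn1.
by apply: eq_bigr => j _; rewrite rank1_mul.
Qed.

Lemma krylov_d_gt0 k : (1 <= k <= n)%N -> 0 < krylov_d A b k.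
Proof.
case: k => // k /andP[_ kn].
pose r := K k - orthoproj (krylov A b k) *m K k.
have pK : orthoproj (krylov A b k) *m K k \in krylov A b k.
  have [oq <-] := krylov_basis_orthonormal_span (ltnW kn).
  rewrite (orthoproj_orthonormal (iota_uniq _ _) oq).
  exact: (orthonormal_is_orthoproj (iota_uniq _ _) oq (K k)).1.
have r0 : r != 0.
  by apply: contraNneq (krylov_notin kn) => /eqP; rewrite subr_eq0 => /eqP ->.
have rr : 0 < enorm r by rewrite sqrtr_gt0 dotv_gt0.
rewrite /krylov_d /= -[X in dotv _ X](subrK (orthoproj (krylov A b k) *m K k)).
rewrite dotvDr (@krylov_basis_perp k.+1 _ _ pK) ?addr0; last by rewrite /= kn.
have -> : q k.+1 = (enorm r)^-1 *: r by [].
by rewrite dotvZl mulr_gt0 ?invr_gt0 // dotv_gt0.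
Qed.

Lemma krylov_mulA k v : v \in krylov A b k -> A *m v \in krylov A b k.+1.
Proof.
set X := [seq K i | i <- iota 0 k] => vX; have vX' : v \in <<in_tuple X>>%VS by [].
rewrite (coord_span vX') mulmx_sumr; apply: memv_suml => i _.
rewrite -scalemxAr; apply: memvZ; have := ltn_ord i; rewrite {2}size_map size_iota => ik.
rewrite (nth_map 0%N) ?size_iota // nth_iota // mulmxA.
have -> : A *m A ^+ (0 + i) = A ^+ i.+1 by rewrite exprS.
exact: krylov_mem.
Qed.

Lemma krylov_basis_mem k : (1 <= k <= n)%N -> q k \in krylov A b k.
Proof.
move=> /andP[k1 kn]; have [_ <-] := krylov_basis_orthonormal_span kn.
by apply/memv_span/map_f; rewrite mem_iota k1 /= add1n ltnS.
Qed.

(** [A] raises the Krylov index by at most one. *)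
Lemma krylov_hessenberg i j : (1 <= j)%N -> (j.+1 < i <= n)%N ->
  dotv (q i) (A *m q j) = 0.
Proof.
move=> j1 /andP[ji i_n]; apply: krylov_basis_perp; first by lia.
have : A *m q j \in krylov A b j.+1 by apply/krylov_mulA/krylov_basis_mem; lia.
have ji' : (j.+1 <= i.-1)%N by lia.
move: (j.+1) (i.-1) ji' => a c; elim: c => [|c IH].
  by rewrite leqn0 => /eqP ->.
rewrite leq_eqVlt => /orP[/eqP -> //|ac vA]; rewrite krylov_S.
by apply: subvP (IH _ vA) => //; exact: addvSl.
Qed.

(** Only the last two basis vectors entering [A^p b] can contribute, by the
    Hessenberg form of [A]. *)
Lemma krylov_pow_step k p : (1 <= k <= n)%N -> (p < k)%N ->
  dotv (q k) (A *m K p) = dotv (q k) (K p) * krylov_a A b k +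
    dotv (q k.-1) (K p) * krylov_beta A b k.-1.
Proof.
move=> hk pk; have Kp : K p \in krylov A b k by exact: krylov_mem.
have kn : (k <= n)%N by lia.
have k_gt0 : (0 < k)%N by lia.
rewrite {1}(krylov_expand kn Kp) mulmx_sumr dotv_sumr big_nat_recr //= addrC.
rewrite -scalemxAr dotvZr; congr (_ + _).
case: k hk pk Kp kn k_gt0 => // -[|k] hk pk Kp kn _ /=.
  by rewrite big_geq // /krylov_beta /= mulr0.
rewrite big_nat_recr //= -scalemxAr dotvZr /krylov_beta /= kn.
rewrite big_nat_cond big1 ?add0r // => j /andP[/andP[j1 jk] _].
by rewrite -scalemxAr dotvZr krylov_hessenberg ?mulr0 //; lia.
Qed.

Lemma krylov_beta_d k : (1 <= k < n)%N ->
  krylov_d A b k.+1 = krylov_beta A b k * krylov_d A b k.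
Proof.
case: k => // k kn; rewrite /krylov_d /=.
have -> : A ^+ k.+1 *m b = A *m K k by rewrite exprS -mulmxA.
rewrite (@krylov_pow_step k.+2) ?ltnSn ?kn //=.
by rewrite krylov_basis_perp_pow ?mul0r ?add0r 1?mulrC //; lia.
Qed.

(** By this recursion the quotient on the left is [a_1 + ... + a_k]. *)
Lemma krylov_a_quotient k : (1 <= k <= n)%N ->
  dotv (q k) (K k) / krylov_d A b k = krylov_a A b k +
    (if (k == 1)%N then 0 else dotv (q k.-1) (K k.-1) / krylov_d A b k.-1).
Proof.
case: k => // k kn; have d0 : krylov_d A b k.+1 != 0 by rewrite gt_eqF ?krylov_d_gt0.
have -> : A ^+ k.+1 *m b = A *m K k by rewrite exprS -mulmxA.
rewrite krylov_pow_step //.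
rewrite mulrDl mulrAC /krylov_d /= mulfV // mul1r; congr (_ + _).
case: k kn d0 => [|k] kn d0; first by rewrite /krylov_beta /= mulr0 mul0r.
have d1 : krylov_d A b k.+1 != 0 by rewrite gt_eqF // krylov_d_gt0 //; lia.
have := @krylov_beta_d k.+1; rewrite kn => /(_ isT) d2.
have -> : dotv (q k.+2) (K k.+1) = krylov_d A b k.+2 by [].
have -> : dotv (q k.+1) (K k) = krylov_d A b k.+1 by [].
rewrite d2 eqSS /=; field.
by move: d0; rewrite d2 mulf_eq0 negb_or => /andP[-> ->].
Qed.

End GramSchmidt.

(** * Symmetric matrices with simple spectrum *)

Section SimpleSpectrum.
Variables (R : realType) (n : nat).

Definition oriented_eigvec (G : 'M[R]_n) (u : 'cV[R]_n) (k : nat) : 'cV[R]_n :=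
  xget 0 [set v | [/\ G *m v = nth 0 (eigenvalues G) k *: v, enorm v = 1 & 0 < dotv v u]].

Definition spectral_family (G : 'M[R]_n) (lam : nat -> R) (psi : nat -> 'cV[R]_n) :=
  [/\ G^T = G, forall k, (k < n)%N -> G *m psi k = lam k *: psi k,
      forall k, (k < n)%N -> dotv (psi k) (psi k) = 1 &
      forall i j, (i < j < n)%N -> lam j < lam i].

Lemma spectral_family_scale G lam psi c : 0 < c -> spectral_family G lam psi ->
  spectral_family (c *: G) (fun i => c * lam i) psi.
Proof.
move=> c0 [Gsym Gpsi psi1 decr]; split=> //.
- by rewrite linearZ /= Gsym.
- by move=> k kn; rewrite -scalemxAl Gpsi // scalerA.
- by move=> i j ij; rewrite ltr_pM2l //; exact: decr.
Qed.

Variables (G : 'M[R]_n) (lam : nat -> R) (psi : nat -> 'cV[R]_n).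
Hypothesis Gspec : spectral_family G lam psi.

Let Gsym : G^T = G. Proof. by case: Gspec. Qed.

Let Gpsi k : (k < n)%N -> G *m psi k = lam k *: psi k.
Proof. by case: Gspec => _ + _ _; exact. Qed.

Let psi1 k : (k < n)%N -> dotv (psi k) (psi k) = 1.
Proof. by case: Gspec => _ _ + _; exact. Qed.

Let lam_decr i j : (i < j < n)%N -> lam j < lam i.
Proof. by case: Gspec => _ _ _; exact. Qed.

Lemma simple_spectrum_inj i j : (i < n)%N -> (j < n)%N -> lam i = lam j -> i = j.
Proof.
move=> iln jln lij; case: (ltngtP i j) => // ij.
  by have := @lam_decr i j; rewrite ij lij ltxx jln => /(_ isT).
by have := @lam_decr j i; rewrite ij lij ltxx iln => /(_ isT).
Qed.

Lemma eigvec_orthogonal k (v : 'cV[R]_n) a : (k < n)%N -> G *m v = a *: v ->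
  lam k != a -> dotv (psi k) v = 0.
Proof.
move=> kn Gv la; have := dotv_mulmx (psi k) G v.
rewrite Gsym Gpsi // Gv dotvZr dotvZl => /eqP.
by rewrite -subr_eq0 -mulrBl mulf_eq0 subr_eq0 eq_sym (negPf la) => /eqP.
Qed.

Lemma eigvec_orthonormal i j : (i < n)%N -> (j < n)%N ->
  dotv (psi i) (psi j) = (i == j)%:R.
Proof.
move=> iln jln; case: eqVneq => [<-|ij]; first exact: psi1.
apply: (eigvec_orthogonal iln (Gpsi jln)).
by apply: contra_neq ij; exact: simple_spectrum_inj.
Qed.

Lemma simple_eigenspace k v : (k < n)%N -> G *m v = lam k *: v ->
  v = dotv (psi k) v *: psi k.
Proof.
move=> kn Gv; apply/eqP; rewrite -subr_eq0; apply/eqP; apply: (orthonormal_basis_eq0 (q := psi)).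
  by move=> i j; exact: eigvec_orthonormal.
move=> i; have iln := ltn_ord i.
rewrite dotvBr dotvZr eigvec_orthonormal //; case: eqVneq => [->|ik].
  by rewrite mulr1 subrr.
rewrite mulr0 subr0; apply: (eigvec_orthogonal iln Gv).
by apply: contra_neq ik; exact: simple_spectrum_inj.
Qed.

(** The [n] distinct eigenvalues exhaust the roots of the characteristic
    polynomial, and a list is determined by its product of linear factors once it
    is sorted. *)
Lemma simple_spectrum_eigenvalues : eigenvalues G = [seq lam i | i <- iota 0 n].
Proof.
set s := map _ _; have ge_tr : transitive (fun x y : R => y <= x).
  by move=> y x z xy yz; exact: le_trans yz xy.
have ssort : sorted (fun x y => y <= x) s.
  apply/(sortedP 0) => i; rewrite size_map size_iota => iln.
  rewrite !(nth_map 0%N) ?size_iota //; try lia.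
  rewrite !nth_iota ?add0n; try lia.
  by apply/ltW/lam_decr; rewrite ltnSn.
have schar : char_poly G = \prod_(z <- s) ('X - z%:P).
  rewrite [LHS](@all_roots_prod_XsubC _ _ s).
  - by have /monicP -> := char_poly_monic G; rewrite scale1r.
  - by rewrite size_char_poly size_map size_iota.
  - apply/allP => x /mapP[i]; rewrite mem_iota add0n => /andP[_ iln] ->.
    rewrite -eigenvalue_root_char; apply/eigenvalueP; exists (psi i)^T.
      by rewrite -{1}Gsym -trmx_mul Gpsi // linearZ.
    apply/eqP => /(congr1 trmx); rewrite trmxK trmx0 => p0.
    by have := psi1 iln; rewrite p0 dotv0r => /esym/eqP; rewrite oner_eq0.
  - rewrite uniq_rootsE map_inj_in_uniq ?iota_uniq // => i j.
    by rewrite !mem_iota !add0n; exact: simple_spectrum_inj.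
apply: xget_unique => // s' [s'char s'sort].
apply: (sorted_eq ge_tr) => //.
  by move=> x y /andP[xy yx]; apply/eqP; rewrite eq_le xy yx.
by apply: prod_XsubC_eq; rewrite -s'char -schar.
Qed.

Lemma nth_simple_spectrum k : (k < n)%N -> nth 0 (eigenvalues G) k = lam k.
Proof.
move=> kn; rewrite simple_spectrum_eigenvalues (nth_map 0%N) ?size_iota //.
by rewrite nth_iota.
Qed.

(** The eigenspace is a line, in which norm and orientation leave one vector. *)
Lemma oriented_eigvecE u k : (k < n)%N -> 0 < dotv (psi k) u ->
  oriented_eigvec G u k = psi k.
Proof.
move=> kn pu; have e1 : enorm (psi k) = 1 by rewrite /enorm psi1 // sqrtr1.
apply: xget_unique; first by split; rewrite ?nth_simple_spectrum ?Gpsi.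
move=> v [Gv v1 vu]; move: Gv; rewrite nth_simple_spectrum // => Gv.
have vE := simple_eigenspace kn Gv; set c := dotv (psi k) v in vE.
have c2 : c ^+ 2 = 1.
  have := enorm_sqr v; rewrite v1 expr1n vE dotvZl dotvZr psi1 // mulr1 => ->.
  by rewrite expr2.
have c0 : 0 < c by move: vu; rewrite vE dotvZl pmulr_lgt0.
have : c = 1 by apply/eqP; rewrite -(@eqrXn2 _ 2) ?ltW // c2 expr1n.
by rewrite vE => ->; rewrite scale1r.
Qed.

End SimpleSpectrum.

Section GramianSpectrum.
Variables (R : realType) (n : nat) (T : R) (A : 'M[R]_n) (b : 'cV[R]_n).
Variables (lam : nat -> R) (psi : nat -> 'cV[R]_n).
Hypothesis Gspec : spectral_family (gramian T A b) lam psi.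
Hypothesis psi_q : forall k, (k < n)%N -> 0 < dotv (psi k) (krylov_basis A b k.+1).

Lemma gramian_eigval k : (1 <= k <= n)%N -> eigval T A b k = lam k.-1.
Proof. by case: k => // k kn; exact: (nth_simple_spectrum Gspec). Qed.

Lemma gramian_eigvec k : (1 <= k <= n)%N -> eigvec T A b k = psi k.-1.
Proof.
by case: k => // k kn; exact: (oriented_eigvecE Gspec kn (psi_q kn)).
Qed.

Lemma gramian_spectral_proj k : (k <= n)%N ->
  spectral_proj T A b k = \sum_(i < k) psi i *m (psi i)^T.
Proof.
move=> kn; rewrite /spectral_proj orthoproj_orthonormal ?iota_uniq //.
  rewrite (iotaDl 1 0) big_map -{1}(subn0 k) -/(index_iota 0 k).
  rewrite big_mkord; apply: eq_bigr => i _; rewrite gramian_eigvec //.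
  by rewrite add1n /= (leq_trans (ltn_ord i)).
move=> i j; rewrite !mem_iota => ik jk; rewrite !gramian_eigvec; try lia.
rewrite (eigvec_orthonormal Gspec); try lia.
by congr (nat_of_bool _)%:R; lia.
Qed.

Lemma gramian_strictly_ordered : (forall k, (k < n)%N -> 0 < lam k) ->
  strictly_ordered T A b.
Proof.
move=> lam0; split=> [[|k] kn|k kn] //.
  by rewrite !gramian_eigval /=; try lia; have [_ _ _] := Gspec; apply; rewrite ltnSn.
by rewrite gramian_eigval //; apply: lam0; lia.
Qed.

Lemma gramian_eigenspaces_not_orthogonal : eigenspaces_not_orthogonal T A b.
Proof.
move=> [|k] kn //; exists (psi k); split; last by rewrite gt_eqF ?psi_q.
by have [_ + _ _] := Gspec; rewrite gramian_eigval //=; exact.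
Qed.

End GramianSpectrum.

(** * The space of times and pairs *)

Section PairSpace.
Variables (R : realType) (n : nat).
Notation X := (R * ('M[R]_n * 'cV[R]_n))%type.
Notation c3 := (@coord3 R n).
Implicit Types (x y : X).

Lemma polydisc_ball x r : 0 < r -> polydisc c3 x r = ball x r.
Proof.
move=> r0; apply/seteqP; split=> y.
  move=> yr; split.
    by rewrite /ball /= distrC; exact: (yr (inl tt)).
  split; split=> // i j; rewrite /ball /= distrC.
    exact: (yr (inr (inl (i, j)))).
  by rewrite ord1; exact: (yr (inr (inr i))).
move=> [y1 [[_ y2] [_ y3]]] [[]|[[i j]|i]] /=; rewrite distrC; first exact: y1.
  exact: (y2 i j).
exact: (y3 i 0).
Qed.

Lemma time_analytic x : analytic_at c3 x (fun y => y.1).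
Proof. exact: (@analytic_at_coord _ _ _ c3 x (inl tt)). Qed.

Lemma pair_matrix_analytic x : mx_analytic_at c3 x (fun y => y.2.1).
Proof. by move=> i j; exact: (@analytic_at_coord _ _ _ c3 x (inr (inl (i, j)))). Qed.

Lemma pair_vector_analytic x : mx_analytic_at c3 x (fun y => y.2.2).
Proof.
by move=> i j; rewrite ord1; exact: (@analytic_at_coord _ _ _ c3 x (inr (inr i))).
Qed.

Lemma krylov_pow_S (A : 'M[R]_n) (b : 'cV[R]_n) p :
  A ^+ p.+1 *m b = A *m (A ^+ p *m b).
Proof. by rewrite exprS -mulmxA. Qed.

Lemma krylov_pow_analytic x p : mx_analytic_at c3 x (fun y => y.2.1 ^+ p *m y.2.2).
Proof.
elim: p => [|p IH].
  by under eq_fun do rewrite expr0 mul1mx; exact: pair_vector_analytic.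
by under eq_fun do rewrite krylov_pow_S; apply: mx_analytic_at_mul => //;
  exact: pair_matrix_analytic.
Qed.

Definition kalman_matrix x := \matrix_(i < n, j < n) (x.2.1 ^+ j *m x.2.2) i 0.

Lemma controllable_det x : controllable x.2.1 x.2.2 <-> \det (kalman_matrix x) != 0.
Proof.
rewrite -unitfE -unitmxE -row_full_unit /row_full.
by split=> [/eqP|/eqP].
Qed.

(** Controllability is the non-vanishing of a determinant. *)
Lemma controllable_near x : controllable x.2.1 x.2.2 ->
  \forall y \near polydisc_nbhs c3 x, controllable y.2.1 y.2.2.
Proof.
move=> /controllable_det dx.
have an : analytic_at c3 x (fun y => \det (kalman_matrix y)).
  apply: analytic_at_det => i j; under eq_fun do rewrite mxE.
  exact: krylov_pow_analytic.
by apply: filterS (analytic_at_neq0 an dx) => y /controllable_det.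
Qed.

Lemma analytic_at_enorm x (F : X -> 'cV[R]_n) : mx_analytic_at c3 x F -> F x != 0 ->
  analytic_at c3 x (fun y => enorm (F y)).
Proof.
move=> anF F0; apply: (@analytic_at_sqrt _ _ _ _ _ (fun y => dotv (F y) (F y))).
  exact: analytic_at_dotv.
exact: dotv_gt0.
Qed.

(** The Gram-Schmidt process uses rational operations and square roots of positive
    quantities. *)
Lemma krylov_basis_analytic x k : controllable x.2.1 x.2.2 -> (1 <= k <= n)%N ->
  mx_analytic_at c3 x (fun y => krylov_basis y.2.1 y.2.2 k).
Proof.
move=> cx; elim/ltn_ind: k => -[//|k] IH kn.
pose P y := orthoproj (krylov y.2.1 y.2.2 k).
have anP : mx_analytic_at c3 x P.
  apply: (@mx_analytic_at_near_eq _ _ _ _ _ _ _ (fun y => \sum_(1 <= j < k.+1)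
     krylov_basis y.2.1 y.2.2 j *m (krylov_basis y.2.1 y.2.2 j)^T)).
    by apply: filterS (controllable_near cx) => y cy; rewrite /P krylov_orthoproj // ltnW.
  under eq_fun do rewrite big_nat_cond.
  apply: mx_analytic_at_sum => j /andP[jk _].
  have anq : mx_analytic_at c3 x (fun y => krylov_basis y.2.1 y.2.2 j).
    by apply: IH; lia.
  by apply: mx_analytic_at_mul => //; exact: mx_analytic_at_tr.
pose r y := y.2.1 ^+ k *m y.2.2 - P y *m (y.2.1 ^+ k *m y.2.2).
have anr : mx_analytic_at c3 x r.
  apply: mx_analytic_at_sub; first exact: krylov_pow_analytic.
  by apply: mx_analytic_at_mul => //; exact: krylov_pow_analytic.
have r0 : r x != 0.
  apply/eqP => r0; have := krylov_d_gt0 cx kn.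
  have -> : krylov_d x.2.1 x.2.2 k.+1 = dotv ((enorm (r x))^-1 *: r x) (x.2.1 ^+ k *m x.2.2) by [].
  by rewrite r0 scaler0 dotv0l ltxx.
apply: mx_analytic_at_scale => //; apply: analytic_at_inv.
  exact: analytic_at_enorm.
by rewrite gt_eqF // sqrtr_gt0 dotv_gt0.
Qed.

End PairSpace.

(** * Cauchy products *)

Section CauchyProduct.
Variable R : realType.
Implicit Types a b : nat -> R.

Lemma triangular_sum a b N :
  \sum_(0 <= m < N) \sum_(0 <= p < m.+1) a p * b (m - p)%N =
  \sum_(0 <= p < N) a p * \sum_(0 <= s < N - p) b s.
Proof.
elim: N => [|N IH]; first by rewrite !big_nil.
rewrite big_nat_recr //= IH [X in _ + X = _]big_nat_recr //= [RHS]big_nat_recr //=.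
rewrite addrA; congr (_ + _); last by rewrite subnn subSnn big_nat1.
rewrite -big_split /= big_nat_cond [RHS]big_nat_cond; apply: eq_bigr => p.
move=> /andP[/andP[_ pN] _]; rewrite subSn; last exact: ltnW.
by rewrite [in RHS]big_nat_recr //= mulrDr.
Qed.

(** The sums over the square and over the triangle differ by at most [N ^ 2]
    terms of order [th ^ N], and [N ^ 2 <= 4 ^ N]: this is where [th <= 1 / 8] is
    used. *)
Lemma cauchy_product_geometric a b C th (l l' : R) : 0 <= th <= 8^-1 ->
  (forall p, `|a p| <= C * th ^+ p) -> (forall p, `|b p| <= C * th ^+ p) ->
  series a @ \oo --> l -> series b @ \oo --> l' ->
  series (fun m => \sum_(0 <= p < m.+1) a p * b (m - p)%N) @ \oo --> l * l'.
Proof.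
move=> /andP[th0 th8] aC bC al bl'.
have C0 : 0 <= C by have := le_trans (normr_ge0 _) (aC 0%N); rewrite mulr1.
have diff N : series a N * series b N -
    series (fun m => \sum_(0 <= p < m.+1) a p * b (m - p)%N) N =
    \sum_(0 <= p < N) a p * \sum_(N - p <= s < N) b s.
  rewrite /series /= triangular_sum mulr_suml -sumrB; apply: eq_bigr => p _.
  rewrite -mulrBr; congr (_ * _).
  by rewrite (big_cat_nat (leq0n _) (leq_subr p N)) /= addrAC subrr add0r.
have diff_le N : `|\sum_(0 <= p < N) a p * \sum_(N - p <= s < N) b s| <=
    C ^+ 2 * 2^-1 ^+ N.
  apply: (@le_trans _ _ (\sum_(0 <= p < N) \sum_(0 <= s < N) C ^+ 2 * th ^+ N)).
    apply: (le_trans (ler_norm_sum _ _ _)); apply: ler_sum_nat => p /andP[_ pN].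
    rewrite mulr_sumr; apply: (le_trans (ler_norm_sum _ _ _)).
    apply: (@le_trans _ _ (\sum_(N - p <= s < N) C ^+ 2 * th ^+ N)).
      apply: ler_sum_nat => s /andP[Ns sN]; rewrite normrM.
      apply: (@le_trans _ _ ((C * th ^+ p) * (C * th ^+ s))); first exact: ler_pM.
      rewrite mulrACA -expr2 -exprD; apply: ler_wpM2l; first exact: exprn_ge0.
      rewrite -(@subnKC N (p + s)); last by lia.
      rewrite exprD ler_piMr ?exprn_ge0 // exprn_ile1 //; lra.
    rewrite [leRHS](big_cat_nat (leq0n _) (leq_subr p N)) /= lerDr.
    by apply: sumr_ge0 => s _; rewrite mulr_ge0 ?exprn_ge0.
  rewrite !sumr_const_nat subn0 -mulrnA -[X in X <= _]mulr_natr -mulrA.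
  apply: ler_wpM2l; first exact: exprn_ge0.
  apply: (@le_trans _ _ (8^-1 ^+ N * 4 ^+ N)).
    apply: ler_pM => //; first exact: exprn_ge0.
      by rewrite lerXn2r ?nnegrE //; lra.
    rewrite -natrX ler_nat (_ : 4 = 2 * 2)%N // expnMn.
    by apply: leq_mul; exact/ltnW/ltn_expl.
  rewrite -exprMn (_ : 8^-1 * 4 = 2^-1 :> R) //; by field.
have half_cvg : (fun N => C ^+ 2 * 2^-1 ^+ N) @ \oo --> (0 : R).
  rewrite -[X in _ --> X](mulr0 (C ^+ 2)); apply: cvgMr.
  by apply: cvg_expr; rewrite ger0_norm; lra.
have diff0 : (fun N => series a N * series b N -
    series (fun m => \sum_(0 <= p < m.+1) a p * b (m - p)%N) N) @ \oo --> (0 : R).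
  apply/cvgrPdist_le => e e0; move/cvgrPdist_le : half_cvg => /(_ _ e0).
  apply: filterS => N; rewrite !sub0r !normrN diff; apply: le_trans.
  by apply: le_trans (diff_le N) (ler_norm _).
rewrite -[l * l']subr0; set c := series _; rewrite -/c in diff0.
have -> : c = fun N => series a N * series b N - (series a N * series b N - c N).
  by apply/funext => N; rewrite subKr.
by apply: cvgB; [exact: cvgM|exact: diff0].
Qed.

End CauchyProduct.

(** * Integration of power series *)

Section Integrals.
Variable R : realType.
Notation mu := (@lebesgue_measure R).
Local Open Scope ereal_scope.

Lemma integral_monomial (T : R) m : (0 < T)%R ->
  \int[mu]_(t in `[0%R, T]) (t ^+ m)%:E = (T ^+ m.+1 / m.+1%:R)%:E.
Proof.
move=> T0; rewrite (@continuous_FTC2 _ _ (fun t => t ^+ m.+1 / m.+1%:R)%R) //.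
- by rewrite expr0n /= mul0r sube0.
- by apply: continuous_subspaceT => x; exact: exprn_continuous.
- have cF : continuous (fun t : R => t ^+ m.+1 / m.+1%:R)%R.
    by move=> x; apply: cvgMl; exact: exprn_continuous.
  split.
  + move=> x _; apply: derivableM; last exact: derivable_cst.
    exact: exprn_derivable.
  + by apply: cvg_at_right_filter; exact: cF.
  + by apply: cvg_at_left_filter; exact: cF.
- move=> x _; rewrite derive1Mr; last exact: exprn_derivable.
  rewrite derive1E exp_derive // scaler1 /= -mulr_natl.
  by rewrite mulrAC mulfV ?mul1r // pnatr_eq0.
Qed.

Lemma continuous_integrable (T : R) (f : R -> R) : continuous f ->
  mu.-integrable `[0%R, T] (EFin \o f).
Proof.
move=> cf; apply: continuous_compact_integrable; first exact: segment_compact.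
exact: continuous_subspaceT.
Qed.

Lemma integral_polynomial (T : R) (c : nat -> R) N : (0 < T)%R ->
  \int[mu]_(t in `[0%R, T]) (\sum_(0 <= m < N) c m * t ^+ m)%:E =
  (\sum_(0 <= m < N) c m * (T ^+ m.+1 / m.+1%:R))%:E.
Proof.
move=> T0; under eq_integral do rewrite -sumEFin.
rewrite -sumEFin integral_sum //; last first.
  move=> m; apply: (@continuous_integrable T (fun t => c m * t ^+ m)%R) => x.
  by apply: cvgMr; exact: exprn_continuous.
apply: eq_bigr => m _; under eq_integral do rewrite EFinM.
rewrite integralZl // ?integral_monomial //.
by apply: (@continuous_integrable T (fun t => t ^+ m)%R); exact: exprn_continuous.
Qed.

(** Termwise integration, by dominated convergence: the partial sums are
    bounded by the sum of a geometric series. *)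
Lemma integral_power_series (T : R) (c : nat -> R) (f : R -> R) C : (0 < T)%R ->
  (forall m t, (0 <= t <= T)%R -> `|c m * t ^+ m|%R <= C * 2^-1 ^+ m)%R ->
  (forall t, (0 <= t <= T)%R -> series (fun m => c m * t ^+ m)%R @ \oo --> f t) ->
  series (fun m => c m * (T ^+ m.+1 / m.+1%:R))%R @ \oo -->
    (\int[mu]_(t in `[0%R, T]) f t)%R.
Proof.
move=> T0 cC cf.
have C0 : (0 <= C)%R.
  have := cC 0%N 0%R; rewrite lexx ltW // => /(_ isT).
  by rewrite !expr0 !mulr1; apply: le_trans; exact: normr_ge0.
pose S N (t : R) := (\sum_(0 <= m < N) c m * t ^+ m)%R.
have cS N : continuous (S N).
  elim: N => [|N IH] t.
    rewrite (_ : S 0%N = fun=> 0%R); first exact: cvg_cst.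
    by apply/funext => s; rewrite /S big_nil.
  rewrite (_ : S N.+1 = fun t => S N t + c N * t ^+ N)%R.
    by apply: cvgD; [exact: IH|apply: cvgMr; exact: exprn_continuous].
  by apply/funext => s; rewrite /S big_nat_recr.
have mS N := measurable_int mu (continuous_integrable T (@cS N)).
have cfE t : `[0%R, T]%classic t -> (fun N => (EFin \o S N) t) @ \oo --> (EFin \o f) t.
  by rewrite /= in_itv /= => tT; apply: cvg_EFin; [exact: nearW|exact: cf].
have mf : measurable_fun `[0%R, T] (EFin \o f).
  exact: (emeasurable_fun_cvg _ _ mS cfE).
have [|||fint _ fcvg] := @dominated_convergence _ _ R mu `[0%R, T] (measurable_itv _)
  (fun N => EFin \o S N) (EFin \o f) (fun=> (2 * C)%:E) mS mf.
- by apply: aeW => t; exact: cfE.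
- by apply: (@continuous_integrable T (fun=> 2 * C)%R) => x; exact: cvg_cst.
- apply: aeW => t N; rewrite /= in_itv /= => tT; rewrite lee_fin.
  apply: (le_trans (ler_norm_sum _ _ _)).
  apply: (@le_trans _ _ (\sum_(0 <= m < N) C * 2^-1 ^+ m)%R).
    by apply: ler_sum => m _; exact: cC.
  exact: sum_half_le.
have fE : \int[mu]_(t in `[0%R, T]) (EFin \o f) t = (\int[mu]_(t in `[0%R, T]) f t)%R%:E.
  by rewrite /Rintegral fineK //; exact: integrable_fin_num fint.
move: fcvg; rewrite fE => /fine_cvgP[_].
rewrite (_ : fine \o _ = series (fun m => c m * (T ^+ m.+1 / m.+1%:R))%R) //.
by apply/funext => N /=; rewrite integral_polynomial.
Qed.

End Integrals.

(** * The Gramian as a power series in the time *)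

Section GramianSeries.
Variables (R : realType) (n : nat).
Implicit Types (A M : 'M[R]_n) (b : 'cV[R]_n) (T t rho C : R).

Definition exp_coef A p : 'M[R]_n := (p`!%:R)^-1 *: A ^+ p.
Definition flow_coef A b p : 'cV[R]_n := exp_coef A p *m b.
(** The Cauchy coefficients of the integrand of the Gramian. *)
Definition gramian_coef A b m : 'M[R]_n :=
  \sum_(0 <= p < m.+1) flow_coef A b p *m (flow_coef A b (m - p)%N)^T.
(** The Gramian divided by the time: being the sum of a power series it makes sense
    for small times of both signs and for time zero. *)
Definition scaled_gramian T A b : 'M[R]_n := \matrix_(i, j)
  limn (series (fun m => gramian_coef A b m i j * (T ^+ m / m.+1%:R))).

Lemma cvg_matrix (m p : nat) (u : nat -> 'M[R]_(m, p)) (l : 'M[R]_(m, p)) :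
  (forall i j, (fun k => u k i j) @ \oo --> l i j) -> u @ \oo --> l.
Proof.
move=> ul; apply/cvg_ballP => e e0.
have : \forall k \near \oo, forall i j, ball (l i j) e (u k i j).
  apply: filter_forall => i; apply: filter_forall => j.
  by have /cvg_ballP := ul i j; apply.
by apply: filterS => k uk; split.
Qed.

Lemma expmx_cvg M C : (forall p i j, `|exp_coef M p i j| <= C * 2^-1 ^+ p) ->
  forall i j, series (fun p => exp_coef M p i j) @ \oo --> expmx M i j.
Proof.
move=> MC.
have C0 : 0 <= C \/ n = 0%N.
  have [n0|n_gt0] := posnP n; [by right|left].
  have := MC 0%N (Ordinal n_gt0) (Ordinal n_gt0).
  by rewrite [2^-1 ^+ _]expr0 mulr1; apply: le_trans.
have cvgM i j : cvgn (series (fun p => exp_coef M p i j)).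
  case: C0 => [C0|n0]; last first.
    by exfalso; have := leq_ltn_trans (leq0n i) (ltn_ord i); rewrite n0.
  apply: (@normal_series_cvg _ _ (fun p => C * 2^-1 ^+ p) (2 * C)) => // N; exact: sum_half_le.
pose L : 'M[R]_n := \matrix_(i, j) limn (series (fun p => exp_coef M p i j)).
have ML : series (fun k : nat => (k`!%:R)^-1 *: M ^+ k) @ \oo --> L.
  apply: cvg_matrix => i j; rewrite mxE /series /=.
  by under eq_fun do rewrite summxE; exact: cvgM.
move=> i j; rewrite /expmx (cvg_lim _ ML) //; first by rewrite mxE; exact: cvgM.
Qed.

Lemma exp_coef_scale t A p : exp_coef (t *: A) p = t ^+ p *: exp_coef A p.
Proof.
rewrite /exp_coef scalerA mulrC -scalerA; congr (_ *: _).
elim: p => [|p IH]; first by rewrite !expr0 scale1r.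
by rewrite exprS IH (exprS A p) -[LHS]scalemxAl -scalemxAr scalerA -exprS.
Qed.

Lemma exp_coef_tr A p : exp_coef A^T p = (exp_coef A p)^T.
Proof.
rewrite /exp_coef linearZ /=; congr (_ *: _).
elim: p => [|p IH]; first by rewrite !expr0 trmx1.
by rewrite exprS exprSr trmx_mul IH.
Qed.

Lemma gramian_coef_sym A b m : (gramian_coef A b m)^T = gramian_coef A b m.
Proof.
rewrite /gramian_coef raddf_sum /= big_nat_rev /= add0n.
rewrite big_nat_cond [RHS]big_nat_cond; apply: eq_bigr => p /andP[/andP[_ pm] _].
by rewrite trmx_mul trmxK subSS subKn.
Qed.

Lemma gramian_coefE A b m i j : gramian_coef A b m i j =
  \sum_(0 <= p < m.+1) flow_coef A b p i 0 * flow_coef A b (m - p)%N j 0.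
Proof.
by rewrite summxE; apply: eq_bigr => p _; rewrite mxE big_ord1 [_^T _ _]mxE.
Qed.

Lemma geometric_convolution_le C rho m : 0 <= rho ->
  \sum_(0 <= p < m.+1) (C * rho ^+ p) * (C * rho ^+ (m - p)) <= C ^+ 2 * (2 * rho) ^+ m.
Proof.
move=> rho0; rewrite (eq_big_nat _ _ (F2 := fun=> C ^+ 2 * rho ^+ m)) => [|p /andP[_ pm]].
  rewrite sumr_const_nat subn0 -[X in X <= _]mulr_natr -mulrA.
  apply: ler_wpM2l; first exact: sqr_ge0.
  rewrite exprMn mulrC; apply: ler_wpM2r; first exact: exprn_ge0.
  by rewrite -natrX ler_nat; exact: ltn_expl.
by rewrite mulrACA -expr2 -exprD subnKC.
Qed.

Section Convergence.
Variables (A : 'M[R]_n) (b : 'cV[R]_n) (rho C : R).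
Hypothesis rho0 : 0 <= rho.
Hypothesis expC : forall p i j, `|exp_coef A p i j| <= rho ^+ p.
Hypothesis flowC : forall p i, `|flow_coef A b p i 0| <= C * rho ^+ p.

Lemma gramian_coef_bound m i j : `|gramian_coef A b m i j| <= C ^+ 2 * (2 * rho) ^+ m.
Proof.
rewrite gramian_coefE; apply: le_trans (geometric_convolution_le C m rho0).
apply: (le_trans (ler_norm_sum _ _ _)); apply: ler_sum => p _.
by rewrite normrM; apply: ler_pM.
Qed.

Lemma gramian_term_bound T m i j : `|T| * rho <= 8^-1 ->
  `|gramian_coef A b m i j * T ^+ m| <= C ^+ 2 * 2^-1 ^+ m.
Proof.
move=> Tr; rewrite normrM normrX.
apply: (@le_trans _ _ (C ^+ 2 * (2 * rho) ^+ m * `|T| ^+ m)).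
  by apply: ler_wpM2r; [exact: exprn_ge0|exact: gramian_coef_bound].
rewrite -mulrA -exprMn; apply: ler_wpM2l; first exact: sqr_ge0.
have Tr0 : 0 <= `|T| * rho by rewrite mulr_ge0.
rewrite lerXn2r ?nnegrE //; first by rewrite mulr_ge0 // mulr_ge0.
have -> : 2 * rho * `|T| = 2 * (`|T| * rho) by ring.
lra.
Qed.

Lemma scaled_gramian_cvg T i j : `|T| * rho <= 8^-1 ->
  series (fun m => gramian_coef A b m i j * (T ^+ m / m.+1%:R)) @ \oo -->
  scaled_gramian T A b i j.
Proof.
move=> Tr; rewrite mxE; apply: (normal_series_cvg _ (fun N => sum_half_le N (sqr_ge0 C))) => m.
apply: le_trans (gramian_term_bound m i j Tr).
rewrite mulrA normrM ler_piMr // ger0_norm ?invr_ge0 // invf_le1 ?ltr0n //.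
by rewrite (ler_nat _ 1).
Qed.

Lemma exp_coef_scale_bound t p i j : `|t| * rho <= 8^-1 ->
  `|exp_coef (t *: A) p i j| <= 1 * 2^-1 ^+ p.
Proof.
move=> tr; have tr0 : 0 <= `|t| * rho by rewrite mulr_ge0.
rewrite exp_coef_scale mxE normrM normrX mul1r.
apply: (@le_trans _ _ (`|t| ^+ p * rho ^+ p)).
  by apply: ler_wpM2l; [exact: exprn_ge0|exact: expC].
by rewrite -exprMn lerXn2r ?nnegrE //; lra.
Qed.

Lemma flow_cvg t i : `|t| * rho <= 8^-1 ->
  series (fun p => t ^+ p * flow_coef A b p i 0) @ \oo --> (expmx (t *: A) *m b) i 0.
Proof.
move=> tr; have bound p k l := exp_coef_scale_bound p k l tr.
rewrite mxE; have := @cvg_sum_seq R _ (index_enum 'I_n) xpredT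
  (fun j N => series (fun p => exp_coef (t *: A) p i j) N * b j 0)
  (fun j => expmx (t *: A) i j * b j 0).
rewrite (_ : (fun N => _) = series (fun p => t ^+ p * flow_coef A b p i 0)).
  by apply=> j _; apply: cvgMl; exact: expmx_cvg.
apply/funext => N; rewrite /series /=.
under eq_bigr do rewrite mulr_suml.
rewrite exchange_big /=; apply: eq_bigr => p _.
by rewrite mxE mulr_sumr; apply: eq_bigr => j _; rewrite exp_coef_scale mxE mulrA.
Qed.

Lemma expmx_tr t : `|t| * rho <= 8^-1 -> expmx (t *: A^T) = (expmx (t *: A))^T.
Proof.
move=> tr; have bound p k l := exp_coef_scale_bound p k l tr.
have trE p k l : exp_coef (t *: A^T) p k l = exp_coef (t *: A) p l k.
  by rewrite -linearZ exp_coef_tr mxE.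
apply/matrixP => i j; rewrite [RHS]mxE.
have cvgT := @expmx_cvg (t *: A^T) 1.
rewrite -(cvg_lim _ (cvgT _ i j)) //; last by move=> p k l; rewrite trE.
by under eq_fun do rewrite trE; apply: cvg_lim => //; exact: expmx_cvg.
Qed.

(** The integrand is the product of two exponential series, whose Cauchy
    product is integrated term by term. *)
Lemma gramian_scaled T : 0 < T -> T * rho <= 8^-1 ->
  gramian T A b = T *: scaled_gramian T A b.
Proof.
move=> T0 Tr; apply/matrixP => i j; rewrite [RHS]mxE.
have Tabs : `|T| = T by rewrite gtr0_norm.
have tr t : 0 <= t <= T -> `|t| * rho <= 8^-1.
  by case/andP=> t0 tT; rewrite ger0_norm //; apply: le_trans Tr; exact: ler_wpM2r.
have L : series (fun m => gramian_coef A b m i j * (T ^+ m.+1 / m.+1%:R)) @ \oo -->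
    gramian T A b i j.
  rewrite mxE; apply: (@integral_power_series _ _ _ _ (C ^+ 2)) => // [m t /tr|t /tr tr'].
    exact: gramian_term_bound.
  have -> : (expmx (t *: A) *m b *m b^T *m expmx (t *: A^T)) i j =
      (expmx (t *: A) *m b) i 0 * (expmx (t *: A) *m b) j 0.
    rewrite expmx_tr // -mulmxA -trmx_mul mxE big_ord1.
    by congr (_ * _); rewrite mxE.
  rewrite (_ : (fun m => _) = (fun m => \sum_(0 <= p < m.+1)
      (t ^+ p * flow_coef A b p i 0) * (t ^+ (m - p) * flow_coef A b (m - p) j 0))).
    have tr0 : 0 <= `|t| * rho <= 8^-1 by rewrite mulr_ge0.
    have bound p k : `|t ^+ p * flow_coef A b p k 0| <= C * (`|t| * rho) ^+ p.
      rewrite normrM normrX exprMn mulrCA; apply: ler_wpM2l; first exact: exprn_ge0.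
      exact: flowC.
    apply: (cauchy_product_geometric tr0 (bound ^~ i) (bound ^~ j)); exact: flow_cvg.
  apply/funext => m; rewrite gramian_coefE mulr_suml big_nat_cond [RHS]big_nat_cond.
  apply: eq_bigr => p /andP[/andP[_ pm] _].
  by rewrite mulrACA -exprD subnKC // mulrC.
have TT : 0 <= T <= T by rewrite lexx ltW.
have L' : (fun N => T * series (fun m => gramian_coef A b m i j *
    (T ^+ m / m.+1%:R)) N) @ \oo --> T * scaled_gramian T A b i j.
  by apply: cvgMr; exact: scaled_gramian_cvg (tr T TT).
rewrite -(cvg_lim _ L) //; apply: cvg_lim => //.
rewrite [X in X @ _](_ : _ = fun N => T * series (fun m => gramian_coef A b m i j *
  (T ^+ m / m.+1%:R)) N) //.
apply/funext => N; rewrite /series /= mulr_sumr; apply: eq_bigr => m _.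
by rewrite exprS; ring.
Qed.

Lemma scaled_gramian_sym T : (scaled_gramian T A b)^T = scaled_gramian T A b.
Proof.
apply/matrixP => i j; rewrite !mxE; congr (limn (series _)); apply/funext => m.
by rewrite -{1}gramian_coef_sym mxE.
Qed.

End Convergence.
End GramianSeries.

(** * The graded Gramian *)

Section GradedGramian.
Variables (R : realType) (n : nat).
Notation X := (R * ('M[R]_n * 'cV[R]_n))%type.
Notation c3 := (@coord3 R n).
Notation q y k := (krylov_basis y.2.1 y.2.2 k).
Notation power_series := (power_series c3).
Notation ctrl y := (controllable y.2.1 y.2.2).
Notation Gam y := (scaled_gramian y.1 y.2.1 y.2.2).

(** Geometric bounds in the norm of power series in the pair, rather than for a
    fixed pair, are what makes the Gramian jointly analytic. *)
Lemma flow_coef_ps (x0 : X) : exists r rho C, [/\ 0 < r, 0 <= rho,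
  forall p i j, power_series x0 r (rho ^+ p) (fun y => exp_coef y.2.1 p i j) &
  forall p i, power_series x0 r (C * rho ^+ p) (fun y => flow_coef y.2.1 y.2.2 p i 0)].
Proof.
have [r [a [r0 a0 psc]]] := analytic_at_common (@analytic_at_coord _ _ _ c3 x0).
pose rho := n%:R * a; have rho0 : 0 <= rho by rewrite mulr_ge0.
have ps_exp_coef p i j : power_series x0 r (rho ^+ p) (fun y => exp_coef y.2.1 p i j).
  elim: p i j => [|p IH] i j.
    rewrite (_ : (fun y => _) = (fun=> (1%:M : 'M[R]_n) i j)); last first.
      by apply/funext => y; rewrite /exp_coef fact0 invr1 scale1r.
    apply: (ps_weaken _ (ps_const _ _ _ _)).
    by rewrite expr0 !mxE; case: (i == j); rewrite ?normr1 ?normr0.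
  have E (y : 'M[R]_n) : exp_coef y p.+1 i j = p.+1%:R^-1 * \sum_(k < n) y i k * exp_coef y p k j.
    rewrite /exp_coef exprS -[y * _]/(y *m _) 2!mxE factS natrM invfM -mulrA.
    congr (_ * _); rewrite mulr_sumr; apply: eq_bigr => k _.
    by rewrite [in RHS]mxE mulrCA.
  under eq_fun do rewrite E.
  apply: (ps_weaken _ (ps_scale _ (ps_sum _ (ltW r0)
    (fun k _ => ps_mul r0 (psc (inr (inl (i, k)))) (IH k j))))).
  rewrite sumr_const card_ord -[a * _ *+ n]mulr_natl exprS /rho -mulrA.
  apply: ler_piMl; first by rewrite mulr_ge0 // mulr_ge0 // exprn_ge0.
  by rewrite ger0_norm ?invr_ge0 // invf_le1 ?ltr0n // (ler_nat _ 1).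
exists r, rho, (n%:R * a); split=> // p i.
rewrite /flow_coef; under eq_fun do rewrite mxE.
apply: (ps_weaken _ (ps_sum _ (ltW r0) (fun k _ =>
    ps_mul r0 (ps_exp_coef p i k) (psc (inr (inr k)))))).
by rewrite sumr_const card_ord -[_ * a *+ n]mulr_natl mulrA mulrAC.
Qed.

Lemma dotv_mulmxE (u v : 'cV[R]_n) (M : 'M[R]_n) :
  dotv u (M *m v) = \sum_k \sum_l u k 0 * (M k l * v l 0).
Proof. by apply: eq_bigr => k _; rewrite mxE mulr_sumr. Qed.

Definition graded_coef (y : X) i j m : R :=
  dotv (q y i.+1) (gramian_coef y.2.1 y.2.2 m *m q y j.+1).

(** The first [i + j] coefficients of the power series of [<q_i, G q_j>] are zero,
    where [G] is the Gramian divided by the time and the indices start at zero: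
    [A ^ p b] is orthogonal to [q_i] for [p < i]. This is the quotient of that
    series by [T ^ (i + j)]. *)
Definition graded_gramian (i j : nat) (y : X) : R :=
  limn (series (fun m => graded_coef y i j (m + (i + j)) * (y.1 ^+ m / (m + (i + j)).+1%:R))).

Variable x0 : X.
Hypothesis x00 : x0.1 = 0.
Hypothesis x0c : ctrl x0.

Lemma graded_coef_ps : exists r rho D, [/\ 0 < r, 0 <= rho, 0 <= D,
  forall (i j : 'I_n) m, power_series x0 r (D * rho ^+ m) (fun y => graded_coef y i j m) &
  forall y, polydisc c3 x0 r y -> [/\ ctrl y,
    forall T, 0 < T -> T * rho <= 8^-1 ->
      gramian T y.2.1 y.2.2 = T *: scaled_gramian T y.2.1 y.2.2 &
    forall T i j, `|T| * rho <= 8^-1 ->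
      series (fun m => gramian_coef y.2.1 y.2.2 m i j * (T ^+ m / m.+1%:R)) @ \oo
      --> scaled_gramian T y.2.1 y.2.2 i j]].
Proof.
have [r1 [rho [C [r10 rho0 pse psf]]]] := flow_coef_ps x0.
have anq (ik : 'I_n * 'I_n) : analytic_at c3 x0 (fun y => q y ik.1.+1 ik.2 0).
  by apply: krylov_basis_analytic => //; exact: ltn_ord.
have [r2 [Q [r20 Q0 psq]]] := analytic_at_common anq.
have [r3 r30 r3c] := controllable_near x0c.
pose r := Num.min (Num.min r1 r2) r3.
have r12 : 0 < Num.min r1 r2 by rewrite lt_min r10.
have r0 : 0 < r by rewrite lt_min r12.
have rr1 : 0 <= r <= r1.
  by rewrite ltW //= !ge_min lexx.
have rr2 : 0 <= r <= r2.
  by rewrite ltW //= !ge_min lexx orbT.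
have rr3 : r <= r3 by rewrite ge_min lexx orbT.
exists r, (2 * rho), (\sum_(k < n) Q * \sum_(l < n) C ^+ 2 * Q).
have rho2 : 0 <= 2 * rho by rewrite mulr_ge0.
split=> //.
- apply: sumr_ge0 => k _; apply: mulr_ge0 => //; apply: sumr_ge0 => l _.
  by rewrite mulr_ge0 // sqr_ge0.
- move=> i j m; rewrite /graded_coef /dotv mulr_suml.
  apply: ps_sum => [|k _]; first exact: ltW.
  rewrite -mulrA; apply: ps_mul => //; first exact: ps_restrict rr2 (psq (i, k)).
  rewrite mulr_suml; under [X in power_series _ _ _ X]eq_fun do rewrite mxE.
  apply: ps_sum => [|l _]; first exact: ltW.
  rewrite mulrAC; apply: ps_mul => //; last exact: ps_restrict rr2 (psq (j, l)).
  under eq_fun do rewrite gramian_coefE.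
  apply: ps_weaken (geometric_convolution_le C m rho0) _.
  apply: ps_sum => [|p _]; first exact: ltW.
  by apply: ps_mul => //; exact: ps_restrict rr1 (psf _ _).
- move=> y yr; have yr1 : polydisc c3 x0 r1 y.
    by apply: polydisc_sub yr; case/andP: rr1.
  have be p i j : `|exp_coef y.2.1 p i j| <= rho ^+ p by exact: ps_bound (pse p i j) yr1.
  have bf p i : `|flow_coef y.2.1 y.2.2 p i 0| <= C * rho ^+ p.
    exact: ps_bound (psf p i) yr1.
  have half T : 0 <= T -> T * (2 * rho) <= 8^-1 -> T * rho <= 8^-1.
    move=> T0; have : 0 <= T * rho by rewrite mulr_ge0.
    have -> : T * (2 * rho) = 2 * (T * rho) by ring.
    lra.
  split.
  + exact: r3c (polydisc_sub rr3 yr).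
  + by move=> T T0 /(half _ (ltW T0)); exact: gramian_scaled T0.
  + by move=> T i j /(half _ (normr_ge0 T)); exact: scaled_gramian_cvg.
Qed.

Lemma convolution_vanish (a b : nat -> R) i j m : (m < i + j)%N ->
  (forall p, (p < i)%N -> a p = 0) -> (forall p, (p < j)%N -> b p = 0) ->
  \sum_(0 <= p < m.+1) a p * b (m - p)%N = 0.
Proof.
move=> mij a0 b0; rewrite big_nat_cond big1 // => p /andP[/andP[_ pm] _].
case: (ltnP p i) => pi; first by rewrite a0 // mul0r.
by rewrite b0 ?mulr0 //; lia.
Qed.

Lemma convolution_shift (a b : nat -> R) i j d :
  (forall p, (p < i)%N -> a p = 0) -> (forall p, (p < j)%N -> b p = 0) ->
  \sum_(0 <= p < (d + (i + j)).+1) a p * b (d + (i + j) - p)%N =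
  \sum_(0 <= p < d.+1) a (i + p)%N * b (j + (d - p))%N.
Proof.
move=> a0 b0.
have split3 : ((d + (i + j)).+1 = i + (d.+1 + j))%N by lia.
rewrite split3 (@big_cat_nat _ _ _ i) //=; last by lia.
rewrite big_nat_cond big1 ?add0r; last first.
  by move=> p /andP[/andP[_ pi] _]; rewrite a0 // mul0r.
rewrite -{1}[i]add0n big_addn (_ : i + (d.+1 + j) - i = d.+1 + j)%N; last by lia.
rewrite (@big_cat_nat _ _ _ d.+1) //=; last by lia.
rewrite [X in _ + X]big_nat_cond [X in _ + X]big1 ?addr0; last first.
  by move=> p /andP[/andP[pd pj] _]; rewrite b0 ?mulr0 //; lia.
rewrite big_nat_cond [RHS]big_nat_cond; apply: eq_bigr => p /andP[/andP[_ pd] _].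
by rewrite addnC; congr (_ * b _); lia.
Qed.

Definition flow_coord (y : X) i p : R := dotv (q y i.+1) (flow_coef y.2.1 y.2.2 p).

Lemma graded_coefE y i j m : graded_coef y i j m =
  \sum_(0 <= p < m.+1) flow_coord y i p * flow_coord y j (m - p).
Proof.
rewrite /graded_coef mulmx_suml dotv_sumr; apply: eq_bigr => p _.
by rewrite rank1_mul dotvZr mulrC [dotv _ (q y j.+1)]dotvC.
Qed.

Lemma flow_coordE y i p :
  flow_coord y i p = dotv (q y i.+1) (y.2.1 ^+ p *m y.2.2) / p`!%:R.
Proof. by rewrite /flow_coord /flow_coef /exp_coef -scalemxAl dotvZr mulrC. Qed.

Lemma flow_coord0 y i p : ctrl y -> (i < n)%N -> (p < i)%N ->
  flow_coord y i p = 0.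
Proof.
by move=> cy iln pi; rewrite flow_coordE krylov_basis_perp_pow ?mul0r.
Qed.

Lemma graded_coef_vanish y i j m : ctrl y -> (i < n)%N -> (j < n)%N ->
  (m < i + j)%N -> graded_coef y i j m = 0.
Proof.
move=> cy iln jln mij; rewrite graded_coefE.
by apply: (convolution_vanish mij) => p; exact: flow_coord0.
Qed.

Lemma series_drop (u : nat -> R) k (l : R) : (forall m, (m < k)%N -> u m = 0) ->
  series u @ \oo --> l -> series (fun m => u (m + k)%N) @ \oo --> l.
Proof.
move=> u0 ul; rewrite (_ : series _ = fun N => series u (N + k)%N).
  by rewrite cvg_shiftn.
apply/funext => N; rewrite /series /=.
rewrite [RHS](@big_cat_nat _ _ _ k) ?leq_addl //= [X in _ = X + _]big_nat_cond.
rewrite [X in _ = X + _]big1 ?add0r; last first.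
  by move=> m /andP[/andP[_ mk] _]; exact: u0.
by rewrite -{2}[k]add0n big_addn addnK.
Qed.

Lemma graded_gramian_facts : exists r rho D,
  [/\ 0 < r, 0 <= rho, 0 <= D & r * rho <= 8^-1] /\
  [/\ forall i j : 'I_n, power_series x0 r (2 * (D * rho ^+ (i + j))) (graded_gramian i j),
      forall (i j : 'I_n) y m, polydisc c3 x0 r y -> `|graded_coef y i j m| <= D * rho ^+ m,
      forall (i j : 'I_n) y, polydisc c3 x0 r y ->
        series (fun m => graded_coef y i j (m + (i + j)) * (y.1 ^+ m / (m + (i + j)).+1%:R))
        @ \oo --> graded_gramian i j y &
      forall y, polydisc c3 x0 r y -> [/\ ctrl y,
        (0 < y.1 -> gramian y.1 y.2.1 y.2.2 = y.1 *: Gam y) &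
        forall i j : 'I_n, dotv (q y i.+1) (Gam y *m q y j.+1) =
          y.1 ^+ (i + j) * graded_gramian i j y]].
Proof.
have [r1 [rho [D [r10 rho0 D0 psg psy]]]] := graded_coef_ps.
pose s := 8^-1 / (rho + 1); have rho1 : 0 < rho + 1 by rewrite ltr_wpDl.
have s0 : 0 < s by rewrite divr_gt0.
pose r := Num.min r1 s; have r0 : 0 < r by rewrite lt_min r10.
have rr1 : 0 <= r <= r1 by rewrite ltW //= ge_min lexx.
have rrho : r * rho <= 8^-1.
  apply: (@le_trans _ _ (s * (rho + 1))); last by rewrite divfK // gt_eqF.
  by apply: ler_pM => //; [exact: ltW|rewrite ge_min lexx orbT|rewrite lerDl].
exists r, rho, D; split=> //.
have rrho0 : 0 <= r * rho by rewrite mulr_ge0 // ltW.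
have DD m : 0 <= D * rho ^+ m by rewrite mulr_ge0 // exprn_ge0.
have inv_le1 k : `|(k.+1%:R : R)^-1| <= 1.
  by rewrite ger0_norm ?invr_ge0 // invf_le1 ?ltr0n // (ler_nat _ 1).
have psT m : power_series x0 r (r ^+ m) (fun y => y.1 ^+ m).
  apply: ps_exp => //; apply: ps_ext (ps_coord c3 x0 (inl tt) (ltW r0)) => y _.
  by rewrite /= x00 subr0.
have psm (i j : 'I_n) m : power_series x0 r ((D * rho ^+ (i + j)) * 2^-1 ^+ m) (fun y =>
    graded_coef y i j (m + (i + j)) * (y.1 ^+ m / (m + (i + j)).+1%:R)).
  apply: (@ps_weaken _ _ _ _ _ _ (`|((m + (i + j)).+1%:R : R)^-1| *
    ((D * rho ^+ (m + (i + j))) * r ^+ m))).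
    have X0 : 0 <= D * rho ^+ (m + (i + j)) * r ^+ m.
      by rewrite mulr_ge0 ?mulr_ge0 ?exprn_ge0 // ltW.
    apply: (@le_trans _ _ (D * rho ^+ (m + (i + j)) * r ^+ m)).
      exact: ler_piMl.
    rewrite addnC exprD mulrA -(mulrA (D * _)) -exprMn; apply: ler_wpM2l => //.
    by rewrite lerXn2r ?nnegrE // mulrC //; lra.
  apply: ps_ext (ps_scale _ (ps_mul r0 (ps_restrict rr1 (psg i j (m + (i + j))%N)) (psT m))).
  by move=> y _; rewrite mulrC mulrA.
have gcvg (i j : 'I_n) y : polydisc c3 x0 r y ->
    series (fun m => graded_coef y i j (m + (i + j)) * (y.1 ^+ m / (m + (i + j)).+1%:R)) @ \oo
    --> graded_gramian i j y.
  move=> yr; apply: normal_series_cvg (fun N => sum_half_le N (DD (i + j)%N)) => m.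
  exact: ps_bound (psm i j m) yr.
split=> //.
- by move=> i j; apply: ps_normal_sum r0 (psm i j) _ (gcvg i j) => N; exact: sum_half_le.
- by move=> i j y m yr; apply: ps_bound (ps_restrict rr1 (psg i j m)) yr.
- move=> y yr; have [|cy gT gc] := psy y.
    by apply: polydisc_sub yr; case/andP: rr1.
  have yT : `|y.1| * rho <= 8^-1.
    apply: le_trans rrho; apply: ler_wpM2r => //; apply: ltW.
    by have := yr (inl tt); rewrite /= x00 subr0.
  split=> // [T0|i j]; first by apply: gT => //; rewrite -(gtr0_norm T0).
  have L : series (fun m => graded_coef y i j m * (y.1 ^+ m / m.+1%:R)) @ \oo -->
      dotv (q y i.+1) (Gam y *m q y j.+1).
    rewrite dotv_mulmxE; rewrite (_ : series _ = fun N => \sum_k \sum_l q y i.+1 k 0 * (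
       series (fun m => gramian_coef y.2.1 y.2.2 m k l * (y.1 ^+ m / m.+1%:R)) N * q y j.+1 l 0)).
      apply: cvg_sum_seq => k _; apply: cvg_sum_seq => l _.
      by apply: cvgMr; apply: cvgMl; exact: gc.
    apply/funext => N; rewrite /series /=.
    transitivity (\sum_(0 <= m < N) \sum_k \sum_l q y i.+1 k 0 *
      (gramian_coef y.2.1 y.2.2 m k l * (y.1 ^+ m / m.+1%:R) * q y j.+1 l 0)).
      apply: eq_bigr => m _; rewrite /graded_coef dotv_mulmxE mulr_suml.
      apply: eq_bigr => k _; rewrite mulr_suml; apply: eq_bigr => l _; ring.
    rewrite exchange_big; apply: eq_bigr => k _; rewrite exchange_big.
    by apply: eq_bigr => l _; rewrite mulr_suml mulr_sumr.
  have := series_drop _ L (k := (i + j)%N).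
  have L' : (fun N => y.1 ^+ (i + j) * series (fun m => graded_coef y i j (m + (i + j)) *
      (y.1 ^+ m / (m + (i + j)).+1%:R)) N) @ \oo --> y.1 ^+ (i + j) * graded_gramian i j y.
    by apply: cvgMr; exact: gcvg.
  move=> L2; rewrite -(cvg_lim _ (L2 _)) //; last first.
    by move=> m mij; rewrite graded_coef_vanish ?mul0r.
  apply: cvg_lim => //; rewrite [X in X @ _](_ : _ = fun N => y.1 ^+ (i + j) *
    series (fun m => graded_coef y i j (m + (i + j)) *
      (y.1 ^+ m / (m + (i + j)).+1%:R)) N) //.
  apply/funext => N; rewrite /series /= mulr_sumr; apply: eq_bigr => m _.
  by rewrite exprD; ring.
Qed.

End GradedGramian.

(** * The limit problem *)

Section LocalPair.
Variables (R : realType) (n : nat).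
Notation X := (R * ('M[R]_n * 'cV[R]_n))%type.
Notation c3 := (@coord3 R n).
Notation q y k := (krylov_basis y.2.1 y.2.2 k).
Notation near0 x0 := (polydisc_nbhs c3 x0).
Notation ctrl y := (controllable y.2.1 y.2.2).
Implicit Types (x y : X).

Definition at_time0 y : X := (0, y.2).

Lemma near_at_time0 x0 (P : set X) : x0.1 = 0 -> (\forall y \near near0 x0, P y) ->
  \forall y \near near0 x0, P (at_time0 y).
Proof.
move=> x00 [r r0 rP]; exists r => // y yr; apply: rP => -[[]|i] /=.
  by rewrite x00 subr0 normr0.
exact: (yr (inr i)).
Qed.

(** The first two coordinates of the flow along the basis vector of index [i + 1]
    which are not forced to vanish. *)
Definition lead y i : R := flow_coord y i i.
Definition sublead y i : R := flow_coord y i i.+1.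

Lemma leadE y i : lead y i = krylov_d y.2.1 y.2.2 i.+1 / i`!%:R.
Proof. exact: flow_coordE. Qed.

Lemma lead_gt0 y i : ctrl y -> (i < n)%N -> 0 < lead y i.
Proof.
move=> cy iln; rewrite leadE divr_gt0 ?ltr0n ?fact_gt0 //.
exact: krylov_d_gt0.
Qed.

Section AtPoint.
Variable x0 : X.
Hypothesis x00 : x0.1 = 0.
Hypothesis x0c : ctrl x0.

Lemma lead_analytic (i : nat) : (i < n)%N -> analytic_at c3 x0 (fun y => lead y i).
Proof.
move=> iln; under eq_fun do rewrite leadE.
apply: analytic_at_mul; last exact: analytic_at_const.
apply: analytic_at_dotv; last exact: krylov_pow_analytic.
exact: krylov_basis_analytic.
Qed.

Lemma graded_gramian_analytic (i j : 'I_n) : analytic_at c3 x0 (graded_gramian i j).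
Proof.
have [r [rho [D [[r0 _ _ _] [psH _ _ _]]]]] := graded_gramian_facts x00 x0c.
by exists r, (2 * (D * rho ^+ (i + j))).
Qed.

Definition graded0 y i j := lead y i * lead y j / (i + j).+1%:R.
Definition graded1 y i j :=
  (sublead y i * lead y j + lead y i * sublead y j) / (i + j).+2%:R.

(** The first two terms of the defining series; the other ones are bounded by
    those of a geometric series. *)
Lemma graded_gramian_expansion (i j : 'I_n) : vanishes c3 (inl tt) x0 2 (fun y =>
  graded_gramian i j y - (graded0 y i j + y.1 * graded1 y i j)).
Proof.
have [r [rho [D [[r0 rho0 D0 rrho] [_ /(_ i j) gD /(_ i j) gcvg gc]]]]] :=
  graded_gramian_facts x00 x0c.
pose K := D * rho ^+ (i + j); have K0 : 0 <= K by rewrite mulr_ge0 // exprn_ge0.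
exists (2 * (K * rho ^+ 2)); exists r => // y yr /=.
have [cy _ _] := gc y yr.
have yT : `|y.1| * rho <= 2^-1.
  apply: (@le_trans _ _ (r * rho)); last by lra.
  apply: ler_wpM2r => //; apply: ltW.
  by have := yr (inl tt); rewrite /= x00 subr0.
have yT0 : 0 <= `|y.1| * rho by rewrite mulr_ge0.
pose u m := graded_coef y i j (m + (i + j)) * (y.1 ^+ m / (m + (i + j)).+1%:R).
have ai p : (p < i)%N -> flow_coord y i p = 0 by exact: flow_coord0.
have aj p : (p < j)%N -> flow_coord y j p = 0 by exact: flow_coord0.
have u0 : u 0%N = graded0 y i j.
  rewrite /u graded_coefE (convolution_shift _ ai aj) big_nat1 expr0 mul1r.
  by rewrite subn0 !addn0 add0n /graded0 /lead.
have u1 : u 1%N = y.1 * graded1 y i j.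
  rewrite /u graded_coefE (convolution_shift _ ai aj) big_nat_recr //= big_nat1 expr1.
  by rewrite subnn subn0 !addn0 !addn1 add1n /graded1 /lead /sublead; ring.
have term m : `|u m.+2| <= (K * rho ^+ 2 * `|y.1| ^+ 2) * 2^-1 ^+ m.
  rewrite /u normrM normrM normrX.
  apply: (@le_trans _ _ (D * rho ^+ (m.+2 + (i + j)) * (`|y.1| ^+ m.+2 * 1))).
    apply: ler_pM => //; first exact: gD.
    apply: ler_wpM2l; first exact: exprn_ge0.
    by rewrite ger0_norm ?invr_ge0 // invf_le1 ?ltr0n // (ler_nat _ 1).
  have -> : D * rho ^+ (m.+2 + (i + j)) * (`|y.1| ^+ m.+2 * 1) =
      (K * rho ^+ 2 * `|y.1| ^+ 2) * (`|y.1| * rho) ^+ m.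
    by rewrite /K exprD -addn2 !exprD exprMn; ring.
  apply: ler_wpM2l; first by rewrite !mulr_ge0 ?exprn_ge0.
  by rewrite lerXn2r ?nnegrE.
have L : (fun N => series u N.+2 - (u 0%N + u 1%N)) @ \oo -->
    graded_gramian i j y - (u 0%N + u 1%N).
  apply: cvgB; last exact: cvg_cst.
  have := gcvg y yr; rewrite -(cvg_shiftn 2).
  by under eq_fun do rewrite addn2.
rewrite -u0 -u1; apply: (cvg_norm_le_bound L) => N.
have -> : series u N.+2 - (u 0%N + u 1%N) = \sum_(0 <= m < N) u m.+2.
  by rewrite /series /= big_nat_recl // big_nat_recl //; ring.
apply: (le_trans (ler_norm_sum _ _ _)).
rewrite -mulrA; apply: (@le_trans _ _ (\sum_(0 <= m < N) (K * rho ^+ 2 * `|y.1| ^+ 2) * 2^-1 ^+ m)).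
  by apply: ler_sum => m _; exact: term.
by apply: sum_half_le; rewrite !mulr_ge0 ?exprn_ge0.
Qed.

Lemma graded_gramian_time0 (i j : 'I_n) : \forall y \near near0 x0,
  graded_gramian i j (at_time0 y) = graded0 y i j.
Proof.
have [C] := graded_gramian_expansion i j; move/(near_at_time0 x00).
apply: filterS => y /=; rewrite normr0 expr0n mulr0 normr_le0 mul0r addr0 subr_eq0.
by move/eqP.
Qed.

End AtPoint.

(** The coordinates of the eigenvectors of the limit problem: a scaling turns
    the leading part of the graded Gramian into the Hilbert matrix, and the
    eigenvectors become the orthogonal polynomials on [0, 1]. *)
Definition limit_vec y (k j : nat) : R := lead y k * (legendre R k)`_j / lead y j.

Definition limit_eigval y (k : nat) : R := lead y k ^+ 2 * legendre_norm R k.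

Section LimitProblem.
Variable y : X.
Hypothesis cy : ctrl y.

Lemma lead_neq0 i : (i < n)%N -> lead y i != 0.
Proof. by move=> iln; rewrite gt_eqF // lead_gt0. Qed.

Lemma limit_vec_diag k : (k < n)%N -> limit_vec y k k = 1.
Proof. by move=> kn; rewrite /limit_vec legendre_lead mulr1 mulfV // lead_neq0. Qed.

Lemma limit_vec_gt k j : (k < j)%N -> limit_vec y k j = 0.
Proof. by move=> kj; rewrite /limit_vec legendre_coef_gt // mulr0 mul0r. Qed.

Lemma sum_legendre (m : nat) k (F : nat -> R) : (k < m)%N ->
  \sum_(j < m) (legendre R k)`_j * F j = \sum_(j < k.+1) (legendre R k)`_j * F j.
Proof.
move=> km; rewrite [RHS](big_ord_widen m (fun j => (legendre R k)`_j * F j)) //.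
rewrite [RHS]big_mkcond /=; apply: eq_bigr => j _; case: ltnP => // kj.
by rewrite legendre_coef_gt // mul0r.
Qed.

Lemma limit_vec_moment k p : (k < n)%N ->
  \sum_(j < n) limit_vec y k j * lead y j / (p + j).+1%:R =
  lead y k * \sum_(j < k.+1) (legendre R k)`_j / (p + j).+1%:R.
Proof.
move=> kn; rewrite -(sum_legendre (fun j => (p + j).+1%:R^-1) kn) mulr_sumr.
by apply: eq_bigr => j _; rewrite /limit_vec divfK ?mulrA // lead_neq0.
Qed.

Lemma graded0_vec k i : (k < n)%N -> \sum_(j < n) graded0 y i j * limit_vec y k j =
  lead y i * (lead y k * \sum_(j < k.+1) (legendre R k)`_j / (i + j).+1%:R).
Proof.
move=> kn; rewrite -limit_vec_moment // mulr_sumr.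
by apply: eq_bigr => j _; rewrite /graded0; ring.
Qed.

Lemma graded0_vec_lt k i : (i < k < n)%N -> \sum_(j < n) graded0 y i j * limit_vec y k j = 0.
Proof. by move=> /andP[ik kn]; rewrite graded0_vec // legendre_orthogonal // !mulr0. Qed.

Lemma graded0_vec_diag k : (k < n)%N ->
  \sum_(j < n) graded0 y k j * limit_vec y k j = limit_eigval y k.
Proof. by move=> kn; rewrite graded0_vec // legendre_moment_diag /limit_eigval; ring. Qed.

Lemma graded0_sym i j : graded0 y i j = graded0 y j i.
Proof. by rewrite /graded0 addnC [lead y i * _]mulrC. Qed.

Lemma limit_vec_pairing (k : 'I_n) (v : 'cV[R]_n) :
  \sum_(i < n) limit_vec y k i * (\sum_(j < n) graded0 y i j * ((j <= k)%N%:R * v j 0)) =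
  limit_eigval y k * v k 0.
Proof.
under eq_bigr => i _ do rewrite mulr_sumr.
rewrite exchange_big (bigD1 k) //= [X in _ + X]big1 ?addr0 => [|j jk].
  rewrite -(graded0_vec_diag (ltn_ord k)) mulr_suml; apply: eq_bigr => i _.
  by rewrite leqnn graded0_sym mul1r; ring.
have -> : \sum_(i < n) limit_vec y k i * (graded0 y i j * ((j <= k)%N%:R * v j 0)) =
    (\sum_(i < n) graded0 y j i * limit_vec y k i) * ((j <= k)%N%:R * v j 0).
  by rewrite mulr_suml; apply: eq_bigr => i _; rewrite (graded0_sym j i); ring.
case: (ltngtP j k) => jk'; rewrite ?mul0r ?mulr0 //.
  by rewrite graded0_vec_lt ?jk' ?mul0r //=.
by case/eqP: jk; exact: val_inj.
Qed.

Lemma graded0_vec_next k : (k.+1 < n)%N -> \sum_(j < n) graded0 y k.+1 j * limit_vec y k j =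
  limit_eigval y k * (krylov_beta y.2.1 y.2.2 k.+1 / 2).
Proof.
move=> kn; rewrite graded0_vec ?(ltnW kn) // legendre_moment_next /limit_eigval !leadE.
have := @krylov_beta_d _ _ _ _ cy k.+1; rewrite kn => /(_ isT) ->.
rewrite factS natrM; field.
by rewrite fact_neq0 ?natr1 ?nat1r ?pnatr_eq0.
Qed.

Lemma limit_vec_prev k : (k.+1 < n)%N ->
  limit_vec y k.+1 k = - (krylov_beta y.2.1 y.2.2 k.+1 / 2).
Proof.
move=> kn; rewrite /limit_vec legendre_subleading !leadE.
have d0 : krylov_d y.2.1 y.2.2 k.+1 != 0 by rewrite gt_eqF // krylov_d_gt0 //; lia.
have := @krylov_beta_d _ _ _ _ cy k.+1; rewrite kn => /(_ isT) ->.
rewrite factS natrM; field.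
by rewrite fact_neq0 d0 ?natr1 ?nat1r ?pnatr_eq0.
Qed.

Lemma limit_eigvalE k : limit_eigval y k = kappa R k.+1 * krylov_d y.2.1 y.2.2 k.+1 ^+ 2.
Proof.
by rewrite /limit_eigval leadE kappa_legendre_norm; field; rewrite fact_neq0.
Qed.

Lemma limit_eigval_gt0 k : (k < n)%N -> 0 < limit_eigval y k.
Proof. by move=> kn; rewrite mulr_gt0 ?exprn_gt0 ?lead_gt0 ?legendre_norm_gt0. Qed.

(** By symmetry the first order matrix pairs the limit vector with moments shifted
    by one, of which orthogonality leaves two; they give the difference of two
    consecutive partial sums of the numbers [a_i], times the limit eigenvalue. *)
Lemma graded1_quadratic k : (k < n)%N ->
  \sum_(i < n) limit_vec y k i * \sum_(j < n) graded1 y i j * limit_vec y k j =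
  limit_eigval y k * krylov_a y.2.1 y.2.2 k.+1.
Proof.
move=> kn; pose f i := sublead y i.
pose W p := \sum_(j < n) limit_vec y k j * lead y j / (p + j).+1%:R.
have W_lt p : (p < k)%N -> W p = 0.
  by move=> pk; rewrite /W limit_vec_moment // legendre_orthogonal // mulr0.
transitivity (2 * \sum_(i < n) limit_vec y k i * f i * W i.+1).
  pose S := \sum_(i < n) limit_vec y k i * f i * W i.+1.
  have S1 : S = \sum_(i < n) \sum_(j < n) limit_vec y k i * f i *
        (limit_vec y k j * lead y j / (i + j).+2%:R).
    by apply: eq_bigr => i _; rewrite mulr_sumr.
  have S2 : S = \sum_(i < n) \sum_(j < n) limit_vec y k j * f j *
        (limit_vec y k i * lead y i / (i + j).+2%:R).
    rewrite S1 exchange_big; apply: eq_bigr => j _; apply: eq_bigr => i _.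
    by rewrite addnC.
  have -> : 2 * S = S + S by ring.
  rewrite {1}S1 S2 -big_split; apply: eq_bigr => i _ /=.
  rewrite mulr_sumr -big_split; apply: eq_bigr => j _ /=.
  by rewrite /graded1 /f; ring.
have sumk : \sum_(i < n) limit_vec y k i * f i * W i.+1 =
    \sum_(i < k.+1) limit_vec y k i * f i * W i.+1.
  rewrite [RHS](big_ord_widen n (fun i => limit_vec y k i * f i * W i.+1)) //.
  rewrite [RHS]big_mkcond /=; apply: eq_bigr => j _; case: ltnP => // kj.
  by rewrite limit_vec_gt // !mul0r.
rewrite sumk big_ord_recr /= limit_vec_diag // mul1r.
have -> : W k.+1 = lead y k * (k.+1%:R / 2 * legendre_norm R k).
  by rewrite /W limit_vec_moment // legendre_moment_next.
have fE i : (i < n)%N -> f i = dotv (q y i.+1) (y.2.1 ^+ i.+1 *m y.2.2) / krylov_d y.2.1 y.2.2 i.+1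
    * lead y i / i.+1%:R.
  move=> iln; have d0 : krylov_d y.2.1 y.2.2 i.+1 != 0 by rewrite gt_eqF // krylov_d_gt0.
  rewrite /f /sublead flow_coordE leadE factS natrM; field.
  by rewrite fact_neq0 d0 ?natr1 ?nat1r ?pnatr_eq0.
have := krylov_a_quotient cy (k := k.+1); rewrite ltnS /= => /(_ kn) aE.
rewrite (fE k) // aE /limit_eigval.
have Wk : W k = lead y k * legendre_norm R k.
  by rewrite /W limit_vec_moment // legendre_moment_diag.
clear sumk aE; clearbody W; case: k kn W_lt Wk => [|k] kn W_lt Wk.
  by rewrite big_ord0 /=; field.
rewrite big_ord_recr /= big1 ?add0r => [|i _]; last by rewrite W_lt ?mulr0 //= ltnS.
rewrite Wk (fE k) ?(ltnW kn) // /limit_vec legendre_subleading /=.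
have l0 := lead_neq0 (ltnW kn).
have d0 : krylov_d y.2.1 y.2.2 k.+1 != 0 by rewrite gt_eqF // krylov_d_gt0 //; lia.
field.
by rewrite d0 l0 -(natrD _ 2 k) nat1r !pnatr_eq0.
Qed.

End LimitProblem.
End LocalPair.

(** * The pencil of an eigenpair *)

Section Pencil.
Variables (R : realType) (n : nat) (k : 'I_n).
Notation X := (R * ('M[R]_n * 'cV[R]_n))%type.
Notation c3 := (@coord3 R n).
Notation near0 x0 := (polydisc_nbhs c3 x0).
Notation ctrl y := (controllable y.2.1 y.2.2).
Implicit Types (x y : X) (mu : R).

(** The eigenvector equation of the Gramian for the eigenvalue
    [T ^ (2 * k + 1) * mu] and a vector with coordinates [T ^ |j - k| * w_j]: all
    powers of the time which divide the [i]-th equation are divided out, and only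
    nonnegative exponents remain. *)
Definition pencil y mu : 'M[R]_n := \matrix_(i, j)
  (graded_gramian i j y * y.1 ^+ (2 * (j - k)) -
   (if i == j then y.1 ^+ (2 * (k - i)) * mu else 0)).

Definition pencil_poly y : 'M[{poly R}]_n := \matrix_(i, j)
  ((graded_gramian i j y * y.1 ^+ (2 * (j - k)))%:P -
   (if i == j then y.1 ^+ (2 * (k - i)) *: 'X else 0)).

(** The row [k] is replaced by the condition that the coordinate [k] of a kernel
    vector be one, which determines this vector. *)
Definition bordered_pencil y mu : 'M[R]_n := \matrix_(i, j)
  (if i == k then (j == k)%:R else pencil y mu i j).

Lemma pencil_mul y mu (v : 'cV[R]_n) i : (pencil y mu *m v) i 0 =
  \sum_(j < n) graded_gramian i j y * y.1 ^+ (2 * (j - k)) * v j 0 -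
  y.1 ^+ (2 * (k - i)) * mu * v i 0.
Proof.
rewrite mxE; under eq_bigr => j _ do rewrite mxE mulrBl.
rewrite sumrB [X in _ - X](bigD1 i) //= eqxx [X in _ - (_ + X)]big1 ?addr0 //.
by move=> j /negPf ji; rewrite eq_sym ji mul0r.
Qed.

Lemma bordered_mul y mu p (M : 'M[R]_(n, p)) i l : (bordered_pencil y mu *m M) i l =
  if i == k then M k l else (pencil y mu *m M) i l.
Proof.
rewrite mxE; case: eqVneq => [->|ik]; last first.
  by rewrite mxE; apply: eq_bigr => j _; rewrite [bordered_pencil _ _ _ _]mxE (negPf ik).
rewrite (bigD1 k) //= [bordered_pencil _ _ _ _]mxE !eqxx mul1r big1 ?addr0 //.
by move=> j /negPf jk; rewrite [bordered_pencil _ _ _ _]mxE eqxx jk mul0r.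
Qed.

Lemma pencil_polyE y mu : pencil y mu = map_mx (horner_eval mu) (pencil_poly y).
Proof.
apply/matrixP => i j; rewrite !mxE /horner_eval.
by case: eqP; rewrite !hornerE ?horner0.
Qed.

Lemma pencil_det y mu : \det (pencil y mu) = (\det (pencil_poly y)).[mu].
Proof. by rewrite pencil_polyE det_map_mx. Qed.

Definition at_limit y := [/\ y.1 = 0, ctrl y &
  forall i j : 'I_n, graded_gramian i j y = graded0 y i j].

(** On the columns up to the [k]-th one this matrix holds the orthogonal
    polynomials, so that it makes the limit of the pencil triangular. *)
Definition limit_basis y : 'M[R]_n := \matrix_(j, l)
  (if (l <= k)%N then limit_vec y l j else (j == l)%:R).

Definition limit_diag y (l : 'I_n) : {poly R} :=
  if (l < k)%N then (limit_eigval y l)%:P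
  else if l == k then (limit_eigval y k)%:P - 'X else - 'X.

Lemma det_limit_basis y : ctrl y -> \det (limit_basis y) = 1.
Proof.
move=> cy; rewrite -det_tr det_trig; last first.
  apply/is_trig_mxP => i j ij; rewrite !mxE; case: ifP => _.
    by rewrite limit_vec_gt.
  by case: eqP => // ji; rewrite ji ltnn in ij.
apply: big1 => i _; rewrite !mxE; case: ifP => _; last by rewrite eqxx.
by rewrite limit_vec_diag.
Qed.

Lemma limit_pencil_entry y i l : at_limit y ->
  (pencil_poly y *m map_mx polyC (limit_basis y)) i l =
  if (l <= k)%N then (\sum_(j < n) graded0 y i j * limit_vec y l j)%:P -
      (if (k <= i)%N then limit_vec y l i *: 'X else 0)
  else if i == l then - 'X else 0.
Proof.
move=> [y0 cy yH]; rewrite mxE.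
have exp0 a : y.1 ^+ (2 * a) = (a == 0%N)%:R by rewrite y0 expr0n muln_eq0.
under eq_bigr => j _ do rewrite !mxE yH exp0 mulrBl.
rewrite sumrB [X in _ - X](bigD1 i) //= eqxx [X in _ - (_ + X)]big1 ?addr0; last first.
  by move=> j /negPf ji; rewrite eq_sym ji mul0r.
rewrite exp0 subn_eq0; case: ifP => lk.
  congr (_ - _); last first.
    by case: ifP => _; rewrite ?scale0r ?mul0r // scale1r mulrC mul_polyC.
  rewrite rmorph_sum; apply: eq_bigr => j _ /=; rewrite -polyCM; congr _%:P.
  case: (leqP j k) => jk.
    by move: jk; rewrite -subn_eq0 => ->; rewrite mulr1.
  by rewrite limit_vec_gt ?mulr0 //; exact: leq_ltn_trans lk jk.
rewrite (bigD1 l) //= big1 ?addr0; last first.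
  by move=> j /negPf ->; rewrite mulr0.
rewrite subn_eq0 lk mulr0 mul0r sub0r.
case: eqVneq => [->|_]; last by rewrite polyC0 mulr0 oppr0.
have -> : (k <= l)%N by apply: ltnW; rewrite ltnNge lk.
by rewrite scale1r mulr1.
Qed.

(** Orthogonality of the polynomials to the lower powers. *)
Lemma limit_pencil_lower y (i l : 'I_n) : at_limit y -> (i < l)%N ->
  (pencil_poly y *m map_mx polyC (limit_basis y)) i l = 0.
Proof.
move=> yl il; have [_ cy _] := yl; rewrite limit_pencil_entry //.
case: ifP => lk; last by case: eqP => // ii; rewrite ii ltnn in il.
rewrite graded0_vec_lt ?il //= ifF ?subr0 //.
by apply/negbTE; rewrite -ltnNge; exact: leq_trans il lk.
Qed.

Lemma limit_pencil_diag y l : at_limit y ->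
  (pencil_poly y *m map_mx polyC (limit_basis y)) l l = limit_diag y l.
Proof.
move=> yl; have [_ cy _] := yl; rewrite limit_pencil_entry // eqxx /limit_diag.
case: (ltngtP l k) => lk.
- by rewrite graded0_vec_diag // subr0.
- by case: eqP => // ll; rewrite ll ltnn in lk.
- have -> : l = k by apply: val_inj.
  by rewrite eqxx graded0_vec_diag // limit_vec_diag // scale1r.
Qed.

Lemma limit_pencil_det y : at_limit y -> \det (pencil_poly y) = \prod_l limit_diag y l.
Proof.
move=> yl; have [_ cy _] := yl.
have dU : \det (map_mx polyC (limit_basis y)) = 1.
  by rewrite det_map_mx det_limit_basis.
rewrite -[LHS]mulr1 -[X in _ * X = _]dU -det_mulmx.
rewrite det_trig; first by apply: eq_bigr => l _; exact: limit_pencil_diag.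
by apply/is_trig_mxP => i j; exact: limit_pencil_lower.
Qed.

Lemma limit_diag_neq0 y l : ctrl y -> l != k ->
  (limit_diag y l).[limit_eigval y k] != 0.
Proof.
move=> cy lk; rewrite /limit_diag; case: ifP => _.
  by rewrite hornerC gt_eqF // limit_eigval_gt0.
by rewrite (negPf lk) hornerN hornerX oppr_eq0 gt_eqF // limit_eigval_gt0.
Qed.

Lemma limit_pencil_simple_root y : at_limit y ->
  root (\det (pencil_poly y)) (limit_eigval y k) /\
  (\det (pencil_poly y))^`().[limit_eigval y k] != 0.
Proof.
move=> yl; have [_ cy _] := yl; rewrite limit_pencil_det // (bigD1 k) //=.
have -> : limit_diag y k = (limit_eigval y k)%:P - 'X.
  by rewrite /limit_diag ltnn eqxx.
split; first by rewrite /root !hornerE subrr mul0r.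
rewrite derivM derivB derivC derivX sub0r hornerD !hornerM !hornerE subrr mul0r addr0.
rewrite mulN1r oppr_eq0 horner_prod.
by apply/prodf_neq0 => l lk; exact: limit_diag_neq0.
Qed.

Lemma limit_bordered_det y : at_limit y ->
  \det (bordered_pencil y (limit_eigval y k)) != 0.
Proof.
move=> yl; have [_ cy _] := yl; set mu := limit_eigval y k.
have PU i l : (pencil y mu *m limit_basis y) i l =
    ((pencil_poly y *m map_mx polyC (limit_basis y)) i l).[mu].
  rewrite pencil_polyE; have -> : limit_basis y =
      map_mx (horner_eval mu) (map_mx polyC (limit_basis y)).
    by apply/matrixP => a c; rewrite !mxE /horner_eval hornerC.
  by rewrite -map_mxM mxE /horner_eval; congr (fun_of_matrix (_ *m _) i l).[mu];
     apply/matrixP => a c; rewrite !mxE /horner_eval !hornerC.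
rewrite -[\det _]mulr1 -(det_limit_basis cy) -det_mulmx det_trig; last first.
  apply/is_trig_mxP => i l il; rewrite bordered_mul; case: eqP => [ik|_].
    rewrite mxE ifF; last by apply/negbTE; rewrite -ltnNge -ik.
    by case: eqP => // kl; rewrite ik kl ltnn in il.
  by rewrite PU limit_pencil_lower ?horner0.
apply/prodf_neq0 => i _; rewrite bordered_mul; case: (eqVneq i k) => [ik|ik].
  by rewrite -ik mxE ik leqnn limit_vec_diag ?oner_eq0.
by rewrite PU limit_pencil_diag // limit_diag_neq0.
Qed.

Lemma bordered_solution y mu (w : 'cV[R]_n) : pencil y mu *m w = 0 -> w k 0 = 1 ->
  bordered_pencil y mu *m w = delta_mx k 0.
Proof.
move=> Pw wk; apply/matrixP => i j; rewrite ord1 bordered_mul Pw wk !mxE eqxx andbT.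
by case: eqVneq.
Qed.

(** A singular pencil has a kernel vector, whose coordinate [k] cannot vanish when
    the bordered matrix is regular; it is then a multiple of the solution of the
    bordered system. *)
Lemma bordered_kernel y mu (w : 'cV[R]_n) : \det (pencil y mu) = 0 ->
  \det (bordered_pencil y mu) != 0 -> bordered_pencil y mu *m w = delta_mx k 0 ->
  pencil y mu *m w = 0 /\ w k 0 = 1.
Proof.
move=> dP dB Bw; have Bu : bordered_pencil y mu \in unitmx by rewrite unitmxE unitfE.
have wk : w k 0 = 1.
  by have /matrixP/(_ k 0) := Bw; rewrite bordered_mul !mxE !eqxx.
split=> //.
have /eqP/det0P[v v0 vP] : \det (pencil y mu)^T = 0 by rewrite det_tr.
have {}vP : pencil y mu *m v^T = 0.
  by rewrite -[LHS]trmxK trmx_mul trmxK vP trmx0.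
have Bv : bordered_pencil y mu *m v^T = v^T k 0 *: delta_mx k 0.
  apply/matrixP => i j; rewrite ord1 bordered_mul vP !mxE eqxx andbT.
  by case: eqVneq; rewrite ?mulr1 ?mulr0.
have vw : v^T = v^T k 0 *: w.
  by rewrite -[LHS](mulKmx Bu) Bv -Bw -scalemxAr mulKmx.
have vk : v^T k 0 != 0.
  by apply: contra_neq v0 => vk; rewrite -[v]trmxK vw vk scale0r trmx0.
apply: (scalerI vk).
by rewrite scaler0 scalemxAr -vw.
Qed.

Section LocalEigenpair.
Variable x0 : X.
Hypothesis x00 : x0.1 = 0.
Hypothesis x0c : ctrl x0.

Lemma at_limit_near : \forall y \near near0 x0, at_limit (at_time0 y).
Proof.
have H : \forall y \near near0 x0, forall i j : 'I_n,
    graded_gramian i j (at_time0 y) = graded0 y i j.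
  apply: filter_forall => i; apply: filter_forall => j.
  exact: graded_gramian_time0.
by apply: filterS2 H (controllable_near x0c) => y yH cy; split.
Qed.

Lemma at_limit_center : at_limit x0.
Proof.
have := near_center at_limit_near.
by rewrite /at_time0 -x00 -surjective_pairing.
Qed.

(** The eigenvalue is an analytic simple root of the determinant of the pencil and
    the eigenvector is given by Cramer's rule for the bordered matrix. *)
Lemma local_eigenpair : exists (mu : X -> R) (w : X -> 'cV[R]_n),
  [/\ analytic_at c3 x0 mu, mx_analytic_at c3 x0 w &
      \forall y \near near0 x0, pencil y (mu y) *m w y = 0 /\ w y k 0 = 1].
Proof.
have anT := time_analytic x0.
have anH (i j : 'I_n) := graded_gramian_analytic x00 x0c i j.
have [|||mu [anmu mux0 rmu]] := @analytic_simple_root _ _ _ c3 x0 (fun y => \det (pencil_poly y))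
  (limit_eigval x0 k).
- apply: analytic_poly_at_det => i j; under eq_fun do rewrite mxE.
  apply: analytic_poly_at_add.
    by apply/analytic_poly_at_C/analytic_at_mul => //; exact: analytic_at_exp.
  case: eqP => _; last first.
    by under eq_fun do rewrite oppr0; exact: analytic_poly_at_const.
  under eq_fun do rewrite -mul_polyC -mulrN.
  apply: analytic_poly_at_mul; last exact: analytic_poly_at_const.
  by apply/analytic_poly_at_C/analytic_at_exp.
- exact: (limit_pencil_simple_root at_limit_center).1.
- exact: (limit_pencil_simple_root at_limit_center).2.
have anB : mx_analytic_at c3 x0 (fun y => bordered_pencil y (mu y)).
  move=> i j; under eq_fun do rewrite mxE.
  case: eqP => _; first exact: analytic_at_const.
  under eq_fun do rewrite mxE; apply: analytic_at_sub.
    by apply: analytic_at_mul => //; exact: analytic_at_exp.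
  case: eqP => _; last exact: analytic_at_const.
  by apply: analytic_at_mul => //; exact: analytic_at_exp.
have andB := analytic_at_det anB.
have dB0 : \det (bordered_pencil x0 (mu x0)) != 0.
  by rewrite mux0; exact: limit_bordered_det at_limit_center.
exists mu, (fun y => (\det (bordered_pencil y (mu y)))^-1 *:
  (\adj (bordered_pencil y (mu y)) *m delta_mx k 0)).
split=> //.
  apply: mx_analytic_at_scale; first exact: analytic_at_inv.
  by apply: mx_analytic_at_mul; [exact: mx_analytic_at_adj|exact: mx_analytic_at_const].
apply: filterS2 rmu (analytic_at_neq0 andB dB0) => y ry dBy.
apply: bordered_kernel => //; first by rewrite pencil_det; exact/rootP.
by rewrite -scalemxAr mulmxA mul_mx_adj mul_scalar_mx scalerA mulVf // scale1r.
Qed.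

End LocalEigenpair.

(** At time zero the eigenpair is known, by uniqueness of the solution of the
    bordered system. *)
Lemma limit_eigenpair y mu (w : 'cV[R]_n) : at_limit y -> pencil y mu *m w = 0 ->
  w k 0 = 1 -> mu = limit_eigval y k /\
  (forall i, w i 0 = if (i <= k)%N then limit_vec y k i else
     (\sum_(j < n) graded0 y i j * limit_vec y k j) / limit_eigval y k).
Proof.
move=> yl Pw wk; have [y0 cy yH] := yl.
have exp0 a : y.1 ^+ (2 * a) = (a == 0%N)%:R by rewrite y0 expr0n muln_eq0.
have Pv nu (v : 'cV[R]_n) i : (pencil y nu *m v) i 0 =
    \sum_(j < n) graded0 y i j * ((j <= k)%N%:R * v j 0) - (k <= i)%N%:R * (nu * v i 0).
  rewrite pencil_mul exp0 subn_eq0 -mulrA; congr (_ - _); apply: eq_bigr => j _.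
  by rewrite yH exp0 subn_eq0 mulrA.
have muE : mu = limit_eigval y k.
  (* By orthogonality, pairing with the limit vector leaves the coordinate [k] of
     [w] times the difference of the limit eigenvalue and [mu]. *)
  have : \sum_(i < n) limit_vec y k i * (pencil y mu *m w) i 0 = 0.
    by rewrite Pw; apply: big1 => i _; rewrite mxE mulr0.
  under eq_bigr => i _ do rewrite Pv mulrBr.
  rewrite sumrB limit_vec_pairing // wk mulr1.
  rewrite (bigD1 k) //= big1 ?addr0 => [|i ik]; last first.
    case: (ltngtP k i) => ki; rewrite ?mul0r ?mulr0 //.
      by rewrite limit_vec_gt // mul0r.
    by case/eqP: ik; exact/esym/val_inj.
  rewrite leqnn wk limit_vec_diag // !mul1r mulr1 => /eqP.
  by rewrite subr_eq0 => /eqP.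
split=> // i; rewrite {mu}muE in Pw.
pose v : 'cV[R]_n := \col_i (if (i <= k)%N then limit_vec y k i else
  (\sum_(j < n) graded0 y i j * limit_vec y k j) / limit_eigval y k).
have vk : v k 0 = 1 by rewrite mxE leqnn limit_vec_diag.
have lim0 : limit_eigval y k != 0 by rewrite gt_eqF // limit_eigval_gt0.
have Pv0 : pencil y (limit_eigval y k) *m v = 0.
  apply/matrixP => a c; rewrite ord1 Pv [RHS]mxE.
  have -> : \sum_(j < n) graded0 y a j * ((j <= k)%N%:R * v j 0) =
      \sum_(j < n) graded0 y a j * limit_vec y k j.
    apply: eq_bigr => j _; congr (_ * _); rewrite mxE; case: (leqP j k) => jk.
      by rewrite mul1r.
    by rewrite mul0r limit_vec_gt.
  rewrite mxE; case: (ltngtP a k) => ak.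
  - by rewrite graded0_vec_lt ?ak //= mul0r subrr.
  - by rewrite mul1r mulrC divfK // subrr.
  - have -> : a = k by exact: val_inj.
    by rewrite graded0_vec_diag // limit_vec_diag // mul1r mulr1 subrr.
have := bordered_solution Pv0 vk; rewrite -(bordered_solution Pw wk) => /(congr1
  (mulmx (invmx (bordered_pencil y (limit_eigval y k))))).
rewrite !mulKmx ?unitmxE ?unitfE ?limit_bordered_det // => <-.
by rewrite mxE.
Qed.

End Pencil.

(** * Eigenpairs to first order in the time *)

Section LocalEigenvector.
Variables (R : realType) (n : nat).
Notation X := (R * ('M[R]_n * 'cV[R]_n))%type.
Notation c3 := (@coord3 R n).
Notation near0 x0 := (polydisc_nbhs c3 x0).
Notation q y k := (krylov_basis y.2.1 y.2.2 k).
Notation beta y k := (krylov_beta y.2.1 y.2.2 k).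
Notation ctrl y := (controllable y.2.1 y.2.2).
Notation Gam y := (scaled_gramian y.1 y.2.1 y.2.2).
Implicit Types (x y : X) (mu : R).

Lemma krylov_coord_eq0 y (z : 'cV[R]_n) : ctrl y ->
  (forall i : 'I_n, dotv (q y i.+1) z = 0) -> z = 0.
Proof.
move=> cy; apply: (orthonormal_basis_eq0 (q := fun i => q y i.+1)) => i j.
by rewrite krylov_basis_orthonormal //; exact: ltn_ord.
Qed.

Section Vector.
Variables (k : 'I_n) (w : X -> 'cV[R]_n).

Definition graded_comp y (j : 'I_n) : R := y.1 ^+ ((j - k) + (k - j)) * w y j 0.
Definition eig_dir y : 'cV[R]_n := \sum_(j < n) graded_comp y j *: q y j.+1.
Definition eig_sqnorm y : R := \sum_(j < n) graded_comp y j ^+ 2.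
Definition eig_unit y : 'cV[R]_n := (Num.sqrt (eig_sqnorm y))^-1 *: eig_dir y.

Lemma dotv_eig_dir y (i : 'I_n) : ctrl y ->
  dotv (q y i.+1) (eig_dir y) = graded_comp y i.
Proof.
move=> cy; rewrite dotv_sumr (bigD1 i) //= dotvZr.
have orth (j : 'I_n) : dotv (q y i.+1) (q y j.+1) = (i == j)%:R.
  by rewrite krylov_basis_orthonormal //; exact: ltn_ord.
rewrite orth eqxx mulr1 big1 ?addr0 // => j /negPf ji.
by rewrite dotvZr orth eq_sym ji mulr0.
Qed.

Lemma eig_sqnormE y : ctrl y ->
  dotv (eig_dir y) (eig_dir y) = eig_sqnorm y.
Proof.
move=> cy; rewrite {1}/eig_dir dotv_suml; apply: eq_bigr => j _.
by rewrite dotvZl dotv_eig_dir // expr2.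
Qed.

(** In the orthonormal Krylov basis the eigenvector equation of the Gramian is
    the kernel equation of the pencil, up to powers of the time. *)
Lemma eig_dir_eigen y mu : ctrl y ->
  (forall i j : 'I_n, dotv (q y i.+1) (Gam y *m q y j.+1) =
      y.1 ^+ (i + j) * graded_gramian i j y) ->
  pencil k y mu *m w y = 0 ->
  Gam y *m eig_dir y = (y.1 ^+ (2 * k) * mu) *: eig_dir y.
Proof.
move=> cy gE Pw; apply/eqP; rewrite -subr_eq0; apply/eqP.
apply: (krylov_coord_eq0 cy) => i; rewrite dotvBr dotvZr dotv_eig_dir //.
rewrite mulmx_sumr dotv_sumr.
have E (j : 'I_n) : dotv (q y i.+1) (Gam y *m (graded_comp y j *: q y j.+1)) =
    y.1 ^+ (i + k) * (graded_gramian i j y * y.1 ^+ (2 * (j - k)) * w y j 0).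
  rewrite -scalemxAr dotvZr gE /graded_comp.
  have : y.1 ^+ (j - k + (k - j)) * y.1 ^+ (i + j) = y.1 ^+ (i + k) * y.1 ^+ (2 * (j - k)).
    by rewrite -!exprD; congr (_ ^+ _); lia.
  by move=> E; rewrite mulrACA E; ring.
under eq_bigr do rewrite E.
rewrite -mulr_sumr; have /matrixP/(_ i 0) := Pw; rewrite pencil_mul mxE.
move=> /eqP; rewrite subr_eq0 => /eqP ->; rewrite /graded_comp.
have : y.1 ^+ (i + k) * y.1 ^+ (2 * (k - i)) = y.1 ^+ (2 * k) * y.1 ^+ (i - k + (k - i)).
  by rewrite -!exprD; congr (_ ^+ _); lia.
move=> E2; apply/eqP; rewrite subr_eq0; apply/eqP.
by rewrite !mulrA E2; ring.
Qed.

End Vector.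

Definition eigvec_taylor (k : nat) y : 'cV[R]_n :=
  q y k.+1 + (y.1 / 2) *: (beta y k.+1 *: q y k.+2 - beta y k *: q y k).

Section AtPoint.
Variables (k : 'I_n) (x0 : X).
Hypothesis x00 : x0.1 = 0.
Hypothesis x0c : ctrl x0.
Notation vanishes := (vanishes c3 (inl tt) x0).
Notation analytic := (analytic_at c3 x0).

Let near_c := controllable_near x0c.

Lemma vanishes_time_mul a f : (2 <= a)%N -> analytic f -> vanishes 2 (fun y => y.1 ^+ a * f y).
Proof.
move=> a2 anf; apply: (vanishes_eq _ (vanishes_mull anf (vanishes_le _ a2 (vanishes_coord c3 (inl tt) x0 a)))) => //.
by apply: nearW => y /=; rewrite mulrC.
Qed.

Lemma vanishes_time1_mul f : vanishes 1 f -> vanishes 2 (fun y => y.1 * f y).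
Proof. by move=> vf; apply: (vanishes_mul (vanishes_coord c3 (inl tt) x0 1) vf). Qed.

Lemma vanishes0 m : vanishes m (fun=> 0).
Proof. by exists 0; apply: nearW => y; rewrite normr0 mul0r. Qed.

Lemma vanishes_near0 m f : (\forall y \near near0 x0, f y = 0) -> vanishes m f.
Proof. by move=> f0; apply: (vanishes_eq _ (vanishes0 m)); apply: filterS f0 => y ->. Qed.

Lemma vanishes_at_time0 f : analytic f -> vanishes 1 (fun y => f y - f (at_time0 y)).
Proof.
by move=> anf; apply: (@analytic_at_vanishes1 _ _ _ c3 (inl tt) x0 x00 f (@at_time0 R n) anf) => // y [[]|i].
Qed.

Lemma limit_vec_analytic (j : 'I_n) : analytic (fun y => limit_vec y k j).
Proof.
apply: analytic_at_div; last by rewrite gt_eqF // lead_gt0.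
  apply: analytic_at_mul; last exact: analytic_at_const.
  exact: lead_analytic.
exact: lead_analytic.
Qed.

Lemma limit_eigval_analytic : analytic (fun y => limit_eigval y k).
Proof.
apply: analytic_at_mul; last exact: analytic_at_const.
by apply: analytic_at_exp; exact: lead_analytic.
Qed.

Lemma flow_coord_analytic (i : 'I_n) p : analytic (fun y => flow_coord y i p).
Proof.
under eq_fun do rewrite flow_coordE.
apply: analytic_at_mul; last exact: analytic_at_const.
apply: analytic_at_dotv; last exact: krylov_pow_analytic.
by apply: krylov_basis_analytic => //; exact: ltn_ord.
Qed.

Lemma graded1_analytic (i j : 'I_n) : analytic (fun y => graded1 y i j).
Proof.
apply: analytic_at_mul; last exact: analytic_at_const.
by apply: analytic_at_add; apply: analytic_at_mul; exact: flow_coord_analytic.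
Qed.

Lemma beta_analytic l : analytic (fun y => beta y l).
Proof.
rewrite /krylov_beta; have [ln|_] := boolP (0 < l < n)%N; last exact: analytic_at_const.
apply: analytic_at_dotv; first by apply: krylov_basis_analytic => //; lia.
apply: mx_analytic_at_mul; first exact: pair_matrix_analytic.
by apply: krylov_basis_analytic => //; lia.
Qed.

Variables (mu : X -> R) (w : X -> 'cV[R]_n).
Hypothesis anmu : analytic mu.
Hypothesis anw : mx_analytic_at c3 x0 w.
Hypothesis muw : \forall y \near near0 x0, pencil k y (mu y) *m w y = 0 /\ w y k 0 = 1.

Lemma eigenpair_time0 : \forall y \near near0 x0, mu (at_time0 y) = limit_eigval y k /\
  (forall i, w (at_time0 y) i 0 = if (i <= k)%N then limit_vec y k i else
     (\sum_(j < n) graded0 y i j * limit_vec y k j) / limit_eigval y k).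
Proof.
apply: filterS2 (near_at_time0 x00 muw) (at_limit_near x00 x0c) => y [Pw wk] yl.
exact: (limit_eigenpair yl Pw wk).
Qed.

Lemma eigvec_comp_limit (j : 'I_n) : (j <= k)%N ->
  vanishes 1 (fun y => w y j 0 - limit_vec y k j).
Proof.
move=> jk; apply: (vanishes_eq _ (vanishes_at_time0 (anw j 0))).
by apply: filterS eigenpair_time0 => y [_ /(_ j) ->]; rewrite jk.
Qed.

(** The kernel equation is paired with the limit vector, the left null vector of
    the limit pencil: up to the second order the coordinates of [w] below [k]
    contribute only through their limits, and those above [k] not at all. *)
Lemma eigval_expansion : vanishes 2 (fun y => mu y -
  limit_eigval y k * (1 + krylov_a y.2.1 y.2.2 k.+1 * y.1)).
Proof.
pose G1 y := \sum_(i < n) \sum_(j < n) limit_vec y k i *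
  (graded_gramian i j y * y.1 ^+ (2 * (j - k)) * w y j 0).
pose G2 y := \sum_(i < n) limit_vec y k i * (y.1 ^+ (2 * (k - i)) * mu y * w y i 0).
have G12 : \forall y \near near0 x0, G1 y = G2 y.
  apply: filterS muw => y [Pw _]; apply: eq_bigr => i _; rewrite -mulr_sumr.
  have /matrixP/(_ i 0) := Pw; rewrite pencil_mul mxE => /eqP.
  by rewrite subr_eq0 => /eqP ->.
have G2mu : vanishes 2 (fun y => G2 y - mu y).
  have : vanishes 2 (fun y => \sum_(i < n | i != k)
      limit_vec y k i * (y.1 ^+ (2 * (k - i)) * mu y * w y i 0)).
    apply: vanishes_sum => i ik; case: (ltngtP k i) => ki.
    - apply: vanishes_near0; apply: nearW => y.
      by rewrite limit_vec_gt // mul0r.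
    - apply: vanishes_mull; first exact: limit_vec_analytic.
      apply: (vanishes_eq _ (vanishes_time_mul (a := 2 * (k - i)) _
        (analytic_at_mul anmu (anw i 0)))); last by lia.
      by apply: nearW => y; rewrite mulrA.
    - by case/eqP: ik; exact/esym/val_inj.
  apply: vanishes_eq; apply: filterS2 muw near_c => y [_ wk] cy.
  rewrite /G2 [in RHS](bigD1 k) //= subnn muln0 expr0 wk limit_vec_diag //.
  by rewrite !mul1r mulr1 addrAC subrr add0r.
have G1E : vanishes 2 (fun y => G1 y -
    limit_eigval y k * (1 + krylov_a y.2.1 y.2.2 k.+1 * y.1)).
  have : vanishes 2 (fun y => \sum_(i < n) \sum_(j < n) limit_vec y k i *
      (graded_gramian i j y * y.1 ^+ (2 * (j - k)) * w y j 0 -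
       graded0 y i j * ((j <= k)%N%:R * w y j 0) - y.1 * (graded1 y i j * limit_vec y k j))).
    apply: vanishes_sum => i _; apply: vanishes_sum => j _.
    apply: vanishes_mull; first exact: limit_vec_analytic.
    case: (leqP j k) => jk; last first.
      apply: (vanishes_eq _ (vanishes_time_mul (a := 2 * (j - k)) _ (analytic_at_mul
        (graded_gramian_analytic x00 x0c i j) (anw j 0)))); last by lia.
      by apply: nearW => y; rewrite limit_vec_gt //= mulr0n; ring.
    have vw := vanishes_mull (anw j 0) (graded_gramian_expansion x00 x0c i j).
    have vl := vanishes_time1_mul (vanishes_mull (graded1_analytic i j) (eigvec_comp_limit jk)).
    apply: (vanishes_eq _ (vanishes_add vw vl)); apply: nearW => y.
    rewrite (_ : 2 * (j - k) = 0)%N ?expr0 ?mulr1n; last by lia.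
    by ring.
  apply: vanishes_eq; apply: filterS2 muw near_c => y [_ wk] cy.
  under eq_bigr => i _ do under eq_bigr => j _ do rewrite !mulrBr.
  under eq_bigr => i _ do rewrite !sumrB.
  rewrite !sumrB -/(G1 y) -addrA -opprD; congr (_ - _).
  rewrite mulrDr mulr1; congr (_ + _); last first.
    rewrite mulrA -graded1_quadratic // mulr_suml; apply: eq_bigr => i _.
    rewrite mulr_sumr mulr_suml; apply: eq_bigr => j _; ring.
  under eq_bigr => i _ do rewrite -mulr_sumr.
  by rewrite limit_vec_pairing // wk mulr1.
apply: (vanishes_eq _ (vanishes_sub G1E G2mu)).
by apply: filterS G12 => y ->; ring.
Qed.

Lemma eigval_pos : \forall y \near near0 x0, 0 < mu y.
Proof.
apply: analytic_at_gt0 => //; have [muE _] := near_center eigenpair_time0.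
have x0E : at_time0 x0 = x0 by rewrite /at_time0 -x00 -surjective_pairing.
by rewrite -x0E muE limit_eigval_gt0.
Qed.

Lemma graded_comp_analytic j : analytic (fun y => graded_comp k w y j).
Proof. by apply: analytic_at_mul (anw j 0); apply/analytic_at_exp/time_analytic. Qed.

Lemma eig_dir_analytic : mx_analytic_at c3 x0 (eig_dir k w).
Proof.
apply: mx_analytic_at_sum => j _; apply: mx_analytic_at_scale.
  exact: graded_comp_analytic.
by apply: krylov_basis_analytic => //; exact: ltn_ord.
Qed.

Lemma eig_sqnorm_analytic : analytic (eig_sqnorm k w).
Proof.
by apply: analytic_at_sum => j _; apply/analytic_at_exp/graded_comp_analytic.
Qed.

Lemma eig_sqnorm_expansion : vanishes 2 (fun y => eig_sqnorm k w y - 1).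
Proof.
have : vanishes 2 (fun y => \sum_(j < n | j != k) graded_comp k w y j ^+ 2).
  apply: vanishes_sum => j jk; rewrite /graded_comp.
  apply: (vanishes_eq _ (vanishes_time_mul (a := 2 * ((j - k) + (k - j))) _
    (analytic_at_exp 2 (anw j 0)))).
    by apply: nearW => y; rewrite exprMn -exprM mulnC.
  have : (j != k :> nat) by apply: contra_neq jk; exact: val_inj.
  by lia.
apply: vanishes_eq; apply: filterS muw => y [_ wk].
rewrite /eig_sqnorm [in RHS](bigD1 k) //= {2}/graded_comp subnn expr0 wk mulr1 expr1n.
by rewrite addrAC subrr add0r.
Qed.

Lemma eig_sqnorm_center : eig_sqnorm k w x0 = 1.
Proof.
have [C nC] := eig_sqnorm_expansion; have := near_center nC.
by rewrite /= x00 normr0 expr0n mulr0 normr_le0 subr_eq0 => /eqP.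
Qed.

Lemma eig_sqnorm_pos : \forall y \near near0 x0, 0 < eig_sqnorm k w y.
Proof.
by apply: analytic_at_gt0; [exact: eig_sqnorm_analytic|rewrite eig_sqnorm_center].
Qed.

Lemma eig_norm_analytic : analytic (fun y => Num.sqrt (eig_sqnorm k w y)).
Proof.
by apply: analytic_at_sqrt; [exact: eig_sqnorm_analytic|rewrite eig_sqnorm_center].
Qed.

Lemma eig_unit_analytic : mx_analytic_at c3 x0 (eig_unit k w).
Proof.
apply: mx_analytic_at_scale; last exact: eig_dir_analytic.
apply: analytic_at_inv; first exact: eig_norm_analytic.
by rewrite eig_sqnorm_center sqrtr1 oner_eq0.
Qed.

Lemma sum_ord_eq (m : nat) (F : nat -> 'cV[R]_n) :
  \sum_(j < n) (j == m :> nat)%:R *: F j = if (m < n)%N then F m else 0.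
Proof.
case: ltnP => mn.
  rewrite (bigD1 (Ordinal mn)) //= eqxx scale1r big1 ?addr0 // => j jm.
  rewrite (_ : (j == m :> nat) = false) ?scale0r //.
  by apply: contraNF jm => /eqP jm; apply/eqP/val_inj.
apply: big1 => j _; rewrite (_ : (j == m :> nat) = false) ?scale0r //.
by apply/negbTE; have := ltn_ord j; lia.
Qed.

(** The coordinates in the Krylov basis of the Taylor polynomial. *)
Definition taylor_comp y (j : nat) : R := (j == k :> nat)%:R + y.1 / 2 *
  ((j == k.+1)%:R * beta y k.+1 - (j.+1 == k)%:R * beta y k).

Lemma eigvec_taylorE y :
  eigvec_taylor k y = \sum_(j < n) taylor_comp y j *: q y j.+1.
Proof.
pose c := y.1 / 2.
have E (j : 'I_n) : taylor_comp y j *: q y j.+1 = (j == k :> nat)%:R *: q y j.+1 +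
    c *: ((j == k.+1 :> nat)%:R *: (beta y k.+1 *: q y j.+1) -
          (j.+1 == k)%:R *: (beta y k *: q y j.+1)).
  rewrite /taylor_comp -/c scalerDl -scalerA; congr (_ + c *: _).
  by rewrite scalerBl -!scalerA.
under eq_bigr => j _ do rewrite E.
rewrite big_split /= -scaler_sumr sumrB.
rewrite (sum_ord_eq k (fun j => q y j.+1)) ltn_ord.
rewrite (sum_ord_eq k.+1 (fun j => beta y k.+1 *: q y j.+1)).
have -> : \sum_(i < n) (i.+1 == k)%:R *: (beta y k *: q y i.+1) = beta y k *: q y k.
  case: (posnP k) => [k0|kpos].
    by rewrite k0 /krylov_beta /= scale0r big1 // => i _; rewrite scale0r.
  under eq_bigr => i _ do rewrite -[in X in X%:R](prednK kpos) eqSS.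
  rewrite (sum_ord_eq k.-1 (fun j => beta y k *: q y j.+1)) prednK //.
  by rewrite ltnW ?ltn_ord.
rewrite /eigvec_taylor; congr (_ + _ *: (_ - _)).
by case: ifP => // kn; rewrite /krylov_beta /= kn scale0r.
Qed.

Lemma eig_dir_expansion l : vanishes 2 (fun y => eig_dir k w y l 0 - eigvec_taylor k y l 0).
Proof.
have : vanishes 2 (fun y => \sum_(j < n) (graded_comp k w y j - taylor_comp y j) * q y j.+1 l 0).
  apply: vanishes_sum => j _.
  have anq : analytic (fun y => q y j.+1 l 0).
    by apply: krylov_basis_analytic => //; exact: ltn_ord.
  suff H : vanishes 2 (fun y => graded_comp k w y j - taylor_comp y j).
    by apply: (vanishes_eq _ (vanishes_mull anq H)); apply: nearW => y; rewrite mulrC.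
  rewrite /graded_comp /taylor_comp.
  case: (ltngtP j k) => jk.
  (* The coordinate [j] carries the factor [T ^ |j - k|], so that only the two
     neighbours of [k] are of order one. *)
  - case: (eqVneq j.+1 k) => [jk1|jk1]; last first.
      apply: (vanishes_eq _ (vanishes_time_mul (a := (j - k) + (k - j)) _ (anw j 0))); last by lia.
      apply: nearW => y; rewrite (_ : (j == k.+1 :> nat) = false); last by apply/negbTE; lia.
      by rewrite !mul0r subr0 mulr0 addr0 subr0.
    have jk0 : (j <= k)%N by rewrite ltnW.
    apply: (vanishes_eq _ (vanishes_time1_mul (eigvec_comp_limit jk0))).
    apply: filterS near_c => y cy.
    rewrite (_ : (j == k.+1 :> nat) = false); last by apply/negbTE; lia.
    rewrite (_ : (j - k + (k - j)) = 1)%N ?expr1; last by lia.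
    by rewrite -jk1 limit_vec_prev ?jk1 ?ltn_ord //= !mulr0n mulr1n; field.
  - case: (eqVneq (j : nat) k.+1) => [jk1|jk1]; last first.
      apply: (vanishes_eq _ (vanishes_time_mul (a := (j - k) + (k - j)) _ (anw j 0))); last by lia.
      apply: nearW => y; rewrite (_ : (j.+1 == k :> nat) = false); last by apply/negbTE; lia.
      by rewrite !mul0r subr0 mulr0 addr0 subr0.
    apply: (vanishes_eq _ (vanishes_time1_mul (vanishes_at_time0 (anw j 0)))).
    apply: filterS2 near_c eigenpair_time0 => y cy [_ /(_ j) ->].
    rewrite (_ : (j.+1 == k :> nat) = false); last by apply/negbTE; lia.
    rewrite (_ : (j - k + (k - j)) = 1)%N ?expr1; last by lia.
    rewrite leqNgt jk /= {1}jk1 graded0_vec_next //; last by rewrite -jk1 ltn_ord.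
    have l0 : limit_eigval y k != 0 by rewrite gt_eqF // limit_eigval_gt0.
    by rewrite !(mulr0n, mulr1n); field.
  - have -> : j = k by exact: val_inj.
    apply: vanishes_near0; apply: filterS muw => y [_ ->].
    rewrite (_ : (k == k.+1 :> nat) = false); last by apply/negbTE; lia.
    rewrite (_ : (k.+1 == k :> nat) = false); last by apply/negbTE; lia.
    by rewrite subnn expr0 !mul0r subr0 mulr0 addr0 mulr1 subrr.
apply: vanishes_eq; apply: nearW => y; rewrite eigvec_taylorE !summxE -sumrB.
by apply: eq_bigr => j _; rewrite mulrBl [in RHS]mxE [X in _ = _ - X]mxE.
Qed.

(** Normalization is invisible to first order, since the squared norm is
    [1 + O(T ^ 2)]. *)
Lemma eig_unit_expansion l : vanishes 2 (fun y => eig_unit k w y l 0 - eigvec_taylor k y l 0).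
Proof.
pose s y := Num.sqrt (eig_sqnorm k w y).
have ans : analytic s := eig_norm_analytic.
have s1 : s x0 = 1 by rewrite /s eig_sqnorm_center sqrtr1.
have anf : analytic (fun y => - (eig_dir k w y l 0 / (s y * (1 + s y)))).
  apply: analytic_at_opp; apply: analytic_at_div; first exact: eig_dir_analytic.
    apply: analytic_at_mul => //; apply: analytic_at_add => //.
    exact: analytic_at_const.
  by rewrite s1 mul1r; apply: lt0r_neq0; exact: addr_gt0.
apply: (vanishes_eq _ (vanishes_add (vanishes_mull anf eig_sqnorm_expansion)
  (eig_dir_expansion l))).
apply: filterS eig_sqnorm_pos => y spos.
have s0 : 0 < s y by rewrite sqrtr_gt0.
have sE : eig_sqnorm k w y = s y ^+ 2 by rewrite sqr_sqrtr // ltW.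
rewrite /eig_unit [in RHS]mxE -/(s y) sE; field.
by rewrite !gt_eqF // ltr_wpDl // ltW.
Qed.

Lemma eig_unit_facts : \forall y \near near0 x0, [/\
  Gam y *m eig_unit k w y =
    (y.1 ^+ (2 * k) * mu y) *: eig_unit k w y,
  dotv (eig_unit k w y) (eig_unit k w y) = 1 &
  0 < dotv (eig_unit k w y) (q y k.+1)].
Proof.
have [r [rho [D [[r0 _ _ _] [_ _ _ facts]]]]] := graded_gramian_facts x00 x0c.
have := near_polydisc c3 x0 r0; apply: filterS3 muw eig_sqnorm_pos => y [Pw wk] spos yr.
have [cy _ gE] := facts y yr.
have s0 : 0 < Num.sqrt (eig_sqnorm k w y) by rewrite sqrtr_gt0.
split.
- by rewrite /eig_unit -scalemxAr (eig_dir_eigen cy gE Pw) !scalerA mulrC.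
- rewrite dotvZl dotvZr eig_sqnormE // -{3}(sqr_sqrtr (ltW spos)); field.
  by rewrite gt_eqF.
- rewrite dotvZl mulr_gt0 ?invr_gt0 // dotvC dotv_eig_dir //.
  by rewrite /graded_comp subnn expr0 wk mulr1.
Qed.

End AtPoint.
End LocalEigenvector.

(** * Extension of the spectral data to all times *)

Section GlobalExtension.
Variables (R : realType) (n : nat).
Notation X := (R * ('M[R]_n * 'cV[R]_n))%type.
Notation c3 := (@coord3 R n).
Notation near0 x0 := (polydisc_nbhs c3 x0).
Notation q y k := (krylov_basis y.2.1 y.2.2 k).
Notation beta y k := (krylov_beta y.2.1 y.2.2 k).
Notation ctrl y := (controllable y.2.1 y.2.2).
Notation Gam y := (scaled_gramian y.1 y.2.1 y.2.2).
Implicit Types (x y : X) (k : nat).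

(** These formulas define the extensions at once for all pairs and times, so that
    local statements about them need not be glued together. *)
Definition ext_eigval k y : R :=
  if y.1 == 0 then kappa R k * krylov_d y.2.1 y.2.2 k ^+ 2
  else nth 0 (eigenvalues (Gam y)) k.-1 / y.1 ^+ (2 * k.-1).

Definition ext_eigvec k y : 'cV[R]_n :=
  if y.1 == 0 then q y k
  else oriented_eigvec (Gam y) (q y k) k.-1.

Definition ext_proj k y : 'M[R]_n :=
  \sum_(i < k) ext_eigvec i.+1 y *m (ext_eigvec i.+1 y)^T.

Definition extends_at y : Prop :=
  [/\ strictly_ordered y.1 y.2.1 y.2.2, eigenspaces_not_orthogonal y.1 y.2.1 y.2.2 &
   [/\ forall k, (1 <= k <= n)%N -> normalized_eigval y.1 y.2.1 y.2.2 k = ext_eigval k y,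
       forall k, (k <= n)%N -> spectral_proj y.1 y.2.1 y.2.2 k = ext_proj k y &
       forall k, (1 <= k <= n)%N -> eigvec y.1 y.2.1 y.2.2 k = ext_eigvec k y]].

Definition remainders_bounded C y : Prop :=
  [/\ forall k, (1 <= k <= n)%N ->
        `|eigval_remainder y.1 y.2.1 y.2.2 k| <= C * y.1 ^+ 2,
      forall k, (1 <= k < n)%N ->
        forall i j, `|spectral_proj_remainder y.1 y.2.1 y.2.2 k i j| <= C * y.1 ^+ 2 &
      forall k, (1 <= k <= n)%N ->
        forall i j, `|eigvec_remainder y.1 y.2.1 y.2.2 k i j| <= C * y.1 ^+ 2].

Section AtPoint.
Variable x0 : X.
Hypothesis x00 : x0.1 = 0.
Hypothesis x0c : ctrl x0.
Notation vanishes := (vanishes c3 (inl tt) x0).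
Notation analytic := (analytic_at c3 x0).

Let near_c := controllable_near x0c.

Lemma gramian_near : \forall y \near near0 x0, 0 < y.1 ->
  gramian y.1 y.2.1 y.2.2 = y.1 *: Gam y.
Proof.
have [r [rho [D [[r0 _ _ _] [_ _ _ facts]]]]] := graded_gramian_facts x00 x0c.
by exists r => // y /facts[].
Qed.

(** The eigenpairs are constructed for indices in ['I_n], while spectra are indexed
    by natural numbers. *)
Definition ord_family (S : Type) (d : S) (F : 'I_n -> S) (i : nat) : S :=
  if insub i is Some k then F k else d.

Lemma ord_familyE (S : Type) (d : S) (F : 'I_n -> S) (k : 'I_n) : ord_family d F k = F k.
Proof. by rewrite /ord_family valK. Qed.

Lemma ord_familyP (S : Type) (d : S) (F : 'I_n -> S) i (iln : (i < n)%N) :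
  ord_family d F i = F (Ordinal iln).
Proof. exact: (ord_familyE d F (Ordinal iln)). Qed.

(** All eigenpairs of the Gramian divided by the time, the eigenvalues being taken
    without their power of the time. These powers make their order strict. *)
Lemma local_spectrum : exists (mu : nat -> X -> R) (psi : nat -> X -> 'cV[R]_n),
  [/\ forall i, (i < n)%N -> analytic (mu i),
      forall i, (i < n)%N -> mx_analytic_at c3 x0 (psi i),
      forall i, (i < n)%N -> vanishes 2 (fun y => mu i y -
        limit_eigval y i * (1 + krylov_a y.2.1 y.2.2 i.+1 * y.1)),
      forall i, (i < n)%N -> forall l, vanishes 2 (fun y => psi i y l 0 -
        eigvec_taylor i y l 0) &
      \forall y \near near0 x0, [/\ forall i, (i < n)%N -> 0 < mu i y,
        forall i, (i < n)%N -> 0 < dotv (psi i y) (q y i.+1) &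
        y.1 != 0 -> spectral_family (Gam y) (fun i => y.1 ^+ (2 * i) * mu i y) (psi ^~ y)]].
Proof.
have [mu_ /choice[w_ H]] := choice (fun k : 'I_n => local_eigenpair k x00 x0c).
have anmu (k : 'I_n) : analytic (mu_ k) by have [] := H k.
have anw (k : 'I_n) : mx_analytic_at c3 x0 (w_ k) by have [] := H k.
have muw (k : 'I_n) : \forall y \near near0 x0, pencil k y (mu_ k y) *m w_ k y = 0 /\ w_ k y k 0 = 1.
  by have [] := H k.
exists (ord_family (fun=> 0) mu_), (ord_family (fun=> 0) (fun k : 'I_n => eig_unit k (w_ k))).
split.
- by move=> i iln; rewrite ord_familyP.
- move=> i iln; rewrite ord_familyP.
  exact: (eig_unit_analytic x00 x0c (anw _) (muw _)).
- move=> i iln; rewrite ord_familyP.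
  exact: (eigval_expansion x00 x0c (anmu (Ordinal iln)) (anw _) (muw _)).
- move=> i iln l; rewrite ord_familyP.
  exact: (eig_unit_expansion x00 x0c (anw (Ordinal iln)) (muw _)).
have pos (k : 'I_n) : \forall y \near near0 x0, 0 < mu_ k y.
  exact: (eigval_pos x00 x0c (anmu k) (muw k)).
have near1 : \forall y \near near0 x0, forall k : 'I_n, 0 < mu_ k y /\ [/\
   Gam y *m eig_unit k (w_ k) y = (y.1 ^+ (2 * k) * mu_ k y) *: eig_unit k (w_ k) y,
   dotv (eig_unit k (w_ k) y) (eig_unit k (w_ k) y) = 1 &
   0 < dotv (eig_unit k (w_ k) y) (q y k.+1)].
  apply: filter_forall => k.
  by apply: filterS2 (pos k) (eig_unit_facts x00 x0c (anw k) (muw k)) => y; split.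
have near2 : \forall y \near near0 x0, forall i j : 'I_n, (i < j)%N ->
    y.1 ^+ (2 * (j - i)) * mu_ j y < mu_ i y.
  apply: filter_forall => i; apply: filter_forall => j.
  case: (ltnP i j) => ij; last by apply: nearW.
  have an : analytic (fun y => mu_ i y - y.1 ^+ (2 * (j - i)) * mu_ j y).
    apply: analytic_at_sub => //; apply: analytic_at_mul => //.
    by apply: analytic_at_exp; exact: time_analytic.
  have c0 : 0 < mu_ i x0 - x0.1 ^+ (2 * (j - i)) * mu_ j x0.
    rewrite x00 expr0n (_ : (2 * (j - i) == 0)%N = false); last by apply/negbTE; lia.
    by rewrite mul0r subr0; exact: near_center (pos i).
  by apply: filterS (analytic_at_gt0 an c0) => y yp _; rewrite -subr_gt0.
apply: filterS2 near1 near2 => y h1 h2; split.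
- by move=> i iln; rewrite ord_familyP; have [] := h1 (Ordinal iln).
- by move=> i iln; rewrite ord_familyP; have [_ []] := h1 (Ordinal iln).
move=> y0; split; first exact: scaled_gramian_sym.
- by move=> i iln; rewrite !ord_familyP; have [_ []] := h1 (Ordinal iln).
- by move=> i iln; rewrite ord_familyP; have [_ []] := h1 (Ordinal iln).
move=> i j /andP[ij jn]; rewrite (ord_familyP _ _ jn) (ord_familyP _ _ (ltn_trans ij jn)).
have -> : (2 * j = 2 * i + 2 * (j - i))%N by lia.
rewrite exprD -mulrA ltr_pM2l; last by rewrite exprM exprn_gt0 // exprn_even_gt0 //= y0.
exact: (h2 (Ordinal (ltn_trans ij jn)) (Ordinal jn) ij).
Qed.

Lemma vanishes_exact m f : (0 < m)%N -> vanishes m f ->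
  \forall y \near near0 x0, y.1 = 0 -> f y = 0.
Proof.
move=> m0 [C fC]; apply: filterS fC => y /= fy y0; apply/eqP.
by rewrite -normr_le0 (le_trans fy) // y0 normr0 expr0n gtn_eqF // mulr0.
Qed.

Lemma mx_entries_near m p (F G : X -> 'M[R]_(m, p)) :
  (forall i j, \forall y \near near0 x0, F y i j = G y i j) ->
  \forall y \near near0 x0, F y = G y.
Proof.
move=> FG; have : \forall y \near near0 x0, forall i j, F y i j = G y i j.
  by apply: filter_forall => i; apply: filter_forall => j.
by apply: filterS => y h; apply/matrixP.
Qed.

Lemma vanishes_common (J : finType) m (f_ : J -> X -> R) :
  (forall j, vanishes m (f_ j)) -> exists C,
  \forall y \near near0 x0, forall j, `|f_ j y| <= C * `|y.1| ^+ m.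
Proof.
move=> /choice[C_ C_P]; exists (\sum_j `|C_ j|).
have : \forall y \near near0 x0, forall j, `|f_ j y| <= C_ j * `|y.1| ^+ m.
  exact: filter_forall.
apply: filterS => y h j; apply: (le_trans (h j)); apply: ler_wpM2r.
  exact: exprn_ge0.
apply: (le_trans (ler_norm _)); rewrite (bigD1 j) //= lerDl.
by apply: sumr_ge0.
Qed.

Lemma beta_basis_analytic l m (a : 'I_n) : ((0 < l < n)%N -> (1 <= m <= n)%N) ->
  analytic (fun y => beta y l * q y m a 0).
Proof.
have [ln /(_ isT) mn|ln _] := boolP (0 < l < n)%N.
  apply: analytic_at_mul; first exact: beta_analytic.
  exact: krylov_basis_analytic.
by rewrite /krylov_beta (negPf ln); under eq_fun do rewrite mul0r; exact: analytic_at_const.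
Qed.

Definition proj_remainder (psi : nat -> X -> 'cV[R]_n) k (a c : 'I_n) y : R :=
  \sum_(i < k) psi i y a 0 * psi i y c 0 -
  (\sum_(i < k) q y i.+1 a 0 * q y i.+1 c 0 + y.1 / 2 * beta y k *
    (q y k.+1 a 0 * q y k c 0 + q y k a 0 * q y k.+1 c 0)).

(** The first order terms of the rank one projectors telescope. *)
Lemma proj_remainder_vanishes (psi : nat -> X -> 'cV[R]_n) :
  (forall i, (i < n)%N -> mx_analytic_at c3 x0 (psi i)) ->
  (forall i, (i < n)%N -> forall l, vanishes 2 (fun y => psi i y l 0 -
        eigvec_taylor i y l 0)) ->
  forall k a c, (k <= n)%N -> vanishes 2 (proj_remainder psi k a c).
Proof.
move=> anpsi psiE k a c; elim: k => [|k IH] kn.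
  apply: vanishes_near0; apply: nearW => y; rewrite /proj_remainder !big_ord0.
  by rewrite /krylov_beta /= mulr0 mul0r addr0 subr0.
pose d l y := beta y k.+1 * q y k.+2 l 0 - beta y k * q y k l 0.
have and_ l : analytic (d l).
  by apply: analytic_at_sub; apply: beta_basis_analytic; lia.
have anq l : analytic (fun y => q y k.+1 l 0) by apply: krylov_basis_analytic.
have anT : analytic (fun y => y.1 / 2).
  by apply: analytic_at_mul; [exact: time_analytic|exact: analytic_at_const].
pose t l y := q y k.+1 l 0 + y.1 / 2 * d l y.
have ant l : analytic (t l) by apply: analytic_at_add => //; exact: analytic_at_mul.
have vt l : vanishes 2 (fun y => psi k y l 0 - t l y).
  apply: (vanishes_eq _ (psiE k kn l)); apply: nearW => y.
  by rewrite /t /d /eigvec_taylor !mxE.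
have v1 := vanishes_mull (anpsi k kn c 0) (vt a).
have v2 := vanishes_mull (ant a) (vt c).
have v3 : vanishes 2 (fun y => y.1 ^+ 2 * (4^-1 * (d a y * d c y))).
  apply: vanishes_time_mul => //; apply: analytic_at_mul; first exact: analytic_at_const.
  exact: analytic_at_mul.
apply: (vanishes_eq _ (vanishes_add (IH (ltnW kn)) (vanishes_add (vanishes_add v1 v2) v3))).
by apply: nearW => y; rewrite /proj_remainder !big_ord_recr /= /t /d; field.
Qed.

Section Spectrum.
Variables (mu : nat -> X -> R) (psi : nat -> X -> 'cV[R]_n).
Hypothesis anpsi : forall i, (i < n)%N -> mx_analytic_at c3 x0 (psi i).
Hypothesis muE : forall i, (i < n)%N -> vanishes 2 (fun y => mu i y -
  limit_eigval y i * (1 + krylov_a y.2.1 y.2.2 i.+1 * y.1)).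
Hypothesis psiE : forall i, (i < n)%N -> forall l, vanishes 2 (fun y =>
  psi i y l 0 - eigvec_taylor i y l 0).
Hypothesis spec : \forall y \near near0 x0, [/\ forall i, (i < n)%N -> 0 < mu i y,
  forall i, (i < n)%N -> 0 < dotv (psi i y) (q y i.+1) &
  y.1 != 0 -> spectral_family (Gam y) (fun i => y.1 ^+ (2 * i) * mu i y) (psi ^~ y)].

(** For nonzero times by uniqueness of the spectral data, and at time zero by the
    expansions. *)
Lemma ext_spectrum : \forall y \near near0 x0, forall i, (i < n)%N ->
  mu i y = ext_eigval i.+1 y /\ psi i y = ext_eigvec i.+1 y.
Proof.
have ext_mu i : (i < n)%N -> \forall y \near near0 x0, mu i y = ext_eigval i.+1 y.
  move=> iln; apply: filterS2 spec (vanishes_exact _ (muE iln)) => // y [_ _ sy] y0E.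
  rewrite /ext_eigval; case: eqVneq => y0.
    have /eqP := y0E y0; rewrite y0 mulr0 addr0 mulr1 subr_eq0 => /eqP ->.
    by rewrite limit_eigvalE.
  rewrite (nth_simple_spectrum (sy y0) iln) mulrC mulKf // expf_eq0 negb_and y0.
  by rewrite orbT.
have ext_psi i : (i < n)%N -> \forall y \near near0 x0, psi i y = ext_eigvec i.+1 y.
  move=> iln; apply: mx_entries_near => l c; rewrite ord1.
  apply: filterS2 spec (vanishes_exact _ (psiE iln l)) => // y [_ pq sy] y0E.
  rewrite /ext_eigvec; case: eqVneq => y0; last first.
    by rewrite (oriented_eigvecE (sy y0) iln (pq i iln)).
  have /eqP := y0E y0.
  by rewrite /eigvec_taylor y0 mul0r scale0r addr0 subr_eq0 => /eqP.
have : \forall y \near near0 x0, forall i : 'I_n,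
    mu i y = ext_eigval i.+1 y /\ psi i y = ext_eigvec i.+1 y.
  apply: filter_forall => i.
  by apply: filterS2 (ext_mu i (ltn_ord i)) (ext_psi i (ltn_ord i)) => y; split.
by apply: filterS => y h i iln; exact: (h (Ordinal iln)).
Qed.

Lemma gramian_spectrum : \forall y \near near0 x0, 0 < y.1 ->
  [/\ strictly_ordered y.1 y.2.1 y.2.2, eigenspaces_not_orthogonal y.1 y.2.1 y.2.2,
    forall i, (i < n)%N -> eigval y.1 y.2.1 y.2.2 i.+1 = y.1 ^+ (2 * i).+1 * mu i y,
    forall k, (k <= n)%N -> spectral_proj y.1 y.2.1 y.2.2 k = \sum_(i < k) psi i y *m (psi i y)^T &
    forall i, (i < n)%N -> eigvec y.1 y.2.1 y.2.2 i.+1 = psi i y].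
Proof.
apply: filterS2 spec gramian_near => y [mu0 psiq sy] gE y0.
have := spectral_family_scale y0 (sy (lt0r_neq0 y0)); rewrite -gE // => Gspec.
split.
- by apply: (gramian_strictly_ordered Gspec) => i iln; rewrite !mulr_gt0 ?exprn_gt0 ?mu0.
- exact: (gramian_eigenspaces_not_orthogonal Gspec psiq).
- by move=> i iln; rewrite (gramian_eigval Gspec) // mulrA exprS.
- by move=> k kn; rewrite (gramian_spectral_proj Gspec psiq).
- by move=> i iln; rewrite (gramian_eigvec Gspec psiq).
Qed.

Lemma extends_near : \forall y \near near0 x0, 0 < y.1 -> extends_at y.
Proof.
apply: filterS2 gramian_spectrum ext_spectrum => y gy ey y0.
have [so no eE pE vE] := gy y0; split=> //; split.
- move=> [|i] // iln; rewrite /normalized_eigval eE //.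
  have [<- _] := ey i iln; rewrite (_ : (2 * i.+1).-1 = (2 * i).+1); last by lia.
  by rewrite mulrC mulKf // expf_neq0 // gt_eqF.
- move=> k kn; rewrite pE //; apply: eq_bigr => i _.
  by have [_ ->] := ey i (leq_trans (ltn_ord i) kn).
- by move=> [|i] // iln; rewrite vE //; have [_ ->] := ey i iln.
Qed.

Lemma remainders_near : exists C, \forall y \near near0 x0, 0 < y.1 ->
  remainders_bounded C y.
Proof.
pose rem (j : 'I_n + ('I_n * ('I_n * 'I_n) + 'I_n * 'I_n)) y := match j with
  | inl i => mu i y / limit_eigval y i - (1 + krylov_a y.2.1 y.2.2 i.+1 * y.1)
  | inr (inl (k, (a, c))) => proj_remainder psi k a c y
  | inr (inr (i, l)) => psi i y l 0 - eigvec_taylor i y l 0 end.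
have vrem j : vanishes 2 (rem j).
  case: j => [i|[[k [a c]]|[i l]]]; last exact: psiE.
    have anl : analytic (fun y => (limit_eigval y i)^-1).
      apply: analytic_at_inv; first exact: limit_eigval_analytic.
      by rewrite gt_eqF // limit_eigval_gt0.
    apply: (vanishes_eq _ (vanishes_mull anl (muE (ltn_ord i)))).
    apply: filterS near_c => y cy /=.
    by field; rewrite gt_eqF // limit_eigval_gt0.
  by apply: (proj_remainder_vanishes anpsi psiE); exact: ltnW.
have [C nC] := vanishes_common vrem; exists C.
apply: filterS3 near_c gramian_spectrum nC => y cy gy; rewrite /= real_normK ?num_real // => b y0.
have [_ _ eE pE vE] := gy y0; split.
- move=> [|i] // iln; apply: le_trans (b (inl (Ordinal iln))).
  rewrite /= /eigval_remainder eE // (_ : (2 * i.+1).-1 = (2 * i).+1); last by lia.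
  rewrite limit_eigvalE /= le_eqVlt; apply/orP; left; apply/eqP; congr (`|_ - _|).
  rewrite [_ * mu i y]mulrC -mulf_div mulfV ?mulr1 //.
  by rewrite expf_neq0 // gt_eqF.
- move=> k /andP[k1 kn] a c; apply: le_trans (b (inr (inl (Ordinal kn, (a, c))))).
  rewrite /= /spectral_proj_remainder pE ?(ltnW kn) // krylov_orthoproj ?(ltnW kn) //.
  rewrite /proj_remainder le_eqVlt; apply/orP; left; apply/eqP; congr (`|_|).
  rewrite mxE summxE mxE [X in _ - X]mxE; congr (_ - (_ + _)).
  + by apply: eq_bigr => i _; rewrite mxE big_ord1 mxE.
  + rewrite summxE big_add1 big_mkord; apply: eq_bigr => i _.
    by rewrite mxE big_ord1 [X in _ * X]mxE.
  + by rewrite mxE [X in _ * X]mxE; congr (_ * (_ + _));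
      rewrite mxE big_ord1 [X in _ * X]mxE.
- move=> [|i] // iln l c; rewrite ord1; apply: le_trans (b (inr (inr (Ordinal iln, l)))).
  by rewrite /= /eigvec_remainder vE // mxE [X in _ + X]mxE.
Qed.

End Spectrum.

Lemma local_theorem : [/\ forall k, (1 <= k <= n)%N -> analytic (ext_eigval k),
  forall k, (1 <= k <= n)%N -> mx_analytic_at c3 x0 (ext_eigvec k),
  \forall y \near near0 x0, ctrl y /\ (0 < y.1 -> extends_at y) &
  exists C, \forall y \near near0 x0, 0 < y.1 -> remainders_bounded C y].
Proof.
have [mu [psi [anmu anpsi muE psiE spec]]] := local_spectrum.
have extE := ext_spectrum muE psiE spec; split.
- move=> [|i] // iln; apply: analytic_at_near_eq (anmu i iln).
  by apply: filterS extE => y /(_ i iln)[].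
- move=> [|i] // iln; apply: mx_analytic_at_near_eq (anpsi i iln).
  by apply: filterS extE => y /(_ i iln)[].
- by apply: filterS2 near_c (extends_near muE psiE spec) => y; split.
- exact: remainders_near anpsi muE psiE spec.
Qed.

End AtPoint.
End GlobalExtension.

(** * Taylor series *)

Section Taylor.
Variable R : realType.
Implicit Types (c : nat -> R) (r s C : R).

Lemma homogeneous_part_unit (c : {ffun unit -> nat} -> R) (h : unit -> R) k :
  homogeneous_part c h k = c [ffun=> k] * h tt ^+ k.
Proof.
have sum_unit (F : unit -> nat) : (\sum_i F i)%N = F tt.
  by rewrite (bigD1 tt) //= big1 ?addn0 // => -[].
rewrite /homogeneous_part (bigD1 [ffun=> ord_max]) /=; last by rewrite sum_unit ffunE.
rewrite [X in _ + X]big1 ?addr0 => [|a]; last first.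
  rewrite sum_unit => /andP[/eqP ak /eqP[]]; apply/ffunP => -[]; rewrite ffunE.
  exact: val_inj.
rewrite (bigD1 tt) //= big1 ?mulr1 => [|[]//]; rewrite ffunE; congr (c _ * _).
by apply/ffunP => i; rewrite !ffunE.
Qed.

Lemma ps_coord1_coef r C (f : R -> R) : 0 < r -> power_series (@coord1 R) 0 r C f ->
  exists c, (forall k, `|c k| * r ^+ k <= C) /\
    forall y, `|y| < r -> pseries c y @ \oo --> f y.
Proof.
move=> r0 [c [cC cf]]; exists (fun k => c [ffun=> k]); split=> [k|y yr].
  apply: le_trans (cC k.+1); rewrite big_nat_recr //= homogeneous_part_unit lerDr.
  apply: sumr_ge0 => i _; apply: homogeneous_part_ge0 => // j; exact: ltW.
have /cf : polydisc (@coord1 R) 0 r y by case; rewrite /coord1 subr0.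
rewrite (_ : series _ = pseries (fun k => c [ffun=> k]) y) //.
apply/funext => N; apply: eq_bigr => k _.
by rewrite homogeneous_part_unit /coord1 subr0.
Qed.

(** A form of convergence on the disc of radius [r] which passes to the
    derivative, since the radius [s] may be increased a little. *)
Definition coef_bounded r c := forall s, 0 <= s < r -> exists C, forall i, `|c i| * s ^+ i <= C.

Lemma coef_bounded_cvg r c z : coef_bounded r c -> `|z| < r -> cvgn (pseries c z).
Proof.
move=> cb zr; pose s := (`|z| + r) / 2.
have z0 := normr_ge0 z.
have s01 : 0 <= s < r by apply/andP; rewrite /s; split; lra.
have [C cC] := cb s s01.
have s0 : 0 < s by rewrite /s; lra.
have C0 : 0 <= C.
  by apply: le_trans (cC 0%N); rewrite mulr_ge0 // exprn_ge0 // ltW.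
have q01 : 0 <= `|z| / s < 1.
  by rewrite divr_ge0 ?(ltW s0) //= ltr_pdivrMr // mul1r /s; lra.
apply: (@normal_series_cvg _ _ (fun i => C * (`|z| / s) ^+ i) (C * (1 - `|z| / s)^-1)).
  move=> i; rewrite normrM normrX expr_div_n (mulrA C) (mulrAC C).
  apply: ler_wpM2r; first exact: exprn_ge0.
  by rewrite ler_pdivlMr ?exprn_gt0.
by move=> N; rewrite -mulr_sumr; apply: ler_wpM2l => //; exact: geometric_sum_le.
Qed.

Lemma coef_bounded_diffs r c : coef_bounded r c -> coef_bounded r (pseries_diffs c).
Proof.
move=> cb s /andP[s0 sr]; pose t := (s + r) / 2.
have t01 : 0 <= t < r by apply/andP; rewrite /t; split; lra.
have st : s < t by rewrite /t; lra.
clearbody t.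
have [C cC] := cb t t01.
have t0 : 0 < t by lra.
have q01 : 0 <= s / t < 1.
  by rewrite divr_ge0 ?(ltW t0) //= ltr_pdivrMr // mul1r.
exists (C / t * (1 - s / t)^-1) => i; rewrite /pseries_diffs normrM ger0_norm //.
have C0 : 0 <= C.
  by apply: le_trans (cC 0%N); rewrite mulr_ge0 // exprn_ge0 // ltW.
apply: (@le_trans _ _ (C / t * (i.+1%:R * (s / t) ^+ i))).
  have -> : i.+1%:R * `|c i.+1| * s ^+ i =
      (`|c i.+1| * t ^+ i.+1) / t * (i.+1%:R * (s / t) ^+ i).
    have v0 : t ^+ i != 0 by rewrite expf_neq0 // gt_eqF.
    rewrite (expr_div_n s) (exprS t); move: (t ^+ i) v0 (s ^+ i) => v v0 u.
    by field; rewrite v0 gt_eqF.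
  apply: ler_wpM2r; first by rewrite mulr_ge0 // exprn_ge0 //; case/andP: q01.
  by apply: ler_wpM2r => //; rewrite invr_ge0 ltW.
apply: ler_wpM2l; first by rewrite divr_ge0 // ltW.
apply: le_trans (geometric_sum_le i.+1 q01).
rewrite mulr_natl -[i.+1 in X in X <= _]subn0 -sumr_const_nat.
apply: ler_sum_nat => j /andP[_ ji]; rewrite ler_wiXn2l //; first by case/andP: q01.
by apply: ltW; case/andP: q01.
Qed.

Lemma pseries_diffs_iterE c m i :
  iter m (@pseries_diffs R) c i * i`!%:R = (i + m)`!%:R * c (i + m)%N.
Proof.
elim: m i => [|m IH] i; first by rewrite addn0 mulrC.
rewrite iterS /pseries_diffs addnS -addSn -IH factS natrM; ring.
Qed.

Lemma pseries_at0 c : limn (pseries c 0) = c 0%N.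
Proof.
apply: cvg_lim => //; rewrite -cvg_shiftS.
rewrite [X in X @ _](_ : _ = fun=> c 0%N); first exact: cvg_cst.
apply/funext => N; rewrite /pseries /series /= big_nat_recl // expr0 mulr1 big1 ?addr0 // => i _.
by rewrite expr0n mulr0.
Qed.

(** The power series can be differentiated term by term on its open disc. *)
Lemma power_series_taylor r C (f : R -> R) : 0 < r ->
  power_series (@coord1 R) 0 r C f -> taylor_at0_converges r f.
Proof.
move=> r0 /(ps_coord1_coef r0)[c [cC cf]].
have cb : coef_bounded r c.
  move=> s /andP[s0 sr]; exists C => i; apply: le_trans (cC i); apply: ler_wpM2l => //.
  by rewrite lerXn2r ?nnegrE ?(ltW r0) // ltW.
have cbm m : coef_bounded r (iter m (@pseries_diffs R) c).
  by elim: m => // m IH; exact: coef_bounded_diffs.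
have dE m y : `|y| < r -> f^`(m)%classic y = limn (pseries (iter m (@pseries_diffs R) c) y).
  elim: m y => [|m IH] y yr; first by rewrite derive1n0; apply/esym/cvg_lim => //; exact: cf.
  rewrite derive1nS derive1E.
  pose K := (`|y| + r) / 2; have y0 := normr_ge0 y.
  have K0 : 0 < K by rewrite /K; lra.
  have Kr : `|K| < r by rewrite gtr0_norm // /K; lra.
  have := @pseries_snd_diffs R (iter m (@pseries_diffs R) c) K y
    (coef_bounded_cvg (cbm m) Kr) (coef_bounded_cvg (cbm m.+1) Kr)
    (coef_bounded_cvg (cbm m.+2) Kr).
  rewrite (gtr0_norm K0) => /(_ _)[]; first by rewrite /K; lra.
  move=> _ <-; apply: near_eq_derive.
  near=> z; apply: IH; near: z.
  have e0 : 0 < r - `|y| by lra.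
  exists (r - `|y|) => //= z; rewrite /ball /= => yz.
  have := ler_normD (z - y) y; rewrite subrK distrC; lra.
move=> T Tr; rewrite (_ : series _ = pseries c T); first exact: cf.
apply/funext => N; apply: eq_bigr => m _; congr (_ * _); rewrite dE ?normr0 // pseries_at0.
have := pseries_diffs_iterE c m 0; rewrite fact0 mulr1 add0n => ->.
by rewrite mulrC mulKf // pnatr_eq0 -lt0n fact_gt0.
Unshelve. all: by end_near. Qed.

Lemma ps_analytic_line (X : Type) (I : finType) (coord : I -> X -> R) (x : X)
    (phi : R -> X) (i0 : I) r C f : 0 < r -> power_series coord x r C f ->
  (forall T, coord i0 (phi T) - coord i0 x = T) ->
  (forall T i, i != i0 -> coord i (phi T) = coord i x) ->
  power_series (@coord1 R) 0 r C (f \o phi).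
Proof.
move=> r0 psf phi0 phiE.
apply: (@ps_comp _ _ _ _ _ coord (@coord1 R) x 0 r r C f phi (fun=> r)) => // [i|T Tr i].
  have [->|ii0] := eqVneq i i0.
    apply: ps_ext (ps_coord (@coord1 R) 0 tt (ltW r0)) => T _.
    by rewrite phi0 /coord1 subr0.
  apply: (@ps_ext _ _ _ _ _ _ _ (fun=> 0)) => [T _|].
    by rewrite phiE // subrr.
  by apply: ps_weaken (ps_const _ _ _ 0); rewrite normr0 ltW.
have [->|ii0] := eqVneq i i0; last by rewrite phiE // subrr normr0.
by rewrite phi0; have := Tr tt; rewrite /coord1 subr0.
Qed.

End Taylor.

(** * Uniformity on compact sets *)

Section UniformExtension.
Variables (R : realType) (n : nat).
Notation Y := ('M[R]_n * 'cV[R]_n)%type.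
Notation X := (R * Y)%type.
Notation c3 := (@coord3 R n).
Implicit Types (x : Y) (y : X) (rho : R).

(** One parameter serves as radius of convergence and, by its inverse, as constant
    of the remainders: every sufficiently small value is good, uniformly near a
    given pair, and by compactness one value is good for a whole compact set. *)
Definition good_radius rho x : Prop :=
  [/\ forall k, (1 <= k <= n)%N -> exists C, power_series c3 (0, x) rho C (ext_eigval k),
      forall k, (k <= n)%N -> forall i j, exists C,
        power_series c3 (0, x) rho C (fun y => ext_proj k y i j),
      forall k, (1 <= k <= n)%N -> forall i j, exists C,
        power_series c3 (0, x) rho C (fun y => ext_eigvec k y i j) &
      forall y, polydisc c3 (0, x) rho y -> controllable y.2.1 y.2.2 /\
        (0 < y.1 -> extends_at y /\ remainders_bounded rho^-1 y)].

Lemma ext_proj_analytic (y0 : X) k : (forall j, (1 <= j <= n)%N ->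
    mx_analytic_at c3 y0 (ext_eigvec j)) -> (k <= n)%N ->
  mx_analytic_at c3 y0 (ext_proj k).
Proof.
move=> an kn; apply: mx_analytic_at_sum => i _.
have ani : mx_analytic_at c3 y0 (ext_eigvec i.+1).
  by apply: an; exact: leq_trans (ltn_ord i) kn.
by apply: mx_analytic_at_mul => //; exact: mx_analytic_at_tr.
Qed.

Lemma good_radius_near x0 : controllable x0.1 x0.2 ->
  exists2 r, 0 < r & forall x rho, ball x0 r x -> 0 < rho < r -> good_radius rho x.
Proof.
move=> x0c; have [an1 an3 ne [C neC]] := @local_theorem R n (0, x0) erefl x0c.
have an2 k := ext_proj_analytic (k := k) an3.
pose J : finType := ('I_n + (('I_n.+1 * ('I_n * 'I_n)) + ('I_n * ('I_n * 'I_1))))%type.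
pose F (j : J) : X -> R := match j with
  | inl k => ext_eigval k.+1
  | inr (inl (k, (a, c))) => fun y => ext_proj k y a c
  | inr (inr (k, (a, c))) => fun y => ext_eigvec k.+1 y a c end.
have anF j : analytic_at c3 (0, x0) (F j).
  case: j => [k|[[k [a c]]|[k [a c]]]] /=.
  - by apply: an1; exact: ltn_ord.
  - by apply: an2; rewrite -ltnS.
  - by apply: an3; exact: ltn_ord.
have [r1 [D [r10 _ psF]]] := analytic_at_common anF.
have [r2 r20 hr2] := filterI ne neC.
pose s := Num.min (Num.min r1 r2) (`|C| + 1)^-1.
have C1 : 0 < `|C| + 1 by rewrite ltr_wpDl.
have s0 : 0 < s by rewrite !lt_min r10 r20 invr_gt0.
have sr1 : s <= r1 by rewrite !ge_min lexx.
have sr2 : s <= r2 by rewrite !ge_min lexx orbT.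
have sC : s <= (`|C| + 1)^-1 by rewrite ge_min lexx orbT.
exists (s / 2); first by rewrite divr_gt0.
move=> x rho xx0 /andP[rho0 rhos].
have x0x : polydisc c3 (0, x0) (s / 2) (0, x).
  rewrite polydisc_ball; last by rewrite divr_gt0.
  by split => //=; apply: ballxx; rewrite divr_gt0.
have ps_shift f : power_series c3 (0, x0) r1 D f -> power_series c3 (0, x) rho D f.
  apply: ps_recenter => // i; have := x0x i; lra.
have sub y : polydisc c3 (0, x) rho y -> polydisc c3 (0, x0) r2 y.
  move=> yr i; have := ler_normD (c3 i y - c3 i (0, x)) (c3 i (0, x) - c3 i (0, x0)).
  rewrite addrA subrK; have := yr i; have := x0x i; lra.
split.
- by move=> [|k] // kn; exists D; apply/ps_shift/(psF (inl (Ordinal kn))).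
- move=> k kn a c; exists D; apply/ps_shift.
  exact: (psF (inr (inl (Ordinal (kn : (k < n.+1)%N), (a, c))))).
- move=> [|k] // kn a c; exists D; apply/ps_shift.
  exact: (psF (inr (inr (Ordinal kn, (a, c))))).
move=> y /sub/hr2[[cy ey] ry]; split=> // y0; split; first exact: ey.
have [b1 b2 b3] := ry y0.
have Crho : C * y.1 ^+ 2 <= rho^-1 * y.1 ^+ 2.
  apply: ler_wpM2r; first exact: sqr_ge0.
  apply: (@le_trans _ _ (`|C| + 1)); first by have := ler_norm C; lra.
  rewrite -[leLHS]invrK lef_pV2 ?posrE ?invr_gt0 //; apply: ltW.
  by apply: lt_le_trans sC; apply: lt_le_trans rhos _; lra.
split=> k kn.
- exact: le_trans (b1 k kn) Crho.
- by move=> i j; exact: le_trans (b2 k kn i j) Crho.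
- by move=> i j; exact: le_trans (b3 k kn i j) Crho.
Qed.

Lemma good_radius_compact (K : set Y) : compact K ->
  (forall x, K x -> controllable x.1 x.2) ->
  exists2 rho, 0 < rho & forall x, K x -> good_radius rho x.
Proof.
move=> /compact_near_coveringP/(_ R (0^'+) good_radius _) cov Kc.
have : \forall rho \near (0 : R)^'+, K `<=` good_radius rho.
  apply: cov => x Kx; have [r r0 rP] := good_radius_near (Kc x Kx).
  exists (ball x r, [set rho | 0 < rho < r]).
    split; first exact: nbhsx_ballx.
    near=> rho; apply/andP; split; near: rho; [exact: nbhs_right_gt|exact: nbhs_right_lt].
  by move=> [x' rho] /= [? ?]; exact: rP.
move=> H; have : \forall rho \near (0 : R)^'+, 0 < rho /\ K `<=` good_radius rho.
  by near=> rho; split; near: rho => //; exact: nbhs_right_gt.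
by move=> /filter_ex[rho [rho0 Krho]]; exists rho.
Unshelve. all: by end_near. Qed.

(** The extensions do not depend on the centre, so that analyticity on a union of
    good polydiscs is a local matter. *)
Lemma good_radius_joint rho (U : set X) : 0 < rho ->
  (forall y, U y -> exists2 x, good_radius rho x & polydisc c3 (0, x) rho y) ->
  joint_extension U (@ext_eigval R n) (@ext_proj R n) (@ext_eigvec R n).
Proof.
move=> rho0 UP.
have ext y : U y -> 0 < y.1 -> extends_at y.
  by move=> /UP[x [_ _ _ gx] xy] y0; have [_ /(_ y0)[]] := gx y xy.
split.
- by move=> y Uy y0; have [? ? _] := ext y Uy y0.
- move=> k kn; split; last first.
    by move=> y Uy y0; have [_ _ [-> // _ _]] := ext y Uy y0.
  move=> y /UP[x [g _ _ _] xy]; have [C ps] := g k kn.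
  exact: ps_analytic_on rho0 ps _ xy.
- move=> k kn i j; split; last first.
    by move=> y Uy y0; have [_ _ [_ -> // _]] := ext y Uy y0.
  move=> y /UP[x [_ g _ _] xy]; have [C ps] := g k kn i j.
  exact: ps_analytic_on rho0 ps _ xy.
- move=> k kn i j; split; last first.
    by move=> y Uy y0; have [_ _ [_ _ -> //]] := ext y Uy y0.
  move=> y /UP[x [_ _ g _] xy]; have [C ps] := g k kn i j.
  exact: ps_analytic_on rho0 ps _ xy.
Qed.

Lemma time_line_ps x rho C (f : X -> R) : 0 < rho -> power_series c3 (0, x) rho C f ->
  power_series (@coord1 R) 0 rho C (fun T => f (T, x)).
Proof.
move=> rho0 psf; apply: (ps_analytic_line (phi := fun T => (T, x)) (i0 := inl tt) rho0 psf).
  by move=> T; rewrite /= subr0.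
by move=> T [[]|i].
Qed.

Lemma time_line_polydisc x rho T : `|T| < rho -> polydisc c3 (0, x) rho (T, x).
Proof.
move=> Tr [[]|i] /=; first by rewrite subr0.
by rewrite subrr normr0; exact: le_lt_trans Tr.
Qed.

Lemma mx_norm_le m p (M : 'M[R]_(m, p)) C : 0 <= C ->
  (forall i j, `|M i j| <= C) -> `|M| <= C.
Proof.
move=> C0 MC; rewrite [leLHS]/Num.norm /= mx_normrE.
by apply: bigmax_le => // -[i j] _; exact: MC.
Qed.

Lemma remainders_norm rho x T : 0 < T -> 0 < rho -> remainders_bounded rho^-1 (T, x) ->
  [/\ forall k, (1 <= k <= n)%N -> `|eigval_remainder T x.1 x.2 k| <= rho^-1 * T ^+ 2,
      forall k, (1 <= k < n)%N -> `|spectral_proj_remainder T x.1 x.2 k| <= rho^-1 * T ^+ 2 &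
      forall k, (1 <= k <= n)%N -> `|eigvec_remainder T x.1 x.2 k| <= rho^-1 * T ^+ 2].
Proof.
move=> T0 rho0 [b1 b2 b3].
have C0 : 0 <= rho^-1 * T ^+ 2 by rewrite mulr_ge0 ?sqr_ge0 // invr_ge0 ltW.
split=> k kn; first exact: b1.
- by apply: mx_norm_le => // i j; exact: b2.
- by apply: mx_norm_le => // i j; exact: b3.
Qed.

End UniformExtension.

Theorem theorem1 (R : realType) (n : nat) :
  (forall (A : 'M[R]_n) (b : 'cV[R]_n), controllable A b ->
   exists T0 : R, 0 < T0 /\
   (forall T : R, 0 < T < T0 ->
      strictly_ordered T A b /\ eigenspaces_not_orthogonal T A b) /\
   (* (i) *)
   (forall k : nat, (1 <= k <= n)%N ->
      (exists (U : set R) (F : R -> R), open_nbhs 0 U /\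
         analytic_extension (@coord1 R) U `]0, T0[
           (fun T => normalized_eigval T A b k) F) /\
      (fun T : R => eigval_remainder T A b k) =O_ (0^'+) (fun T : R => T ^+ 2)) /\
   (* (ii) *)
   (forall k : nat, (1 <= k < n)%N ->
      (exists (U : set R) (F : R -> 'M[R]_n), open_nbhs 0 U /\
         mx_analytic_extension (@coord1 R) U `]0, T0[
           (fun T => spectral_proj T A b k) F) /\
      (fun T : R => spectral_proj_remainder T A b k) =O_ (0^'+) (fun T : R => T ^+ 2)) /\
   (* (iii) *)
   (forall k : nat, (1 <= k <= n)%N ->
      (exists (U : set R) (F : R -> 'cV[R]_n), open_nbhs 0 U /\
         mx_analytic_extension (@coord1 R) U `]0, T0[
           (fun T => eigvec T A b k) F) /\
      (fun T : R => eigvec_remainder T A b k) =O_ (0^'+) (fun T : R => T ^+ 2))) /\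
  (* (iv), locally *)
  (forall (A0 : 'M[R]_n) (b0 : 'cV[R]_n), controllable A0 b0 ->
   exists (U : set (R * ('M[R]_n * 'cV[R]_n))) L P Psi,
     open_nbhs (0, (A0, b0)) U /\ joint_extension U L P Psi) /\
  (* (iv), on compact sets *)
  (forall K : set ('M[R]_n * 'cV[R]_n), compact K ->
   (forall x, K x -> controllable x.1 x.2) ->
   exists (TK : R) (UK : set ('M[R]_n * 'cV[R]_n)) L P Psi,
     0 < TK /\ open UK /\ K `<=` UK /\
     (forall x, UK x -> controllable x.1 x.2) /\
     joint_extension (`]- TK, TK[ `*` UK) L P Psi /\
     (forall x, K x ->
        (forall k : nat, (1 <= k <= n)%N ->
           taylor_at0_converges TK (fun T => L k (T, x))) /\
        (forall k : nat, (k <= n)%N -> forall i j,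
           taylor_at0_converges TK (fun T => P k (T, x) i j)) /\
        (forall k : nat, (1 <= k <= n)%N -> forall i j,
           taylor_at0_converges TK (fun T => Psi k (T, x) i j))) /\
     exists C : R, forall x, K x -> forall T : R, 0 < T < TK ->
       (forall k : nat, (1 <= k <= n)%N ->
          `|eigval_remainder T x.1 x.2 k| <= C * T ^+ 2) /\
       (forall k : nat, (1 <= k < n)%N ->
          `|spectral_proj_remainder T x.1 x.2 k| <= C * T ^+ 2) /\
       (forall k : nat, (1 <= k <= n)%N ->
          `|eigvec_remainder T x.1 x.2 k| <= C * T ^+ 2)).
Proof.
have good1 (A : 'M[R]_n) (b : 'cV[R]_n) : controllable A b ->
    exists2 rho, 0 < rho & good_radius rho (A, b).
  move=> Ab; have [x -> //|rho rho0 g] := @good_radius_compact R n [set (A, b)] (@compact_set1 _ _).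
  by exists rho => //; exact: g.
split; [|split].
- move=> A b /good1[rho rho0 g]; have [g1 g2 g3 g4] := g; exists rho; split=> //.
  have inD T : 0 < T < rho -> extends_at (T, (A, b)) /\ remainders_bounded rho^-1 (T, (A, b)).
    move=> /andP[T0 Tr]; have [|_ h] := g4 (T, (A, b)); last exact: h.
    by apply: time_line_polydisc; rewrite gtr0_norm.
  have near_rho : \forall T \near (0 : R)^'+, 0 < T < rho.
    near=> T; apply/andP; split; near: T; [exact: nbhs_right_gt|exact: nbhs_right_lt].
  have bigO (V : normedModType R) (f : R -> V) :
      (forall T, 0 < T < rho -> `|f T| <= rho^-1 * T ^+ 2) -> f =O_ (0^'+) (fun T : R => T ^+ 2).
    move=> fC; apply/eqO_exP; exists rho^-1; first by rewrite invr_gt0.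
    by apply: filterS near_rho => T Tr; rewrite [`|T ^+ 2|]ger0_norm ?sqr_ge0 //; exact: fC.
  have rem T : 0 < T < rho -> _ := fun Tr =>
    @remainders_norm R n rho (A, b) T (proj1 (andP Tr)) rho0 (inD T Tr).2.
  have U0 : open_nbhs (0 : R) `]- rho, rho[.
    by split; [exact: interval_open|rewrite /= in_itv /= oppr_lt0 rho0].
  have Uan C (f : R * ('M[R]_n * 'cV[R]_n) -> R) : power_series (@coord3 R n) (0, (A, b)) rho C f ->
      analytic_on (@coord1 R) `]- rho, rho[ (fun T => f (T, (A, b))).
    move=> /(time_line_ps rho0) psf T; rewrite /= in_itv /= => Tr.
    apply: (ps_analytic_on rho0 psf) => -[]; rewrite /coord1 subr0 ltr_norml.
    exact: Tr.
  split; [|split; [|split]].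
  + by move=> T /inD[[]].
  + move=> k kn; split; last by apply: bigO => T /rem[h _ _]; exact: h.
    exists `]- rho, rho[%classic, (fun T => ext_eigval k (T, (A, b))); split=> //.
    split; first by have [C ps] := g1 k kn; exact: Uan ps.
    move=> T _; rewrite /= in_itv /= => /inD[[_ _ [h _ _]] _].
    by rewrite -(h k kn).
  + move=> k kn; split; last by apply: bigO => T /rem[_ h _]; exact: h.
    have kn' : (k <= n)%N by case/andP: kn => _ /ltnW.
    exists `]- rho, rho[%classic, (fun T => ext_proj k (T, (A, b))); split=> // i j.
    split; first by have [C ps] := g2 k kn' i j; exact: Uan ps.
    move=> T _; rewrite /= in_itv /= => /inD[[_ _ [_ h _]] _].
    by rewrite -(h k kn').
  + move=> k kn; split; last by apply: bigO => T /rem[_ _ h]; exact: h.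
    exists `]- rho, rho[%classic, (fun T => ext_eigvec k (T, (A, b))); split=> // i j.
    split; first by have [C ps] := g3 k kn i j; exact: Uan ps.
    move=> T _; rewrite /= in_itv /= => /inD[[_ _ [_ _ h]] _].
    by rewrite -(h k kn).
- move=> A b /good1[rho rho0 g].
  exists (ball ((0 : R), (A, b)) rho)^°, (@ext_eigval R n), (@ext_proj R n), (@ext_eigvec R n).
  split.
    by split; [exact: open_interior|exact: nbhsx_ballx].
  apply: (good_radius_joint rho0) => y /interior_subset yr.
  by exists (A, b) => //; rewrite polydisc_ball.
- move=> K cK Kc; have [rho rho0 g] := good_radius_compact cK Kc.
  exists rho, (\bigcup_(x in K) (ball x rho)^°).
  exists (@ext_eigval R n), (@ext_proj R n), (@ext_eigvec R n).
  have UP x : (\bigcup_(x in K) (ball x rho)^°) x -> forall T, `|T| < rho ->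
      exists2 x', K x' & polydisc (@coord3 R n) (0, x') rho (T, x).
    move=> [x' Kx' /interior_subset xx'] T Tr; exists x' => //.
    by rewrite polydisc_ball //; split => //=; rewrite /ball /= sub0r normrN.
  split=> //; split; first by apply: bigcup_open => x _; exact: open_interior.
  split; first by move=> x Kx; exists x => //; exact: nbhsx_ballx.
  split.
    move=> x /UP/(_ 0)[]; first by rewrite normr0.
    by move=> x' Kx' xr; have [_ _ _ /(_ _ xr)[]] := g x' Kx'.
  split.
    apply: (good_radius_joint rho0) => -[T x] /= [Tr /UP/(_ T)[]].
      by move: Tr; rewrite /= in_itv /= ltr_norml.
    by move=> x' Kx' xr; exists x' => //; exact: g.
  split.
    move=> x Kx; have [g1 g2 g3 _] := g x Kx; split; [|split].
    + by move=> k kn; have [C ps] := g1 k kn; exact: power_series_taylor (time_line_ps rho0 ps).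
    + by move=> k kn i j; have [C ps] := g2 k kn i j; exact: power_series_taylor (time_line_ps rho0 ps).
    + by move=> k kn i j; have [C ps] := g3 k kn i j; exact: power_series_taylor (time_line_ps rho0 ps).
  exists rho^-1 => x Kx T /andP[T0 Tr]; have [_ _ _ g4] := g x Kx.
  have [|_ /(_ T0)[_ b]] := g4 (T, x).
    by apply: time_line_polydisc; rewrite gtr0_norm.
  by have [b1 b2 b3] := remainders_norm T0 rho0 b; split; [|split].
Unshelve. all: by end_near.
Qed.
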